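(* Let $\bar t>0$, $I=(0,\bar t)$, let $\gamma_1,\gamma_2\in\mathrm{Lip}(I)$ (extended continuously to $\bar I$) with $\gamma_1<0<\gamma_2$ on $I$, $\gamma_1(0)=\gamma_1(\bar t)=\gamma_2(0)=\gamma_2(\bar t)=0$, and such that $D=\{(y,t)\in\mathbb W: t\in I,\ \gamma_1(t)<y<\gamma_2(t)\}$ is convex. Let $\phi\in C(\partial D)$ with $\phi_1,\phi_2\in\mathrm{Lip}(I)$, and assume $$\zeta<\frac{\sqrt{721}-25}{48}.$$ Let $u\in\mathrm{Lip}(D)$ be the function with $u=\phi$ on $\partial D$ and $S_u=R_\phi$, and let $D^r\subset\mathbb W$ open and $u^r\in\mathrm{Lip}_{loc}(D^r)$ be such that $S_u=S^r_{u^r}$. Then $$\mathcal A_H(u)=P_H(E_u;D\cdot\mathbb V)=P_H(E^r_{u^r};\mathbb V\cdot D^r)\le P_H(F;\mathbb V\cdot D^r)$$ for every Lebesgue measurable set $F\subset\mathbb H$ such that $E^r_{u^r}\,\Delta\,F\Subset\mathbb V\cdot D^r$.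
   Context: $\mathbb H$ is $\mathbb R^3$ with product $(x,y,t)\cdot(\xi,\eta,\tau)=(x+\xi,y+\eta,t+\tau+2(y\xi-x\eta))$; $X=\partial_x+2y\partial_t$, $Y=\partial_y-2x\partial_t$, $H_p=\mathrm{span}\{X(p),Y(p)\}$. $\mathbb W=\{x=0\}$ with coordinates $(y,t)$. For $D\subset\mathbb W$, $u:D\to\mathbb R$: $S_u=\{(u(y,t),y,t+2yu(y,t)):(y,t)\in D\}$, $E_u=\{(s,y,t+2ys):(y,t)\in D,\ s>u(y,t)\}$, $D\cdot\mathbb V=\{(s,y,t+2ys):(y,t)\in D,\ s\in\mathbb R\}$. For $D^r\subset\mathbb W$, $v:D^r\to\mathbb R$: $S^r_v=\{(v(y,t),y,t-2yv(y,t))\}$, $E^r_v=\{(s,y,t-2ys):(y,t)\in D^r,\ s>v(y,t)\}$, $\mathbb V\cdot D^r=\{(s,y,t-2ys):(y,t)\in D^r,\ s\in\mathbb R\}$. $H$-perimeter of a measurable $E$ in an open $\Omega$: $P_H(E;\Omega)=\sup\{\int_E (Xv_1+Yv_2)\,d\mathcal L: v_1,v_2\in C^1_c(\Omega),\ \sup(v_1^2+v_2^2)^{1/2}\le1\}$. Area: $\mathcal A_H(u)=\int_D\sqrt{1+(\mathcal Bu)^2}\,dy\,dt$ with $\mathcal Bu=\partial_yu-2\partial_t(u^2)$. Set $\phi_i(s)=\phi(\gamma_i(s),s)$, $\|\gamma\|_\infty=\max_i\|\gamma_i\|_\infty$, $\mathrm{Lip}(\gamma)=\max_i\mathrm{Lip}(\gamma_i)$,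 $\|\phi\|_\infty=\max_i\|\phi_i\|_\infty$, $\mathrm{Lip}(\phi)=\max_i\mathrm{Lip}(\phi_i)$, $\zeta=4(\|\gamma\|_\infty+\mathrm{Lip}(\gamma))(\|\phi\|_\infty+\mathrm{Lip}(\phi))$. Let $p_i(s)=(\phi_i(s),\gamma_i(s),s+2\gamma_i(s)\phi_i(s))$; for $\zeta<1$, $\lambda(s)\in\bar I$ is the unique point with $p_2(\lambda(s))-p_1(s)\in H_{p_1(s)}$, $\rho(h,s)=(1-h)p_1(s)+h\,p_2(\lambda(s))$ on $Q=(0,1)\times I$, and $R_\phi=\rho(Q)$. Under the stated smallness of $\zeta$ the paper shows that a Lipschitz $u$ with $u=\phi$ on $\partial D$ and $S_u=R_\phi$, and a right graph representation $S_u=S^r_{u^r}$ with $u^r$ locally Lipschitz on an open $D^r$, exist. *)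

(* Defs.v *)
From mathcomp Require Import all_boot all_order all_algebra.
From mathcomp Require Import all_classical all_reals all_analysis.
Import numFieldNormedType.Exports.
Import Order.TTheory GRing.Theory Num.Theory.
Set Implicit Arguments.
Unset Strict Implicit.
Unset Printing Implicit Defensive.
Local Open Scope ring_scope.
Local Open Scope classical_set_scope.

(* Points of the Heisenberg group H = R^3 are encoded as ((x, y), t);
   points of the vertical plane W = {x = 0} are encoded as (y, t). *)

Definition leb2 (R : realType) :=
  product_measure1 (@lebesgue_measure R) (@lebesgue_measure R).
Definition leb3 (R : realType) :=
  product_measure1 (@leb2 R) (@lebesgue_measure R).

(* Lebesgue measurability in R^3: F differs from a Borel set by a subset of
   a Borel null set (i.e. F belongs to the completion of leb3). *)
Definition leb3_measurable (R : realType) (F : set (R * R * R)) : Prop :=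
  exists B N : set (R * R * R),
    measurable B /\ measurable N /\ @leb3 R N = 0%E /\
    ((F `\` B) `|` (B `\` F)) `<=` N.

Definition dx (R : realType) (v : R * R * R -> R) (p : R * R * R) : R :=
  derive1 (fun s => v ((s, p.1.2), p.2)) p.1.1.
Definition dy (R : realType) (v : R * R * R -> R) (p : R * R * R) : R :=
  derive1 (fun s => v ((p.1.1, s), p.2)) p.1.2.
Definition dt (R : realType) (v : R * R * R -> R) (p : R * R * R) : R :=
  derive1 (fun s => v ((p.1.1, p.1.2), s)) p.2.

(* left-invariant horizontal vector fields X = d_x + 2y d_t, Y = d_y - 2x d_t *)
Definition Xf (R : realType) (v : R * R * R -> R) (p : R * R * R) : R :=
  dx v p + 2 * p.1.2 * dt v p.
Definition Yf (R : realType) (v : R * R * R -> R) (p : R * R * R) : R :=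
  dy v p - 2 * p.1.1 * dt v p.

Definition C1 (R : realType) (v : R * R * R -> R) : Prop :=
  (forall p : R * R * R,
     derivable (fun s => v ((s, p.1.2), p.2)) p.1.1 1 /\
     derivable (fun s => v ((p.1.1, s), p.2)) p.1.2 1 /\
     derivable (fun s => v ((p.1.1, p.1.2), s)) p.2 1) /\
  continuous (dx v) /\ continuous (dy v) /\ continuous (dt v).

Definition cpt_in (T : topologicalType) (A O : set T) : Prop :=
  compact (closure A) /\ closure A `<=` O.

Definition C1c (R : realType) (O : set (R * R * R)) (v : R * R * R -> R) : Prop :=
  C1 v /\ cpt_in [set p | v p != 0] O.

Definition HPer (R : realType) (E O : set (R * R * R)) : \bar R :=
  ereal_sup [set r | exists v1 v2 : R * R * R -> R,
     C1c O v1 /\ C1c O v2 /\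
     (forall p, Num.sqrt (v1 p ^+ 2 + v2 p ^+ 2) <= 1) /\
     r = (\int[@leb3 R]_(p in E) (Xf v1 p + Yf v2 p)%:E)%E].

Definition Bop (R : realType) (u : R * R -> R) (q : R * R) : R :=
  derive1 (fun s => u (s, q.2)) q.1 - 2 * derive1 (fun s => u (q.1, s) ^+ 2) q.2.

Definition AreaH (R : realType) (D : set (R * R)) (u : R * R -> R) : \bar R :=
  (\int[@leb2 R]_(q in D) (Num.sqrt (1 + Bop u q ^+ 2))%:E)%E.

Definition Sgraph (R : realType) (D : set (R * R)) (u : R * R -> R) : set (R * R * R) :=
  [set ((u q, q.1), q.2 + 2 * q.1 * u q) | q in D].
Definition Egraph (R : realType) (D : set (R * R)) (u : R * R -> R) : set (R * R * R) :=
  [set p | exists q s, D q /\ u q < s /\ p = ((s, q.1), q.2 + 2 * q.1 * s)].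
Definition DV (R : realType) (D : set (R * R)) : set (R * R * R) :=
  [set p | exists q s, D q /\ p = ((s, q.1), q.2 + 2 * q.1 * s)].

Definition Sgraph_r (R : realType) (D : set (R * R)) (v : R * R -> R) : set (R * R * R) :=
  [set ((v q, q.1), q.2 - 2 * q.1 * v q) | q in D].
Definition Egraph_r (R : realType) (D : set (R * R)) (v : R * R -> R) : set (R * R * R) :=
  [set p | exists q s, D q /\ v q < s /\ p = ((s, q.1), q.2 - 2 * q.1 * s)].
Definition VD (R : realType) (D : set (R * R)) : set (R * R * R) :=
  [set p | exists q s, D q /\ p = ((s, q.1), q.2 - 2 * q.1 * s)].

(* Lipschitz / locally Lipschitz (max norm on R^2; any norm gives the same notion) *)
Definition lip1_on (R : realType) (A : set R) (f : R -> R) : Prop :=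
  exists k : R, forall s s', A s -> A s' -> `|f s - f s'| <= k * `|s - s'|.
Definition dist2 (R : realType) (q q' : R * R) : R :=
  Num.max `|q.1 - q'.1| `|q.2 - q'.2|.
Definition lip2_on (R : realType) (A : set (R * R)) (f : R * R -> R) : Prop :=
  exists k : R, forall q q', A q -> A q' -> `|f q - f q'| <= k * dist2 q q'.
Definition loclip2_on (R : realType) (A : set (R * R)) (f : R * R -> R) : Prop :=
  forall q, A q -> exists r : R, 0 < r /\
    lip2_on (A `&` [set q' | dist2 q q' < r]) f.

Definition supnorm (R : realType) (I : set R) (f : R -> R) : R :=
  sup [set `|f s| | s in I].
Definition lipconst (R : realType) (I : set R) (f : R -> R) : R :=
  sup [set r | exists s s', I s /\ I s' /\ s != s' /\
                 r = `|f s - f s'| / `|s - s'|].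

Definition pcurve (R : realType) (g f : R -> R) (s : R) : R * R * R :=
  ((f s, g s), s + 2 * g s * f s).
(* w belongs to H_p = span {X(p), Y(p)}, X(p) = (1,0,2y), Y(p) = (0,1,-2x) *)
Definition horiz (R : realType) (p w : R * R * R) : Prop :=
  exists a b : R, w = ((a, b), a * (2 * p.1.2) + b * (- 2 * p.1.1)).
Definition vsub (R : realType) (p q : R * R * R) : R * R * R :=
  ((p.1.1 - q.1.1, p.1.2 - q.1.2), p.2 - q.2).
Definition vcomb (R : realType) (h : R) (p q : R * R * R) : R * R * R :=
  (((1 - h) * p.1.1 + h * q.1.1, (1 - h) * p.1.2 + h * q.1.2),
    (1 - h) * p.2 + h * q.2).

(* R_phi = rho(Q), where rho(h,s) = (1-h) p1(s) + h p2(lambda(s)) and lambda(s)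
   is the (unique, for zeta < 1) point of [0,tbar] with p2(lambda(s)) - p1(s)
   in H_{p1(s)}. *)
Definition Rphi (R : realType) (tbar : R) (g1 g2 f1 f2 : R -> R) : set (R * R * R) :=
  [set p | exists h s l, 0 < h < 1 /\ 0 < s < tbar /\ 0 <= l <= tbar /\
     horiz (pcurve g1 f1 s) (vsub (pcurve g2 f2 l) (pcurve g1 f1 s)) /\
     p = vcomb h (pcurve g1 f1 s) (pcurve g2 f2 l)].

Definition convex2 (R : realType) (D : set (R * R)) : Prop :=
  forall q q' a, D q -> D q' -> 0 <= a <= 1 ->
    D ((1 - a) * q.1 + a * q'.1, (1 - a) * q.2 + a * q'.2).

(* Main.v *)
From HB Require Import structures.
Require Import Defs.
From mathcomp Require Import all_boot all_order all_algebra.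
From mathcomp Require Import all_classical all_reals all_analysis.
From mathcomp Require Import measurable_realfun ring lra.
Import numFieldNormedType.Exports.
Import Order.TTheory GRing.Theory Num.Theory.
Local Open Scope ring_scope.
Local Open Scope classical_set_scope.
Import HBNNSimple.
Set Implicit Arguments.
Unset Strict Implicit.
Unset Printing Implicit Defensive.

(* The horizontal segments that rule the graph of [u] project from the left onto
   parabolas foliating [D], along which [u] is affine.  Their slope [b] is locally
   Lipschitz and equals [Bop u] wherever [u] is derivable in [t], hence almost everywhere.
   Differentiating along the flows of [X] and [Y] shows that the integral over [E_u] of the
   divergence of a compactly supported field [(v1, v2)] is the integral over [D] of
   [- v1 + b * v2] on the graph; as [E_u] and [E^r] agree near the graph, a cutoff
   transfers this to [E^r].  By Cauchy-Schwarz both perimeters are at most the area.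

   In right coordinates the leaves are the parabolas [t = c + 2 b(c) y^2], so the form
   [b dt - 2 y b^2 dy] has a potential [psi], and the unit normal [(-1, b) / sqrt (1 + b^2)],
   extended constantly along the right fibres, is formally divergence free.  Replacing [b]
   by a centered difference quotient of [psi] of step [e] gives a C^1 field whose divergence
   is [O(e)] on compact sets.  Testing with it bounds the perimeter of [E_u], and of every
   compactly supported perturbation of [E^r], from below by the area. *)

(** * Derivability of Lipschitz functions *)

(** The obstacle is regularity. The slope [b] is only locally Lipschitz, so the unit normal extended
    along the right fibres is not an admissible C^1 test field. Smoothing [b] directly would disturb
    the nonlinear equation [b_y + 4 y b b_t = 0], as the average of [b^2] is not the square of the
    average of [b]. The potential settles both points: its gradient [(- 2 y b^2, b)] is continuous,
    so its difference quotients are C^1, and in their divergence the quotient of [b^2] factors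
    through the quotient of [b], which the Lipschitz bound controls. In this way [b] itself is never
    differentiated. The smallness of [zeta] enters in one place: it prevents a ruling from ending at
    a corner of [D]. Every leaf then crosses the axis [y = 0], where the leaves can be labelled and
    the potential can be started. *)

Lemma lipschitz_continuous (R : realType) (g : R -> R) (k : R) :
  (forall x y, `|g x - g y| <= k * `|x - y|) -> continuous g.
Proof.
move=> gk x; apply/cvgrPdist_lt => e e0.
have k1 : 0 < `|k| + 1 by rewrite ltr_wpDl.
near=> y.
apply: (le_lt_trans (gk x y)).
apply: (@le_lt_trans _ _ ((`|k| + 1) * `|x - y|)).
  by rewrite ler_wpM2r// (le_trans (ler_norm k))// lerDl.
rewrite mulrC -ltr_pdivlMr//.
near: y; apply: cvgr_dist_lt => //; exact: divr_gt0.
Unshelve. all: by end_near. Qed.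

(** Both [h] and [C * x - h x] are nondecreasing, and their Stieltjes measures add up to [C] times
    Lebesgue measure. The measure of [h] is therefore absolutely continuous, [h] is the integral of
    its Radon-Nikodym density, and the fundamental theorem of calculus applies. The constant ends
    give this measure the total mass 1. *)
Lemma clamped_lipschitz_ae_derivable (R : realType) (h : R -> R) (C N : R) :
  0 < C -> {homo h : x y / x <= y} ->
  (forall x y, `|h x - h y| <= C * `|x - y|) ->
  (forall x, x <= - N -> h x = 0) -> (forall x, N <= x -> h x = 1) ->
  {ae (@lebesgue_measure R), forall x, derivable h x 1}.
Proof.
move=> C0 hnd hC h0 h1.
have hc : continuous h by exact: lipschitz_continuous hC.
have hrc : right_continuous h by exact: right_continuousW.
have hNy : h @ -oo --> (0:R).
  apply: cvg_near_cst; near=> x; apply: h0; near: x; apply: nbhs_ninfty_le; exact: num_real.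
have hy : h @ +oo --> (1:R).
  apply: cvg_near_cst; near=> x; apply: h1; near: x; apply: nbhs_pinfty_ge; exact: num_real.
pose H : cumulativeBounded (0:R) (1:R) := HB.pack h
  (isCumulative.Build R _ R h hnd hrc)
  (isCumulativeBounded.Build R 0 1 h hNy hy).
pose g x := C * x - h x.
have gnd : {homo g : x y / x <= y}.
  move=> x y xy; rewrite /g.
  have := hC y x; rewrite (ger0_norm (_ : 0 <= y - x)) ?subr_ge0// => H1.
  have := le_trans (ler_norm _) H1; lra.
have gc : continuous g.
  move=> x; apply: cvgB; last exact: hc.
  by apply: cvgM; [exact: cvg_cst|exact: cvg_id].
have grc : right_continuous g by exact: right_continuousW.
pose G : cumulative R R := HB.pack g (isCumulative.Build R _ R g gnd grc).
pose nu := lebesgue_stieltjes_measure H.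
pose nu' := lebesgue_stieltjes_measure G.
have C0' : 0 <= C^-1 by rewrite invr_ge0 ltW.
(* Half-open intervals get their length, since [h] and [g] add up to [C * x]; uniqueness of Lebesgue
   measure does the rest. *)
pose mu := mscale (NngNum C0') (measure_add nu nu').
have muE0 A : mu A = ((C^-1)%:E * (nu A + nu' A))%E.
  exact: (congr1 (fun z => (C^-1)%:E * z)%E (measure_addE nu nu' A)).
have muE A : measurable A -> lebesgue_measure A = mu A.
  apply: lebesgue_measure_unique => _ [[a b] _ <-].
  transitivity (mu `]a, b]%classic) => //; rewrite muE0.
  rewrite /nu /nu' /lebesgue_stieltjes_measure /measure_extension.
  rewrite !measurable_mu_extE/=; [|exact: is_ocitv..].
  rewrite lebesgue_measure_itv/= lte_fin.
  rewrite !wlength_itv/= !lte_fin.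
  case: ifP => ab; last by rewrite adde0 mule0.
  rewrite -!EFinB -EFinD -EFinM; congr (_%:E).
  rewrite /g/=; field; exact: lt0r_neq0.
have numu : nu `<< (@lebesgue_measure R).
  apply/null_content_dominatesP => A mA lA0.
  have := muE A mA; rewrite muE0 (_ : lebesgue_measure A = 0%E)//.
  move/esym/eqP; rewrite mule_eq0 eqe invr_eq0 (gt_eqF C0)/=.
  by rewrite padde_eq0// => /andP[/eqP].
have [f [f0 ffin intf fE]] := @radon_nikodym_sigma_finite _ _ _ (@lebesgue_measure R) nu numu.
pose F x := fine (f x).
have fF : f = EFin \o F by apply/funext => x /=; rewrite fineK.
have hF x : h x = (\int[lebesgue_measure]_(t in `]-oo, x]) F t)%R.
  have : nu `]-oo, x] = (h x)%:E.
    have cvg1 : nu \o (fun n : nat => `](- n%:R), x]%classic) @ \oo --> nu (\bigcup_n `](- n%:R), x]%classic).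
      apply: nondecreasing_cvg_mu => //.
        exact: bigcup_measurable.
      move=> m n mn; apply/subsetPset/subset_itvr.
      by rewrite bnd_simp lerN2 ler_nat.
    have cupE : \bigcup_n `](- n%:R), x]%classic = `]-oo, x].
      apply/seteqP; split => [z [n _]|z] /=; rewrite !in_itv/=; first by case/andP.
      move=> zx; exists (Num.bound z) => //=; rewrite in_itv/= zx andbT.
      by rewrite ltrNl mathcomp.classical.unstable.ltrNbound.
    rewrite cupE in cvg1; apply: (cvg_unique _ cvg1) => //.
    apply: cvg_near_cst; near=> n => /=.
    rewrite /nu /lebesgue_stieltjes_measure /measure_extension.
    rewrite measurable_mu_extE/=; last exact: is_ocitv.
    rewrite wlength_itv/= lte_fin.
    have nx : - n%:R < x.
      rewrite ltrNl; near: n; exact: nbhs_infty_gtr.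
    have nN : - n%:R <= - N.
      rewrite lerN2; near: n; exact: nbhs_infty_ger.
    by rewrite nx/= (h0 _ nN) sube0.
  move=> nuE; have := etrans (esym nuE) (fE `]-oo, x]%classic (measurable_itv _)).
  by rewrite fF /Rintegral => <-.
have intF : (@lebesgue_measure R).-integrable setT (EFin \o F) by rewrite -fF.
have := @FTC1Ny R F _ _.
rewrite (_ : (fun x => _) = h); last by apply/funext => x; rewrite -hF.
move=> FTC; have : {ae (@lebesgue_measure R), forall x, derivable h x 1 /\ h^`() x = F x}.
  apply: FTC; first by move=> y; apply: integrableS intF.
  by apply: open_integrable_locally => //; exact: openT.
by apply: filterS; [exact: (ae_filter_ringOfSetsType (@lebesgue_measure R))|move=> x []].
Unshelve. all: by end_near. Qed.

(** Adding [2 * k1 * x] produces a function [H] with slopes between [k1] and [3 * k1]. Clamping its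
    argument to [[- n.+1, n.+1]] and normalising its range to [[0, 1]] reduces to the previous case.
    Near a given [x] the clamp is invisible for large [n], and only countably many null sets are
    discarded. *)
Lemma lipschitz_ae_derivable (R : realType) (g : R -> R) (k : R) :
  (forall x y, `|g x - g y| <= k * `|x - y|) ->
  {ae (@lebesgue_measure R), forall x, derivable g x 1}.
Proof.
move=> gk.
pose k1 := `|k| + 1.
have k10 : 0 < k1 by rewrite ltr_wpDl.
have gk1 x y : `|g x - g y| <= k1 * `|x - y|.
  by rewrite (le_trans (gk _ _))// ler_wpM2r// (le_trans (ler_norm k))// lerDl.
pose H x := g x + 2 * k1 * x.
have Hle x y : x <= y -> k1 * (y - x) <= H y - H x <= 3 * k1 * (y - x).
  move=> xy; have := gk1 y x; rewrite (ger0_norm (_ : 0 <= y - x)) ?subr_ge0//.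
  by rewrite ler_norml /H => /andP[? ?]; apply/andP; split; lra.
pose cl (n : nat) (x : R) := Num.max (- n.+1%:R) (Num.min x n.+1%:R).
pose d (n : nat) := H n.+1%:R - H (- n.+1%:R).
have d0 n : 0 < d n.
  have := Hle (- n.+1%:R) n.+1%:R; rewrite ge0_cp// => /(_ isT)/andP[+ _].
  by apply: lt_le_trans; rewrite mulr_gt0// opprK addr_gt0.
pose h n x := (H (cl n x) - H (- n.+1%:R)) / d n.
have clle n x y : x <= y -> cl n x <= cl n y /\ cl n y - cl n x <= y - x.
  move=> xy; rewrite /cl; have : 0 < n.+1%:R :> R by [].
  by rewrite /Num.max /Num.min; do ![case: ifPn]; rewrite -?leNgt; lra.
have hle n x y : x <= y -> 0 <= h n y - h n x <= 3 * k1 / d n * (y - x).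
  move=> xy; have [c1 c2] := clle n _ _ xy; have /andP[H1 H2] := Hle _ _ c1.
  rewrite /h -mulrBl opprB addrA subrK.
  rewrite divr_ge0 ?(ltW (d0 n))//=; last first.
    by rewrite (le_trans _ H1)// mulr_ge0 ?(ltW k10)// subr_ge0.
  rewrite mulrAC ler_pM2r ?invr_gt0// (le_trans H2)// ler_wpM2l//.
  by rewrite mulr_ge0 ?(ltW k10).
have hder n : {ae (@lebesgue_measure R), forall x, derivable (h n) x 1}.
  apply: (@clamped_lipschitz_ae_derivable R _ (3 * k1 / d n) n.+1%:R).
  - by rewrite divr_gt0// mulr_gt0.
  - by move=> x y /(hle n)/andP[+ _]; rewrite subr_ge0.
  - move=> x y; wlog xy : x y / x <= y => [hw|].
      by case: (leP x y) => [/hw//|/ltW/hw]; rewrite distrC (distrC y).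
    have /andP[h1 h2] := hle n _ _ xy.
    by rewrite distrC (ger0_norm h1) distrC ger0_norm ?subr_ge0.
  - move=> x xn; rewrite /h (_ : cl n x = - n.+1%:R) ?subrr ?mul0r//.
    by rewrite /cl min_l ?max_l// (le_trans xn)// ge0_cp.
  - move=> x xn; have cE : cl n x = n.+1%:R.
      by rewrite /cl min_r// max_r// ge0_cp.
    by rewrite /h cE -/(d n) divff// lt0r_neq0.
have : {ae (@lebesgue_measure R), forall x n, derivable (h n) x 1}.
  exact: ae_foralln.
apply: filterS; first exact: (ae_filter_ringOfSetsType (@lebesgue_measure R)).
move=> x hx; near \oo => n.
have xn : - n.+1%:R < x < n.+1%:R.
  rewrite -ltr_norml; near: n.
  have := nbhs_infty_gtr `|x|; apply: filterS => n nx.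
  by rewrite (lt_trans nx)// ltr_nat.
have {}hx := hx n.
have e : \near x, d n * h n x + H (- n.+1%:R) - 2 * k1 * x = g x.
  have : \near x, - n.+1%:R < x < n.+1%:R.
    have := near_in_itvoo; move=> /(_ R (- n.+1%:R) n.+1%:R x).
    rewrite in_itv/= => /(_ xn); apply: filterS => z; by rewrite in_itv.
  apply: filterS => z /andP[z1 z2].
  rewrite /h (_ : cl n z = z); last by rewrite /cl min_l ?max_r ?ltW.
  by rewrite mulrC divfK ?lt0r_neq0// subrK /H addrK.
apply: (near_eq_derivable e).
have d1 : derivable (fun z => d n * h n z) x 1 by apply: derivableM.
have d2 : derivable (fun z => 2 * k1 * z) x 1.
  by apply: (@derivableM R R^o (cst (2 * k1)) id x 1); [exact: derivable_cst|exact: derivable_id].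
apply: (derivableB _ d2); apply: (derivableD d1); exact: derivable_cst.
Unshelve. all: by end_near. Qed.

(** * Lebesgue measure on the plane and on the Heisenberg group *)

(** The measurable sets of a product are generated by rectangles, so open sets become measurable
    through a countable base of measurable sets. The abstract neighbourhood system [nb] lets the
    property pass to products without mentioning a topology. *)
Definition measurable_nbhs_base {d} {T : measurableType d} (nb : T -> set (set T)) :=
  exists (U : countType) (B : U -> set T), (forall i, measurable (B i)) /\
    forall x A, nb x A -> exists i, B i x /\ B i `<=` A.

Lemma measurable_nbhs_base_open d (T : measurableType d) (nb : T -> set (set T)) :
  measurable_nbhs_base nb ->
  forall A : set T, (forall x, A x -> nb x A) -> measurable A.
Proof.
move=> [U [B [mB hB]]] A oA.
have -> : A = \bigcup_i (if `[< B i `<=` A >] then B i else set0).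
  apply/seteqP; split => [x Ax|x [i _]].
    have [i [Bx BA]] := hB _ _ (oA _ Ax).
    by exists i => //; case: asboolP.
  by case: asboolP => // BA /BA.
apply: countable_bigcupT_measurable; first exact: countableP.
by move=> i; case: asboolP.
Qed.

Lemma measurable_nbhs_base_R (R : realType) :
  measurable_nbhs_base (fun x : R => nbhs x).
Proof.
exists (rat * nat)%type, (fun i => ball (ratr i.1 : R) (i.2.+1%:R^-1)); split.
  by move=> i; rewrite ball_itv; exact: measurable_itv.
move=> x A /nbhs_ballP[e /= e0 eA].
have e20 : 0 < e / 2 by exact: divr_gt0.
have [n /= ne] := filter_ex (near_infty_natSinv_lt (PosNum e20)).
have n0 : 0 < n.+1%:R^-1 :> R by rewrite invr_gt0 ltr0Sn.
have [|q /=] := @rat_in_itvoo R (x - n.+1%:R^-1) (x + n.+1%:R^-1).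
  by rewrite ltrBlDr -addrA ltrDl addr_gt0.
rewrite in_itv/= => /andP[q1 q2].
exists (q, n); rewrite /ball/=; split.
  by rewrite ltr_distl q1 q2.
move=> y yq; apply: eA; rewrite /ball/=.
rewrite -(subrK (ratr q) x) -addrA (le_lt_trans (ler_normD _ _))//.
rewrite (splitr e) ltrD// (lt_trans _ ne)//.
by rewrite ltr_distlC q1 q2.
Qed.

Lemma measurable_nbhs_base_prod d1 d2 (T1 : measurableType d1) (T2 : measurableType d2)
    (n1 : T1 -> set (set T1)) (n2 : T2 -> set (set T2)) (n : T1 * T2 -> set (set (T1 * T2))) :
  (forall x A, n x A -> exists A1 A2, [/\ n1 x.1 A1, n2 x.2 A2 & A1 `*` A2 `<=` A]) ->
  measurable_nbhs_base n1 -> measurable_nbhs_base n2 -> measurable_nbhs_base n.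
Proof.
move=> hn [U1 [B1 [mB1 hB1]]] [U2 [B2 [mB2 hB2]]].
exists (U1 * U2)%type, (fun i => B1 i.1 `*` B2 i.2); split.
  by move=> i; exact: measurableX.
move=> x A /hn[A1 [A2 [/hB1[i1 [x1 s1]] /hB2[i2 [x2 s2]] sA]]].
exists (i1, i2); split => // -[y1 y2] [/= /s1 ? /s2 ?]; exact: sA.
Qed.

Lemma measurable_nbhs_base_R2 (R : realType) :
  measurable_nbhs_base (fun x : R * R => nbhs x).
Proof.
apply: (measurable_nbhs_base_prod _ (@measurable_nbhs_base_R R) (@measurable_nbhs_base_R R)).
by move=> x A [[A1 A2]/= [? ?] ?]; exists A1, A2.
Qed.

Lemma measurable_nbhs_base_R3 (R : realType) :
  measurable_nbhs_base (fun x : R * R * R => nbhs x).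
Proof.
apply: (measurable_nbhs_base_prod _ (@measurable_nbhs_base_R2 R) (@measurable_nbhs_base_R R)).
by move=> x A [[A1 A2]/= [? ?] ?]; exists A1, A2.
Qed.

Lemma open_measurable_R2 (R : realType) (A : set (R * R)) : open A -> measurable A.
Proof.
move=> oA; apply: (measurable_nbhs_base_open (@measurable_nbhs_base_R2 R)) => x Ax.
exact: open_nbhs_nbhs.
Qed.

Lemma open_measurable_R3 (R : realType) (A : set (R * R * R)) : open A -> measurable A.
Proof.
move=> oA; apply: (measurable_nbhs_base_open (@measurable_nbhs_base_R3 R)) => x Ax.
exact: open_nbhs_nbhs.
Qed.

Lemma measurable_fun_preimage_open d (T : measurableType d) (R : realType) (f : T -> R) :
  (forall A : set R, open A -> measurable (f @^-1` A)) -> measurable_fun setT f.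
Proof.
move=> mf; apply: (measurability _ (measurable_realfun.RGenOpens.measurableE R)).
by move=> _ [_ [a [b ->] <-]]; rewrite setTI; apply: mf; exact: interval_open.
Qed.

Lemma continuous_measurable_fun_R2 (R : realType) (f : R * R -> R) :
  continuous f -> measurable_fun setT f.
Proof.
move=> /continuousP cf; apply: measurable_fun_preimage_open => A oA.
by apply: open_measurable_R2; exact: cf.
Qed.

Lemma continuous_measurable_fun_R3 (R : realType) (f : R * R * R -> R) :
  continuous f -> measurable_fun setT f.
Proof.
move=> /continuousP cf; apply: measurable_fun_preimage_open => A oA.
by apply: open_measurable_R3; exact: cf.
Qed.

Definition measure_preserving d1 d2 (T1 : measurableType d1) (T2 : measurableType d2)
    (R : realType) (m1 : set T1 -> \bar R) (m2 : set T2 -> \bar R) (f : T1 -> T2) :=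
  measurable_fun setT f /\ forall A, measurable A -> m1 (f @^-1` A) = m2 A.

Lemma measure_preserving_comp d1 d2 d3 (T1 : measurableType d1) (T2 : measurableType d2)
    (T3 : measurableType d3) (R : realType) (m1 : set T1 -> \bar R) (m2 : set T2 -> \bar R)
    (m3 : set T3 -> \bar R) (f : T1 -> T2) (g : T2 -> T3) :
  measure_preserving m1 m2 f -> measure_preserving m2 m3 g ->
  measure_preserving m1 m3 (g \o f).
Proof.
move=> [mf hf] [mg hg]; split; first exact: measurableT_comp.
move=> A mA; rewrite comp_preimage hf ?hg//.
by rewrite -[_ @^-1` _]setTI; exact: mg.
Qed.

Section measure_preserving_integral.
Context d1 d2 (T1 : measurableType d1) (T2 : measurableType d2) (R : realType).
Variables (m1 : {measure set T1 -> \bar R}) (m2 : {measure set T2 -> \bar R}).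
Variable f : T1 -> T2.
Hypothesis fP : measure_preserving m1 m2 f.
Local Open Scope ereal_scope.

Lemma measure_preserving_ge0_integral (g : T2 -> \bar R) :
  measurable_fun setT g -> (forall x, 0 <= g x) ->
  \int[m2]_x g x = \int[m1]_x g (f x).
Proof.
move=> mg g0; have [mf hf] := fP.
rewrite -[RHS]/(\int[m1]_(x in f @^-1` setT) (g \o f) x).
rewrite -(ge0_integral_pushforward mf)//.
by apply: eq_measure_integral => A mA _; exact/esym/hf.
Qed.

Lemma measure_preserving_integrable (g : T2 -> \bar R) :
  m2.-integrable setT g -> m1.-integrable setT (g \o f).
Proof.
move=> /integrableP[mg ig]; have [mf hf] := fP.
apply/integrableP; split; first exact: measurableT_comp.
rewrite -(measure_preserving_ge0_integral (g := fun x => `|g x|))//.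
exact: measurableT_comp.
Qed.

Lemma measure_preserving_integral (g : T2 -> \bar R) :
  measurable_fun setT g -> \int[m2]_x g x = \int[m1]_x g (f x).
Proof.
move=> mg; rewrite integralE [RHS]integralE.
congr (_ - _).
  rewrite (measure_preserving_ge0_integral (measurable_funepos mg) (funepos_ge0 g)).
  by apply: eq_integral => x _; rewrite !funeposE.
rewrite (measure_preserving_ge0_integral (measurable_funeneg mg) (funeneg_ge0 g)).
by apply: eq_integral => x _; rewrite !funenegE.
Qed.
End measure_preserving_integral.

Lemma lebesgue_measure_shift (R : realType) (a : R) :
  measure_preserving (@lebesgue_measure R) (@lebesgue_measure R) (fun x => x + a).
Proof.
have mf : measurable_fun setT (fun x : R => x + a) by exact: measurable_funD.
split => // A mA.
have mf' : @measurable_fun _ _ (measurableTypeR R) (measurableTypeR R) setT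
  (fun x => x + a) := mf.
pose g : {mfun (measurableTypeR R) >-> (measurableTypeR R)} :=
  HB.pack ((fun x => x + a) : measurableTypeR R -> measurableTypeR R)
    (isMeasurableFun.Build _ _ _ _ _ mf').
rewrite -[LHS]/(pushforward (@lebesgue_measure R) g A).
apply/esym/lebesgue_measure_unique => // _ [[x y] _ <-].
rewrite /= /pushforward (_ : _ @^-1` _ = `]x - a, y - a]%classic); last first.
  by apply/seteqP; split => z /=; rewrite !in_itv/= ltrBlDr lerBrDr.
by rewrite !lebesgue_measure_itv/= !lte_fin ltrD2r -!EFinB opprB addrA subrK.
Qed.

Section product_measure_preserving.
Context d1 (T1 : measurableType d1) (R : realType).
Local Open Scope ereal_scope.

(** Each section over a point of [T1] is merely translated, and the product measure integrates the
    measures of these sections. *)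
Lemma shear_measure_preserving (m : {measure set T1 -> \bar R}) (g : T1 -> R) :
  measurable_fun setT g ->
  measure_preserving (m \x @lebesgue_measure R) (m \x @lebesgue_measure R)
    (fun z => (z.1, z.2 + g z.1)%R).
Proof.
move=> mg; split.
  apply: measurable_fun_pair; first exact: measurable_fst.
  apply: measurable_funD; first exact: measurable_snd.
  by apply: measurableT_comp => //; exact: measurable_fst.
move=> A mA; rewrite /product_measure1; apply: eq_integral => x _ /=.
have [_ h] := @lebesgue_measure_shift R (g x).
rewrite -[RHS](h _ (measurable_xsection x mA)).
congr (lebesgue_measure _); apply/seteqP; split => y;
  by rewrite /xsection/= !inE.
Qed.

Lemma base_measure_preserving d2 (T2 : measurableType d2)
    (m : {measure set T1 -> \bar R}) (m2 : {sigma_finite_measure set T2 -> \bar R})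
    (f : T1 -> T1) :
  measure_preserving m m f ->
  measure_preserving (m \x m2) (m \x m2) (fun z => (f z.1, z.2)).
Proof.
move=> fP; split.
  apply: measurable_fun_pair; last exact: measurable_snd.
  by apply: measurableT_comp; [case: fP|exact: measurable_fst].
move=> A mA; rewrite /product_measure1.
by rewrite [RHS](measure_preserving_ge0_integral fP (measurable_fun_xsection m2 mA)).
Qed.
End product_measure_preserving.

Section leb_flows.
Variable R : realType.
Local Notation leb := (@lebesgue_measure R).
Local Open Scope ereal_scope.

(* right translation by exp(hX) and by exp(hY), respectively *)
Definition flowX (h : R) (p : R * R * R) : R * R * R :=
  ((p.1.1 + h, p.1.2), p.2 + 2 * p.1.2 * h)%R.
Definition flowY (h : R) (p : R * R * R) : R * R * R :=
  ((p.1.1, p.1.2 + h), p.2 - 2 * p.1.1 * h)%R.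

(** The group product of [q = (y, t)] with [exp (s X)]. In the coordinates [(s, q)] the cylinder
    [DV D] is a product, and [Egraph D u] meets each of its fibres in a half line. *)
Definition Phi (z : R * (R * R)) : R * R * R :=
  ((z.1, z.2.1), z.2.2 + 2 * z.2.1 * z.1)%R.

Lemma flowX_measure_preserving h : measure_preserving (@leb3 R) (@leb3 R) (flowX h).
Proof.
have P1 : measure_preserving (@leb2 R) (@leb2 R) (fun z => (z.1 + h, z.2)%R).
  exact: (base_measure_preserving leb (lebesgue_measure_shift h)).
have P2 := base_measure_preserving leb P1.
have mg : measurable_fun setT (fun z : R * R => 2 * z.2 * h)%R.
  apply: measurable_funM => //; apply: measurable_funM => //; exact: measurable_snd.
have := measure_preserving_comp P2 (shear_measure_preserving (@leb2 R) mg).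
exact.
Qed.

Lemma flowY_measure_preserving h : measure_preserving (@leb3 R) (@leb3 R) (flowY h).
Proof.
have P1 : measure_preserving (@leb2 R) (@leb2 R) (fun z => (z.1, z.2 + h)%R).
  by apply: (@shear_measure_preserving _ _ _ leb (cst h)).
have P2 := base_measure_preserving leb P1.
have mg : measurable_fun setT (fun z : R * R => - (2 * z.1 * h))%R.
  apply: measurableT_comp => //.
  apply: measurable_funM => //; apply: measurable_funM => //; exact: measurable_fst.
have := measure_preserving_comp P2 (shear_measure_preserving (@leb2 R) mg).
exact.
Qed.

(** [leb3] groups the coordinates as [(x, y), t], whereas the fibres of [Phi] call for [x, (y, t)];
    Tonelli's theorem identifies the two products. *)
Lemma assoc_measure_preserving : measure_preserving (leb \x @leb2 R) (@leb3 R)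
  (fun z : R * (R * R) => ((z.1, z.2.1), z.2.2)).
Proof.
have mf : measurable_fun setT (fun z : R * (R * R) => ((z.1, z.2.1), z.2.2)).
  apply: measurable_fun_pair; last first.
    by apply: measurableT_comp; exact: measurable_snd.
  apply: measurable_fun_pair; first exact: measurable_fst.
  by apply: measurableT_comp; [exact: measurable_fst|exact: measurable_snd].
split => // A mA.
have mB : measurable ((fun z : R * (R * R) => ((z.1, z.2.1), z.2.2)) @^-1` A).
  by rewrite -[_ @^-1` _]setTI; exact: mf.
rewrite /leb3 /product_measure1.
have mAx : measurable_fun setT (leb \o xsection A).
  exact: measurable_fun_xsection.
have E := fubini_tonelli1 (m1 := leb) (m2 := leb) (leb \o xsection A) mAx
  (fun z => measure_ge0 leb (xsection A z)).
rewrite [RHS]E.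
apply: eq_integral => x _ /=.
rewrite /leb2 /product_measure1 /fubini_F; apply: eq_integral => y _ /=.
congr (leb _); apply/seteqP; split => t; by rewrite /xsection/= !inE/= !inE.
Qed.

Lemma Phi_measure_preserving : measure_preserving (leb \x @leb2 R) (@leb3 R) Phi.
Proof.
have mg : measurable_fun setT (fun z : R * R => 2 * z.2 * z.1)%R.
  apply: measurable_funM; last exact: measurable_fst.
  by apply: measurable_funM => //; exact: measurable_snd.
have := measure_preserving_comp assoc_measure_preserving
  (shear_measure_preserving (@leb2 R) mg).
exact.
Qed.

End leb_flows.

(** * Changing an integrand on a null set *)

Section integral_null_modification.
Context d (T : measurableType d) (R : realType) (mu : {measure set T -> \bar R}).
Local Open Scope ereal_scope.

(** [f] lies between [g1] and [g2], which replace [g] on [N] by 0 and by [+oo]; both are measurable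
    and have the integral of [g]. Monotonicity holds without measurability, because the integral of
    a nonnegative function is the supremum over the simple functions below it. *)
Lemma ge0_integral_eq_off_null (f g : T -> \bar R) (N : set T) :
  measurable N -> mu N = 0 -> measurable_fun setT g ->
  (forall x, 0 <= f x) -> (forall x, 0 <= g x) ->
  (forall x, ~ N x -> f x = g x) -> \int[mu]_x f x = \int[mu]_x g x.
Proof.
move=> mN N0 mg f0 g0 fg.
pose g1 x := if x \in N then 0 else g x.
pose g2 x := if x \in N then +oo else g x.
have mNb : measurable_fun setT (fun x => x \in N).
  apply: (measurable_fun_bool true).
  by rewrite setTI (_ : _ @^-1` _ = N)//; apply/seteqP; split => x /=; [exact: set_mem|exact: mem_set].
have mg1 : measurable_fun setT g1 by exact: measurable_fun_ifT.
have mg2 : measurable_fun setT g2 by exact: measurable_fun_ifT.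
have g10 x : 0 <= g1 x by rewrite /g1; case: ifP.
have g20 x : 0 <= g2 x by rewrite /g2; case: ifP.
have mono (h1 h2 : T -> \bar R) : (forall x, 0 <= h1 x) -> (forall x, h1 x <= h2 x) ->
    \int[mu]_x h1 x <= \int[mu]_x h2 x.
  move=> h10 h12; have h20 x : 0 <= h2 x by exact: le_trans (h10 x) (h12 x).
  rewrite !ge0_integralTE//; apply: le_ereal_sup => _ [h hh <-].
  by exists h => // x; exact: le_trans (hh x) (h12 x).
have nN : mu.-negligible N by exists N; split.
have E1 : \int[mu]_x g1 x = \int[mu]_x g x.
  apply: ge0_ae_eq_integral => //.
  apply: negligibleS nN => x /= /not_implyP[_]; rewrite /g1.
  by case: ifPn => [/set_mem|//].
have E2 : \int[mu]_x g2 x = \int[mu]_x g x.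
  apply: ge0_ae_eq_integral => //.
  apply: negligibleS nN => x /= /not_implyP[_]; rewrite /g2.
  by case: ifPn => [/set_mem|//].
apply/eqP; rewrite eq_le; apply/andP; split.
  rewrite -E2; apply: mono => // x; rewrite /g2; case: ifPn; rewrite ?leey//.
  by move=> /negP xN; rewrite fg// => /mem_set.
rewrite -E1; apply: mono => // x; rewrite /g1; case: ifPn => //.
by move=> /negP xN; rewrite fg// => /mem_set.
Qed.

(* Unlike ae_eq_integral, only one of the two functions is required to be measurable. *)
Lemma integral_eq_off_null (D D' N : set T) (f g : T -> \bar R) :
  measurable N -> mu N = 0 -> measurable D' -> measurable_fun setT g ->
  (forall x, ~ N x -> D x <-> D' x) ->
  (forall x, ~ N x -> D' x -> f x = g x) ->
  \int[mu]_(x in D) f x = \int[mu]_(x in D') g x.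
Proof.
move=> mN N0 mD' mg DD' fg.
rewrite integral_mkcond [RHS]integral_mkcond.
have mgD : measurable_fun setT (g \_ D').
  by apply/(measurable_restrictT _ mD').1; exact: measurable_funTS.
have E x : ~ N x -> (f \_ D) x = (g \_ D') x.
  move=> Nx; rewrite !patchE; case: ifPn => [/set_mem|/negP] Dx.
    have D'x := (DD' x Nx).1 Dx; by rewrite mem_set// fg.
  by rewrite memNset// => /((DD' x Nx).2)/mem_set.
rewrite integralE [RHS]integralE; congr (_ - _).
  apply: (ge0_integral_eq_off_null mN N0) => //; first exact: measurable_funepos.
  by move=> x Nx; rewrite !funeposE E.
apply: (ge0_integral_eq_off_null mN N0) => //; first exact: measurable_funeneg.
by move=> x Nx; rewrite !funenegE E.
Qed.

End integral_null_modification.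

(** * The maximum distance on the plane and Lipschitz extension *)

Section dist2_facts.
Variable R : realType.
Implicit Types q : R * R.

Lemma dist2_ge0 q q' : 0 <= dist2 q q'.
Proof. by rewrite /dist2 le_max normr_ge0. Qed.

Lemma dist2xx q : dist2 q q = 0.
Proof. by rewrite /dist2 !subrr normr0 maxxx. Qed.

Lemma dist2C q q' : dist2 q q' = dist2 q' q.
Proof. by rewrite /dist2 distrC (distrC q.2). Qed.

Lemma dist2_triangle q1 q2 q3 : dist2 q1 q3 <= dist2 q1 q2 + dist2 q2 q3.
Proof.
rewrite {1}/dist2 ge_max; apply/andP; split.
  apply: (le_trans (ler_distD q2.1 _ _)).
  by rewrite lerD// /dist2 le_max lexx.
apply: (le_trans (ler_distD q2.2 _ _)).
by rewrite lerD// /dist2 le_max lexx orbT.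
Qed.

Lemma dist2_ball q e : [set q' | dist2 q q' < e] = ball q e.
Proof.
apply/seteqP; split => [[y t]|[y t] []]; rewrite /ball/= /dist2/=.
  by rewrite gt_max => /andP[? ?]; split.
by move=> ? ?; rewrite gt_max; apply/andP.
Qed.

(** McShane's extension [F q = inf (f a + k * dist2 q a)] over [a] in [A]. A global Lipschitz
    extension of [u] is continuous and Borel on the whole plane, so traces on the graph can be
    integrated without restriction to [D]. *)
Lemma lip2_mcshane (A : set (R * R)) (f : R * R -> R) :
  lip2_on A f -> exists (k : R) (F : R * R -> R),
    [/\ 0 < k, (forall q q', `|F q - F q'| <= k * dist2 q q') & forall q, A q -> F q = f q].
Proof.
move=> [k0 hf]; pose k := `|k0| + 1.
have k_gt0 : 0 < k by rewrite ltr_wpDl.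
have fk q q' : A q -> A q' -> `|f q - f q'| <= k * dist2 q q'.
  move=> Aq Aq'; rewrite (le_trans (hf _ _ Aq Aq'))// ler_wpM2r ?dist2_ge0//.
  by rewrite (le_trans (ler_norm k0))// lerDl.
have [[a Aa]|A0] := pselect (exists a, A a); last first.
  exists k, (cst 0); split => // [q q'|q Aq]; last by exfalso; apply: A0; exists q.
  by rewrite subrr normr0 mulr_ge0 ?dist2_ge0// ltW.
pose S q := [set f a' + k * dist2 q a' | a' in A].
have Slb q a' : A a' -> forall x, S q x -> f a' - k * dist2 q a' <= x.
  move=> Aa' _ [b Ab <-]; have := fk _ _ Aa' Ab.
  have := dist2_triangle a' q b; rewrite (dist2C a' q) => T.
  have := ler_wpM2l (ltW k_gt0) T; rewrite mulrDr => T2 H.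
  have := le_trans (ler_norm _) H; lra.
have hS q : has_inf (S q).
  split; first by exists (f a + k * dist2 q a), a.
  by exists (f a - k * dist2 q a) => x; exact: Slb.
exists k, (fun q => inf (S q)); split => //.
  have main q q' : inf (S q) - inf (S q') <= k * dist2 q q'.
    rewrite lerBlDr -lerBlDl; apply: lb_le_inf; first by case: (hS q').
    move=> _ [b Ab <-].
    have : inf (S q) <= f b + k * dist2 q b.
      by apply: ge_inf; [case: (hS q)|exists b].
    have := ler_wpM2l (ltW k_gt0) (dist2_triangle q q' b); rewrite mulrDr; lra.
  move=> q q'; rewrite ler_norml main andbT lerNl opprB.
  by rewrite dist2C; exact: main.
move=> q Aq; apply/eqP; rewrite eq_le; apply/andP; split.
  apply: ge_inf; first by case: (hS q).
  by exists q => //; rewrite dist2xx mulr0 addr0.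
apply: lb_le_inf; first by case: (hS q).
by move=> x /(Slb q q Aq); rewrite dist2xx mulr0 subr0.
Qed.

Lemma lip2_continuous (k : R) (F : R * R -> R) :
  (forall q q', `|F q - F q'| <= k * dist2 q q') -> continuous F.
Proof.
move=> Fk q; apply/cvgrPdist_lt => e e0.
have k1 : 0 < `|k| + 1 by rewrite ltr_wpDl.
have d0 : 0 < e / (`|k| + 1) by exact: divr_gt0.
have : \forall q' \near q, ball q (e / (`|k| + 1)) q' by exact: nbhsx_ballx.
apply: filterS => q'; rewrite -dist2_ball /= => qq'.
apply: (le_lt_trans (Fk q q')).
apply: (@le_lt_trans _ _ ((`|k| + 1) * dist2 q q')).
  by rewrite ler_wpM2r ?dist2_ge0// (le_trans (ler_norm k))// lerDl.
by rewrite mulrC -ltr_pdivlMr.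
Qed.

End dist2_facts.

(** * Almost everywhere derivability in the second variable *)

Section derivable_slices.
Variable R : realType.
Local Notation leb := (@lebesgue_measure R).

(** Every neighbourhood of [h] contains a rational. This carries Cauchy estimates for difference
    quotients from rational to real increments. *)
Lemma le_rat_limit (f : R -> R) (c h : R) : {for h, continuous f} ->
  (\forall z \near h, forall r : rat, z = ratr r -> f z <= c) -> f h <= c.
Proof.
move=> fh hz; rewrite leNgt; apply/negP => ch.
have near1 : \forall z \near h, c < f z by apply: cvgr_gt fh _ ch.
have hz1 : \forall z \near h, (forall r : rat, z = ratr r -> f z <= c) /\ c < f z.
  exact: filterI.
move/nbhs_ballP : hz1 => [e /= e0 he].
have [|r] := @rat_in_itvoo R (h - e) (h + e); first by lra.
rewrite in_itv/= => rh.
have /he[/(_ r erefl)] : ball h e (ratr r) by rewrite /ball/= ltr_distlC.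
by rewrite leNgt => /negP.
Qed.

(** Each line in the second variable meets the bad set in a null set, by the one-dimensional
    theorem; so the bad set is null once it is known to be Borel. Derivability is expressed by the
    Cauchy criterion for difference quotients. These are continuous in the nonzero increment, so
    rational increments suffice and [G] is a countable combination of Borel sets. *)
Lemma ae_derivable_slices (k : R) (F : R * R -> R) :
  (forall q q', `|F q - F q'| <= k * dist2 q q') ->
  exists N : set (R * R), [/\ measurable N, @leb2 R N = 0%E &
    forall q, ~ N q -> derivable (fun t => F (q.1, t)) q.2 1].
Proof.
move=> Fk.
have cF := lip2_continuous Fk.
have mF := continuous_measurable_fun_R2 cF.
pose dq (q : R * R) (h : R) := h^-1 * (F (q.1, q.2 + h) - F q).
have mdq h : measurable_fun setT (dq ^~ h).
  apply: measurable_funM => //; apply: measurable_funB => //.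
  apply: measurableT_comp => //; apply: measurable_fun_pair; first exact: measurable_fst.
  by apply: measurable_funD => //; exact: measurable_snd.
pose ok (n : nat) (h : R) := (0 < `|h| < n.+1%:R^-1).
pose G0 (l n : nat) (hh : rat * rat) : set (R * R) :=
  if ok n (ratr hh.1) && ok n (ratr hh.2) then
    [set q | `|dq q (ratr hh.1) - dq q (ratr hh.2)| <= l.+1%:R^-1] else setT.
have mG0 l n hh : measurable (G0 l n hh).
  rewrite /G0; case: ifP => // _.
  have mD : measurable_fun setT (fun q => dq q (ratr hh.1) - dq q (ratr hh.2)).
    exact: measurable_funB.
  rewrite (_ : [set q | _] =
    (fun q => dq q (ratr hh.1) - dq q (ratr hh.2)) @^-1` `[- l.+1%:R^-1, l.+1%:R^-1]).
    by rewrite -[_ @^-1` _]setTI; apply: mD => //; exact: measurable_itv.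
  by apply/seteqP; split => q /=; rewrite in_itv/= ler_norml.
pose G := \bigcap_l \bigcup_n \bigcap_hh G0 l n hh.
have mG : measurable G.
  apply: bigcapT_measurable => l; apply: bigcupT_measurable => n.
  rewrite -[X in measurable X]setCK setC_bigcap; apply: measurableC.
  apply: countable_bigcupT_measurable; first exact: countableP.
  by move=> i; exact: measurableC.
have quotE (q : R * R) : (fun h : R => h^-1 *: (((fun t => F (q.1, t)) \o shift q.2) (h *: (1:R^o)) - F (q.1, q.2)))
    = dq q.
  apply/funext => h; rewrite /dq /= -surjective_pairing.
  by rewrite [in LHS]/GRing.scale/= mulr1 (addrC h).
have GP q : G q <-> derivable (fun t => F (q.1, t)) q.2 1.
  split.
  - move=> Gq; rewrite /derivable quotE.
    apply: cauchy_cvg; apply/cauchyP => e e0.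
    have [l /= le] := filter_ex (near_infty_natSinv_lt (PosNum e0)).
    have [n _ Hn] := Gq l I.
    have key h h' : ok n h -> ok n h' -> `|dq q h - dq q h'| <= l.+1%:R^-1.
      have cdq z : z != 0 -> {for z, continuous (dq q)}.
        move=> z0; apply: continuousM; first exact: inv_continuous.
        apply: continuousB; last exact: cst_continuous.
        apply: (@lipschitz_continuous R (fun x => F (q.1, q.2 + x)) k) => x y.
        rewrite (le_trans (Fk _ _))// /dist2/= subrr normr0 max_r//.
        by rewrite opprD addrACA subrr add0r.
      have near_ok z : ok n z -> \forall z' \near z, ok n z'.
        move=> /andP[z0 zn]; have nz : `|x| @[x --> z] --> `|z| by apply: cvg_norm; exact: cvg_id.
        near=> z'; apply/andP; split; near: z'.
          exact: (cvgr_gt _ nz _ z0).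
        exact: (cvgr_lt _ nz _ zn).
      have ok0 z : ok n z -> z != 0 by move=> /andP[+ _]; rewrite normr_gt0.
      move=> okh okh'; apply: (@le_rat_limit (fun z => `|dq q z - dq q h'|)).
        apply: cvg_norm.
        by apply: cvgB; [exact/cdq/ok0|exact: cvg_cst].
      apply: filterS (near_ok _ okh) => z okz r zr.
      apply: (@le_rat_limit (fun z' => `|dq q z - dq q z'|)).
        apply: cvg_norm.
        by apply: cvgB; [exact: cvg_cst|exact/cdq/ok0].
      apply: filterS (near_ok _ okh') => z' okz' r' zr'.
      have := Hn (r, r') I; rewrite /G0/= -zr -zr' okz okz'/=; exact.
    near (0:R)^' => h0; have okh0 : ok n h0.
      apply/andP; split; near: h0.
        by near=> z; rewrite normr_gt0; near: z; exact: nbhs_dnbhs_neq.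
      by apply: dnbhs0_lt; rewrite invr_gt0 ltr0Sn.
    exists (dq q h0); near=> h; rewrite /ball/=.
    apply: le_lt_trans le; apply: key => //.
    apply/andP; split; near: h.
      by near=> z; rewrite normr_gt0; near: z; exact: nbhs_dnbhs_neq.
    by apply: dnbhs0_lt; rewrite invr_gt0 ltr0Sn.
  - rewrite /derivable quotE => /cvg_ex[a /cvgrPdist_lt ha] l _.
    have l0 : 0 < l.+1%:R^-1 / 2 :> R by rewrite divr_gt0// invr_gt0 ltr0Sn.
    have := ha _ l0; rewrite near_withinE => /nbhs_ballP[e /= e0 he].
    have [n /= ne] := filter_ex (near_infty_natSinv_lt (PosNum e0)).
    exists n => // -[r r'] _; rewrite /G0/=; case: ifP => // /andP[okr okr'].
    have Hr z : ok n z -> `|a - dq q z| < l.+1%:R^-1 / 2.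
      move=> /andP[z0 zn]; apply: he; last by rewrite -normr_gt0.
      by rewrite /ball/= sub0r normrN (lt_trans zn).
    rewrite /= (le_trans (ler_distD a _ _))// (splitr l.+1%:R^-1) lerD// ltW//.
      by rewrite distrC Hr.
    exact: Hr.
exists (~` G); split; first exact: measurableC.
  rewrite /leb2 /product_measure1; apply: integral0_eq => y _ /=.
  have mx : measurable (xsection (~` G) y) by apply: measurable_xsection; exact: measurableC.
  apply/negligibleP; first exact: mx.
  have lipy s t : `|F (y, s) - F (y, t)| <= k * `|s - t|.
    rewrite (le_trans (Fk _ _))// /dist2/= subrr normr0 max_r//.
  apply: negligibleS (lipschitz_ae_derivable lipy) => t.
  rewrite /xsection/= inE/= => nG dt; apply: nG; exact/GP.
by move=> q /contrapT/GP.
Unshelve. all: by end_near. Qed.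

End derivable_slices.

(** * Derivatives in one variable as first-order bounds *)

Section real_derivatives.
Variable R : realType.
Implicit Types (f g : R -> R) (x a e : R).

Lemma is_derive_bound f x a :
  (forall e, 0 < e -> \forall h \near x, `|f h - f x - a * (h - x)| <= e * `|h - x|) ->
  is_derive x 1 f a.
Proof.
move=> H.
have C : h^-1 *: ((f \o shift x) (h *: (1:R)) - f x) @[h --> (0:R)^'] --> a.
  apply/cvgrPdist_le => e e0; have /nbhs_ballP[r /= r0 hr] := H e e0.
  rewrite near_withinE; near=> h => h0.
  have : ball x r (h + x).
    rewrite /ball/= opprD addrCA subrr addr0 normrN.
    near: h; apply: cvgr0_norm_lt => //; exact: cvg_id.
  move=> /hr; rewrite addrK /= => B.
  rewrite [h *: 1]mulr1 [_ *: _]/(_ * _).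
  rewrite -(ler_pM2l (_ : 0 < `|h|)) ?normr_gt0// -normrM mulrBr mulVKf//.
  by rewrite mulrC distrC (mulrC `|h|).
have D : derivable f x 1 by apply/cvg_ex; exists a.
by apply: DeriveDef => //; exact/cvg_lim.
Unshelve. all: by end_near. Qed.

Lemma is_derive_boundP f x a : is_derive x 1 f a -> forall e, 0 < e ->
  \forall h \near x, `|f h - f x - a * (h - x)| <= e * `|h - x|.
Proof.
move=> [/cvg_ex[l H] <-] e e0.
have -> : 'D_1 f x = l by exact: cvg_lim.
move/cvgrPdist_le : H => /(_ e e0).
rewrite near_withinE => /nbhs_ballP[r /= r0 hr].
apply/nbhs_ballP; exists r => //= h xh.
have [->|hx] := eqVneq h x; first by rewrite !subrr mulr0 subrr normr0 mulr0.
have h0 : h - x != 0 by rewrite subr_eq0.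
have := hr (h - x); rewrite /ball/= sub0r normrN distrC => /(_ xh h0).
rewrite [_ *: 1]mulr1 subrK [_ *: _]/(_ * _).
rewrite -(ler_pM2l (_ : 0 < `|h - x|)) ?normr_gt0// -normrM mulrBr mulVKf//.
move=> H; rewrite (_ : _ - _ = - ((h - x) * l - (f h - f x))); last by ring.
by rewrite normrN (distrC x) (mulrC e).
Qed.

Lemma is_derive_continuous f x a : is_derive x 1 f a -> {for x, continuous f}.
Proof. by move=> [fx _]; apply/differentiable_continuous/derivable1_diffP. Qed.

Lemma is_derive_eqf f g x a b : f =1 g -> a = b -> is_derive x 1 f a -> is_derive x 1 g b.
Proof. by move=> /funext -> ->. Qed.

Lemma is_derive_line a b x : is_derive x 1 (fun z : R => a + b * z) b.
Proof.
apply: is_derive_bound => e e0; near=> h.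
rewrite (_ : _ - _ = 0) ?normr0 ?mulr_ge0 ?(ltW e0)//; ring.
Unshelve. all: by end_near. Qed.

Lemma is_derive_mul f g x a b : is_derive x 1 f a -> is_derive x 1 g b ->
  is_derive x 1 (fun z => f z * g z) (a * g x + f x * b).
Proof.
move=> fa gb; have := is_deriveM fa gb; apply: is_derive_eqf => //.
by rewrite addrC [_ *: _]mulrC; congr (_ + _); rewrite mulrC.
Qed.

Lemma is_derive_add f g x a b : is_derive x 1 f a -> is_derive x 1 g b ->
  is_derive x 1 (fun z => f z + g z) (a + b).
Proof. by move=> fa gb; exact: is_deriveD. Qed.

Lemma is_derive_chain f g x a b : is_derive (g x) 1 f a -> is_derive x 1 g b ->
  is_derive x 1 (fun z => f (g z)) (a * b).
Proof. by move=> fa gb; exact: is_derive1_comp. Qed.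

(** Subtracting a reference slope [a] turns near constancy of the derivative into a first-order
    expansion; with [a = 0] it is the usual Lipschitz bound. *)
Lemma mvt_bound f (df : R -> R) x y a e :
  (forall z, Num.min x y <= z <= Num.max x y -> is_derive z 1 f (df z)) ->
  (forall z, Num.min x y <= z <= Num.max x y -> `|df z - a| <= e) ->
  `|f y - f x - a * (y - x)| <= e * `|y - x|.
Proof.
move=> fd de; wlog xy : x y fd de / x <= y => [hw|].
  case: (leP x y) => [|/ltW] xy; first exact: hw.
  have := hw y x; rewrite minC maxC => /(_ fd de xy).
  rewrite (distrC x) (_ : f x - f y - a * (x - y) = - (f y - f x - a * (y - x))); last by ring.
  by rewrite normrN.
rewrite min_l // max_r // in fd de.
have cf : {within `[x, y], continuous f}.
  apply: derivable_within_continuous => z; rewrite in_itv/= => /fd[]//.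
have [|z zI E] := MVT_segment xy (f := f) (df := df) _ cf.
  by move=> z; rewrite in_itv/= => /andP[/ltW xz /ltW zy]; apply: fd; rewrite xz.
rewrite E -mulrBl normrM ler_wpM2r//; apply: de.
by move: zI; rewrite in_itv.
Qed.

End real_derivatives.

Section neighbourhoods.
Variable R : realType.

Lemma near3P (p : R * R * R) (P : R * R * R -> Prop) : (\forall p' \near p, P p') <->
  exists e : R, 0 < e /\ forall p', `|p'.1.1 - p.1.1| < e -> `|p'.1.2 - p.1.2| < e ->
    `|p'.2 - p.2| < e -> P p'.
Proof.
split=> [/nbhs_ballP[e /= e0 he]|[e [e0 he]]].
  by exists e; split => // p' h1 h2 h3; apply: he; split; [split|]; rewrite /ball/= distrC.
apply/nbhs_ballP; exists e => //= p' [[h1 h2] h3]; apply: he.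
- by rewrite distrC; exact: h1.
- by rewrite distrC; exact: h2.
- by rewrite distrC; exact: h3.
Qed.

Lemma continuous_x3 : continuous (fun p : R * R * R => p.1.1).
Proof. by move=> p; apply: (@continuous_comp _ _ _ fst fst p); exact: cvg_fst. Qed.

Lemma continuous_y3 : continuous (fun p : R * R * R => p.1.2).
Proof. by move=> p; apply: (@continuous_comp _ _ _ fst snd p); [exact: cvg_fst|exact: cvg_snd]. Qed.

Lemma continuous_t3 : continuous (fun p : R * R * R => p.2).
Proof. by move=> p; apply: cvg_snd. Qed.

End neighbourhoods.

(** * Continuously differentiable functions of three variables *)

Section C1_calculus.
Variable R : realType.
Local Notation H := (R * R * R)%type.
Implicit Types (v w : H -> R) (p : H).

Definition has_grad v p (a b c : R) := [/\
  is_derive p.1.1 1 (fun s => v ((s, p.1.2), p.2)) a,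
  is_derive p.1.2 1 (fun s => v ((p.1.1, s), p.2)) b &
  is_derive p.2 1 (fun s => v ((p.1.1, p.1.2), s)) c].

(** A pointwise form of [C1] that depends only on the germ of [v] at [p]. A field can thus be
    checked with a different formula near each point before [C1at_C1] assembles the result. *)
Definition C1at v p := exists gx gy gt : H -> R,
  [/\ \forall p' \near p, has_grad v p' (gx p') (gy p') (gt p'),
    {for p, continuous gx}, {for p, continuous gy} & {for p, continuous gt}].

Definition diff3 v p (a b c : R) := forall e, 0 < e -> \forall p' \near p,
  `|v p' - v p - (a * (p'.1.1 - p.1.1) + b * (p'.1.2 - p.1.2) + c * (p'.2 - p.2))|
    <= e * (`|p'.1.1 - p.1.1| + `|p'.1.2 - p.1.2| + `|p'.2 - p.2|).

Lemma between_dist (x y z r : R) : Num.min x y <= z <= Num.max x y ->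
  `|y - x| < r -> `|z - x| < r.
Proof.
by rewrite /Num.min /Num.max; case: ifPn; rewrite -?leNgt !ltr_norml; lra.
Qed.

(** The increment is split along three segments parallel to the axes; on each, the mean value bound
    compares the partial derivative with its value at [p]. *)
Lemma C1_diff3 v p (gx gy gt : H -> R) :
  (\forall p' \near p, has_grad v p' (gx p') (gy p') (gt p')) ->
  {for p, continuous gx} -> {for p, continuous gy} -> {for p, continuous gt} ->
  diff3 v p (gx p) (gy p) (gt p).
Proof.
move=> G cx cy ct e e0.
have nx : \forall p' \near p, `|gx p' - gx p| <= e.
  by move/cvgrPdist_le : cx => /(_ e e0); apply: filterS => z; rewrite distrC.
have ny : \forall p' \near p, `|gy p' - gy p| <= e.
  by move/cvgrPdist_le : cy => /(_ e e0); apply: filterS => z; rewrite distrC.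
have nt : \forall p' \near p, `|gt p' - gt p| <= e.
  by move/cvgrPdist_le : ct => /(_ e e0); apply: filterS => z; rewrite distrC.
have /near3P[r [r0 hr]] : \forall p' \near p, [/\ has_grad v p' (gx p') (gy p') (gt p'),
    `|gx p' - gx p| <= e, `|gy p' - gy p| <= e & `|gt p' - gt p| <= e].
  by near=> z; split; near: z.
apply/near3P; exists r; split => // -[[x' y'] t'] /=.
case: p G cx cy ct nx ny nt hr => [[x y] t] /= _ _ _ _ _ _ _ hr hx hy ht.
have n0 : `|0 : R| < r by rewrite normr0.
have Bx : `|v ((x', y), t) - v ((x, y), t) - gx ((x, y), t) * (x' - x)| <= e * `|x' - x|.
  apply: (@mvt_bound R (fun s => v ((s, y), t)) (fun s => gx ((s, y), t))) => z zI;
    by have [|||[]] := hr ((z, y), t); rewrite /= ?subrr//; exact: between_dist hx.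
have By : `|v ((x', y'), t) - v ((x', y), t) - gy ((x, y), t) * (y' - y)| <= e * `|y' - y|.
  apply: (@mvt_bound R (fun s => v ((x', s), t)) (fun s => gy ((x', s), t))) => z zI;
    by have [|||[]] := hr ((x', z), t); rewrite /= ?subrr//; exact: between_dist hy.
have Bt : `|v ((x', y'), t') - v ((x', y'), t) - gt ((x, y), t) * (t' - t)| <= e * `|t' - t|.
  apply: (@mvt_bound R (fun s => v ((x', y'), s)) (fun s => gt ((x', y'), s))) => z zI;
    by have [|||[]] := hr ((x', y'), z); rewrite /= ?subrr//; exact: between_dist ht.
rewrite !mulrDr; apply: le_trans (lerD (lerD Bx By) Bt).
apply: le_trans (lerD (ler_normD _ _) (lexx _)); apply: le_trans (ler_normD _ _).
by rewrite le_eqVlt; apply/orP; left; apply/eqP; congr (`|_|); ring.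
Unshelve. all: by end_near. Qed.

Lemma diff3_chain v p a b c (c1 c2 c3 : R -> R) h d1 d2 d3 :
  p = ((c1 h, c2 h), c3 h) -> diff3 v p a b c ->
  is_derive h 1 c1 d1 -> is_derive h 1 c2 d2 -> is_derive h 1 c3 d3 ->
  is_derive h 1 (fun z => v ((c1 z, c2 z), c3 z)) (a * d1 + b * d2 + c * d3).
Proof.
move=> -> D D1 D2 D3; apply: is_derive_bound => e e0.
pose M := `|a| + `|b| + `|c|; pose K := `|d1| + `|d2| + `|d3| + 3.
have M0 : 0 <= M by rewrite !addr_ge0.
have K0 : 0 < K by rewrite ltr_wpDl// !addr_ge0.
(* [K] bounds the first-order growth of the curve and [M] the size of the gradient, so the
   accumulated error is [e1 * (K + M) * |z - h|]. The cap [e1 <= 1] makes [|d| + 1] a growth rate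
   for each coordinate. *)
pose e1 := Num.min 1 (e / (K + M)).
have KM : 0 < K + M by rewrite ltr_wpDr.
have e10 : 0 < e1 by rewrite lt_min ltr01 divr_gt0.
have e11 : e1 <= 1 by rewrite ge_min lexx.
have e1e : e1 * (K + M) <= e by rewrite -ler_pdivlMr// ge_min lexx orbT.
have /near3P[r [r0 hr]] := D _ e10.
have B1 := is_derive_boundP D1 e10.
have B2 := is_derive_boundP D2 e10.
have B3 := is_derive_boundP D3 e10.
have near_c (f : R -> R) (d : R) : is_derive h 1 f d -> \forall z \near h, `|f z - f h| < r.
  move=> D0; have /cvgrPdist_lt/(_ r r0) := is_derive_continuous D0.
  by apply: filterS => z; rewrite distrC.
have C1 := near_c _ _ D1; have C2 := near_c _ _ D2; have C3 := near_c _ _ D3.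
near=> z.
have b1 : `|c1 z - c1 h - d1 * (z - h)| <= e1 * `|z - h| by near: z.
have b2 : `|c2 z - c2 h - d2 * (z - h)| <= e1 * `|z - h| by near: z.
have b3 : `|c3 z - c3 h - d3 * (z - h)| <= e1 * `|z - h| by near: z.
have k1 : `|c1 z - c1 h| < r by near: z.
have k2 : `|c2 z - c2 h| < r by near: z.
have k3 : `|c3 z - c3 h| < r by near: z.
have hr1 := hr ((c1 z, c2 z), c3 z) k1 k2 k3; rewrite /= in hr1.
have n0 : 0 <= `|z - h| by [].
have big (f : R -> R) (d : R) : `|f z - f h - d * (z - h)| <= e1 * `|z - h| ->
    `|f z - f h| <= (`|d| + 1) * `|z - h|.
  move=> B; rewrite -(subrK (d * (z - h)) (f z - f h)) (le_trans (ler_normD _ _))//.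
  rewrite mulrDl addrC lerD ?normrM// (le_trans B)// ler_wpM2r//.
have lin (k : R) (f : R -> R) (d : R) : `|f z - f h - d * (z - h)| <= e1 * `|z - h| ->
    `|k * (f z - f h) - k * d * (z - h)| <= `|k| * e1 * `|z - h|.
  by move=> B; rewrite -mulrA -mulrBr normrM -mulrA ler_wpM2l.
have G1 := big _ _ b1; have G2 := big _ _ b2; have G3 := big _ _ b3.
have L1 := lin a _ _ b1; have L2 := lin b _ _ b2; have L3 := lin c _ _ b3.
apply: (@le_trans _ _ (e1 * (K + M) * `|z - h|)); last by rewrite ler_wpM2r.
have Hr : `|v (c1 z, c2 z, c3 z) - v (c1 h, c2 h, c3 h) -
       (a * (c1 z - c1 h) + b * (c2 z - c2 h) + c * (c3 z - c3 h))|
     <= e1 * (K * `|z - h|).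
  apply: (le_trans hr1); rewrite ler_pM2l//.
  by apply: (le_trans (lerD (lerD G1 G2) G3)); rewrite -!mulrDl /K ler_wpM2r//; lra.
rewrite (_ : v (c1 z, c2 z, c3 z) - v (c1 h, c2 h, c3 h) - (a * d1 + b * d2 + c * d3) * (z - h) =
  (v (c1 z, c2 z, c3 z) - v (c1 h, c2 h, c3 h) -
       (a * (c1 z - c1 h) + b * (c2 z - c2 h) + c * (c3 z - c3 h))) +
  ((a * (c1 z - c1 h) - a * d1 * (z - h)) + (b * (c2 z - c2 h) - b * d2 * (z - h)) +
   (c * (c3 z - c3 h) - c * d3 * (z - h)))); last by ring.
apply: (le_trans (ler_normD _ _)).
rewrite (_ : e1 * (K + M) * `|z - h| = e1 * (K * `|z - h|) +
  ((`|a| * e1 * `|z - h| + `|b| * e1 * `|z - h|) + `|c| * e1 * `|z - h|)); last by rewrite /M; ring.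
rewrite lerD// (le_trans (ler_normD _ _))// lerD// (le_trans (ler_normD _ _))// lerD//.
Unshelve. all: by end_near. Qed.

Lemma has_grad_continuous v p (gx gy gt : H -> R) :
  (\forall p' \near p, has_grad v p' (gx p') (gy p') (gt p')) ->
  {for p, continuous gx} -> {for p, continuous gy} -> {for p, continuous gt} ->
  {for p, continuous v}.
Proof.
move=> G cx cy ct; have D := C1_diff3 G cx cy ct.
apply/cvgrPdist_le => e e0.
pose M := `|gx p| + `|gy p| + `|gt p| + 1.
have M0 : 0 < M by rewrite ltr_wpDl// !addr_ge0.
have /near3P[r [r0 hr]] := D 1 ltr01.
apply/near3P; exists (Num.min r (e / (3 * M))); split.
  by rewrite lt_min r0 divr_gt0// mulr_gt0.
move=> p'; rewrite !lt_min => /andP[x1 x2] /andP[y1 y2] /andP[t1 t2].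
have {}hr := hr _ x1 y1 t1; rewrite mul1r in hr.
set Dx := p'.1.1 - _ in hr x2; set Dy := p'.1.2 - _ in hr y2; set Dt := p'.2 - _ in hr t2.
rewrite distrC.
have -> : v p' - v p = (v p' - v p - (gx p * Dx + gy p * Dy + gt p * Dt)) +
  (gx p * Dx + gy p * Dy + gt p * Dt) by ring.
apply: (le_trans (ler_normD _ _)).
have T : `|gx p * Dx + gy p * Dy + gt p * Dt| <= `|gx p| * `|Dx| + `|gy p| * `|Dy| + `|gt p| * `|Dt|.
  by rewrite -!normrM (le_trans (ler_normD _ _))// lerD// ler_normD.
apply: (le_trans (lerD hr T)).
have S (z d : R) : 0 <= z -> `|d| < e / (3 * M) -> (1 + z) * `|d| <= (1 + z) * (e / (3 * M)).
  by move=> z0 /ltW; apply: ler_wpM2l; rewrite addr_ge0.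
have := lerD (lerD (S _ _ (normr_ge0 (gx p)) x2) (S _ _ (normr_ge0 (gy p)) y2)) (S _ _ (normr_ge0 (gt p)) t2).
have -> : (1 + `|gx p|) * (e / (3 * M)) + (1 + `|gy p|) * (e / (3 * M)) +
   (1 + `|gt p|) * (e / (3 * M)) = (M + 2) / (3 * M) * e by rewrite /M; ring.
move=> Hs; apply: (@le_trans _ _ ((M + 2) / (3 * M) * e)); first by move: Hs; lra.
rewrite ler_piMl ?(ltW e0)// ler_pdivrMr ?mulr_gt0// mul1r.
have : 0 <= `|gx p| + `|gy p| + `|gt p| by rewrite !addr_ge0.
by rewrite /M; lra.
Qed.

Lemma C1at_continuous v p : C1at v p -> {for p, continuous v}.
Proof. by move=> [gx [gy [gt [G ? ? ?]]]]; exact: has_grad_continuous G _ _ _. Qed.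

Lemma has_grad_dE v p a b c : has_grad v p a b c ->
  [/\ dx v p = a, dy v p = b & dt v p = c].
Proof. by move=> [[_ hx] [_ hy] [_ ht]]; rewrite /dx /dy /dt !derive1E; split. Qed.

Lemma C1at_C1 v : (forall p, C1at v p) -> C1 v.
Proof.
move=> h; split.
  move=> p; have [gx [gy [gt [/nbhs_singleton[[hx _] [hy _] [ht _]] _ _ _]]]] := h p.
  exact: (conj hx (conj hy ht)).
have near_cont (f g : H -> R) p : (\forall p' \near p, g p' = f p') ->
    {for p, continuous g} -> {for p, continuous f}.
  move=> fg cg; have E : g p = f p := nbhs_singleton fg.
  by apply: (cvg_trans (near_eq_cvg fg)); rewrite -E; exact: cg.
split; [|split] => p; have [gx [gy [gt [G cx cy ct]]]] := h p.
- by apply: near_cont cx; apply: filterS G => q /has_grad_dE[].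
- by apply: near_cont cy; apply: filterS G => q /has_grad_dE[].
- by apply: near_cont ct; apply: filterS G => q /has_grad_dE[].
Qed.

Lemma C1_has_grad v p : C1 v -> has_grad v p (dx v p) (dy v p) (dt v p).
Proof.
move=> [h _]; have [hx [hy ht]] := h p.
by split; [apply: (DeriveDef hx)|apply: (DeriveDef hy)|apply: (DeriveDef ht)];
  rewrite /dx /dy /dt derive1E.
Qed.

Lemma C1_C1at v p : C1 v -> C1at v p.
Proof.
move=> hv; have [_ [cx [cy ct]]] := hv.
exists (dx v), (dy v), (dt v); split; [|exact: cx|exact: cy|exact: ct].
by near=> q; exact: C1_has_grad.
Unshelve. all: by end_near. Qed.

Lemma C1_diff3_global v p : C1 v -> diff3 v p (dx v p) (dy v p) (dt v p).
Proof.
move=> hv; have [_ [cx [cy ct]]] := hv.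
apply: C1_diff3; [|exact: cx|exact: cy|exact: ct].
by near=> q; exact: C1_has_grad.
Unshelve. all: by end_near. Qed.

Lemma C1_continuous v : C1 v -> continuous v.
Proof. by move=> hv p; exact/C1at_continuous/C1_C1at. Qed.

Lemma has_grad_near_eq v w p a b c : (\forall p' \near p, v p' = w p') ->
  has_grad v p a b c -> has_grad w p a b c.
Proof.
case: p => [[x y] t] /near3P[r [r0 hr]] [hx hy ht].
have n0 (z : R) : `|z - z| < r by rewrite subrr normr0.
have nr (z : R) : \forall s \near z, `|s - z| < r.
  by apply/nbhs_ballP; exists r => // s; rewrite /ball/= distrC.
split; [apply: near_eq_is_derive hx|apply: near_eq_is_derive hy|apply: near_eq_is_derive ht];
  have := nr; move=> /= nr'.
- by apply: filterS (nr x) => s sx; apply: hr => /=.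
- by apply: filterS (nr y) => s sx; apply: hr => /=.
- by apply: filterS (nr t) => s sx; apply: hr => /=.
Qed.

Lemma C1at_near_eq v w p : (\forall p' \near p, v p' = w p') -> C1at v p -> C1at w p.
Proof.
move=> vw [gx [gy [gt [G cx cy ct]]]]; exists gx, gy, gt; split => //.
move: vw => /near_join vw; near=> q.
have h : has_grad v q (gx q) (gy q) (gt q) by near: q.
by apply: has_grad_near_eq h; near: q.
Unshelve. all: by end_near. Qed.

Lemma has_gradM v w p a b c a' b' c' : has_grad v p a b c -> has_grad w p a' b' c' ->
  has_grad (fun p => v p * w p) p (a * w p + v p * a') (b * w p + v p * b') (c * w p + v p * c').
Proof.
case: p => [[x y] t] [hx hy ht] [kx ky kt]; split => /=.
- exact: (is_derive_mul hx kx).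
- exact: (is_derive_mul hy ky).
- exact: (is_derive_mul ht kt).
Qed.

Lemma has_gradD v w p a b c a' b' c' : has_grad v p a b c -> has_grad w p a' b' c' ->
  has_grad (fun p => v p + w p) p (a + a') (b + b') (c + c').
Proof.
move=> [hx hy ht] [kx ky kt]; split => /=.
- exact: (is_derive_add hx kx).
- exact: (is_derive_add hy ky).
- exact: (is_derive_add ht kt).
Qed.

Lemma has_grad_comp (f : R -> R) d v p a b c : is_derive (v p) 1 f d -> has_grad v p a b c ->
  has_grad (fun p => f (v p)) p (d * a) (d * b) (d * c).
Proof.
case: p => [[x y] t] hf [hx hy ht]; split => /=.
- exact: (@is_derive_chain _ f (fun s => v ((s, y), t))).
- exact: (@is_derive_chain _ f (fun s => v ((x, s), t))).
- exact: (@is_derive_chain _ f (fun s => v ((x, y), s))).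
Qed.

Lemma C1atM v w p : C1at v p -> C1at w p -> C1at (fun p => v p * w p) p.
Proof.
move=> hv hw; have cv := C1at_continuous hv; have cw := C1at_continuous hw.
have [gx [gy [gt [G cx cy ct]]]] := hv; have [kx [ky [kt [K dx' dy' dt']]]] := hw.
exists (fun q => gx q * w q + v q * kx q), (fun q => gy q * w q + v q * ky q),
  (fun q => gt q * w q + v q * kt q); split; last 3 first.
- by apply: cvgD; apply: cvgM.
- by apply: cvgD; apply: cvgM.
- by apply: cvgD; apply: cvgM.
by near=> q; apply: has_gradM; near: q.
Unshelve. all: by end_near. Qed.

Lemma C1atD v w p : C1at v p -> C1at w p -> C1at (fun p => v p + w p) p.
Proof.
move=> [gx [gy [gt [G cx cy ct]]]] [kx [ky [kt [K dx' dy' dt']]]].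
exists (fun q => gx q + kx q), (fun q => gy q + ky q), (fun q => gt q + kt q).
split; [|exact: cvgD|exact: cvgD|exact: cvgD].
by near=> q; apply: has_gradD; near: q.
Unshelve. all: by end_near. Qed.

Lemma C1at_comp (f f' : R -> R) v p : (forall z : R, is_derive z 1 f (f' z)) ->
  continuous f' -> C1at v p -> C1at (fun p => f (v p)) p.
Proof.
move=> hf cf' hv; have cv := C1at_continuous hv.
have [gx [gy [gt [G cx cy ct]]]] := hv.
have cfv : {for p, continuous (fun q => f' (v q))}.
  by apply: (@continuous_comp _ _ _ v f' p cv); exact: cf'.
exists (fun q => f' (v q) * gx q), (fun q => f' (v q) * gy q), (fun q => f' (v q) * gt q).
split; [|exact: cvgM|exact: cvgM|exact: cvgM].
by near=> q; apply: has_grad_comp => //; near: q.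
Unshelve. all: by end_near. Qed.

Lemma C1at_cst (k : R) p : C1at (fun=> k) p.
Proof.
exists (fun=> 0), (fun=> 0), (fun=> 0); split; [|exact: cvg_cst..].
by near=> q; split; exact: is_derive_cst.
Unshelve. all: by end_near. Qed.

Lemma C1at_x p : C1at (fun p => p.1.1) p.
Proof.
exists (fun=> 1), (fun=> 0), (fun=> 0); split; [|exact: cvg_cst..].
by near=> q; split; [exact: is_derive_id|exact: is_derive_cst|exact: is_derive_cst].
Unshelve. all: by end_near. Qed.

Lemma C1at_y p : C1at (fun p => p.1.2) p.
Proof.
exists (fun=> 0), (fun=> 1), (fun=> 0); split; [|exact: cvg_cst..].
by near=> q; split; [exact: is_derive_cst|exact: is_derive_id|exact: is_derive_cst].
Unshelve. all: by end_near. Qed.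

Lemma C1at_t p : C1at (fun p => p.2) p.
Proof.
exists (fun=> 0), (fun=> 0), (fun=> 1); split; [|exact: cvg_cst..].
by near=> q; split; [exact: is_derive_cst|exact: is_derive_cst|exact: is_derive_id].
Unshelve. all: by end_near. Qed.

Lemma C1_flowX v p (h : R) : C1 v ->
  is_derive h 1 (fun z => v (flowX z p)) (Xf v (flowX h p)).
Proof.
move=> hv; case: p => [[x y] t].
have := @diff3_chain v (flowX h ((x, y), t)) _ _ _ (fun z => x + z) (fun z => y)
  (fun z => t + 2 * y * z) h 1 0 (2 * y) erefl (C1_diff3_global _ hv).
move=> H; apply: (is_derive_eqf _ _ (H _ _ _)) => //.
- by rewrite /Xf/= mulr1 mulr0 addr0 mulrC.
- by apply: is_derive_eqf (is_derive_line x 1 h) => // z; rewrite mul1r.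
- exact: is_derive_line.
Qed.

Lemma C1_flowY v p (h : R) : C1 v ->
  is_derive h 1 (fun z => v (flowY z p)) (Yf v (flowY h p)).
Proof.
move=> hv; case: p => [[x y] t].
have := @diff3_chain v (flowY h ((x, y), t)) _ _ _ (fun z => x) (fun z => y + z)
  (fun z => t - 2 * x * z) h 0 1 (- (2 * x)) erefl (C1_diff3_global _ hv).
move=> H; apply: (is_derive_eqf _ _ (H _ _ _)) => //.
- by rewrite /Yf/= mulr1 mulr0 add0r mulrN (mulrC (dt _ _)).
- by apply: is_derive_eqf (is_derive_line y 1 h) => // z; rewrite mul1r.
- by apply: is_derive_eqf (is_derive_line t (- (2 * x)) h) => // z; rewrite mulNr.
Qed.

End C1_calculus.

(** * Bump and cutoff functions of class C^1 *)

Section cutoff.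
Variable R : realType.
Local Notation H := (R * R * R)%type.
Implicit Types (c p : H) (r z : R).

(** Squaring makes the positive part C^1, which is all the smoothness that test fields require. *)
Definition pos2 (z : R) := Num.max z 0 ^+ 2.

Lemma pos2_bound (z h : R) :
  `|pos2 h - pos2 z - 2 * Num.max z 0 * (h - z)| <= (h - z) ^+ 2.
Proof.
rewrite ler_norml /pos2; have [z0|/ltW z0] := leP z 0; have [h0|/ltW h0] := leP h 0;
  rewrite !expr2; have := sqr_ge0 h; have := sqr_ge0 z; have := sqr_ge0 (h - z);
  rewrite !expr2 => h1 h2 h3; apply/andP; split; nra.
Qed.

Lemma is_derive_pos2 (z : R) : is_derive z 1 pos2 (2 * Num.max z 0).
Proof.
apply: is_derive_bound => e e0; apply/nbhs_ballP; exists e => // h; rewrite /ball/= distrC => zh.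
apply: (le_trans (pos2_bound z h)); rewrite -[leLHS]ger0_norm ?sqr_ge0// normrX expr2.
by rewrite ler_wpM2r// ltW.
Qed.

Lemma continuous_max0 : continuous (fun z : R => Num.max z 0).
Proof. by move=> z; apply: continuous_max; [exact: cvg_id|exact: cvg_cst]. Qed.

Lemma pos2_ge0 z : 0 <= pos2 z.
Proof. exact: sqr_ge0. Qed.

Lemma pos2_eq0 z : z <= 0 -> pos2 z = 0.
Proof. by move=> z0; rewrite /pos2 max_r// expr0n. Qed.

Definition smoothstep (z : R) := pos2 z / (pos2 z + pos2 (1 - z)).

Lemma smoothstep_den (z : R) : 0 < pos2 z + pos2 (1 - z).
Proof. by rewrite /pos2 /Num.max; case: ifPn; case: ifPn; rewrite -?leNgt; nra. Qed.

Lemma smoothstep_itv z : 0 <= smoothstep z <= 1.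
Proof.
rewrite /smoothstep divr_ge0 ?pos2_ge0 ?(ltW (smoothstep_den z))//=.
by rewrite ler_pdivrMr ?smoothstep_den// mul1r lerDl pos2_ge0.
Qed.

Lemma smoothstep_le0 z : z <= 0 -> smoothstep z = 0.
Proof. by move=> /pos2_eq0; rewrite /smoothstep => ->; rewrite mul0r. Qed.

Lemma smoothstep_ge1 z : 1 <= z -> smoothstep z = 1.
Proof.
move=> z1; have := smoothstep_den z; rewrite /smoothstep.
by rewrite (@pos2_eq0 (1 - z)) ?subr_le0// addr0 => /lt0r_neq0/divff.
Qed.

Definition smoothstep' (z : R) :=
  2 * Num.max z 0 * (pos2 z + pos2 (1 - z))^-1 +
  pos2 z * (- ((pos2 z + pos2 (1 - z))^-1 * (pos2 z + pos2 (1 - z))^-1) *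
    (2 * Num.max z 0 - 2 * Num.max (1 - z) 0)).

Lemma is_derive_smoothstep (z : R) : is_derive z 1 smoothstep (smoothstep' z).
Proof.
have D1 := is_derive_pos2 z.
have D2 : is_derive z 1 (fun s => pos2 (1 - s)) (- (2 * Num.max (1 - z) 0)).
  have L : is_derive z 1 (fun s : R => 1 - s) (-1).
    by apply: is_derive_eqf (is_derive_line 1 (-1) z) => // s; rewrite mulN1r.
  have E := @is_derive_chain R pos2 (fun s => 1 - s) z _ _ (is_derive_pos2 (1 - z)) L.
  by apply: is_derive_eqf E => //; rewrite mulrN1.
have D3 := @is_deriveV R (fun s => pos2 s + pos2 (1 - s)) z _ 1 (lt0r_neq0 (smoothstep_den z))
  (is_derive_add D1 D2).
by apply: is_derive_eqf (is_derive_mul D1 D3) => //; rewrite -exprVn expr2.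
Qed.

Lemma continuous_pos2 : continuous pos2.
Proof. by move=> z; apply: is_derive_continuous (is_derive_pos2 z). Qed.

Lemma continuous_smoothstep' : continuous smoothstep'.
Proof.
move=> z.
have c1 : {for z, continuous (fun s : R => 1 - s)}.
  by apply: cvgB; [exact: cvg_cst|exact: cvg_id].
have cm : {for z, continuous (fun s : R => Num.max s 0)} by exact: continuous_max0.
have cp : {for z, continuous pos2} by exact: continuous_pos2.
have cm1 : {for z, continuous (fun s : R => Num.max (1 - s) 0)}.
  by apply: (@continuous_comp _ _ _ (fun s : R => 1 - s) (fun s => Num.max s 0)) => //; exact: continuous_max0.
have cp1 : {for z, continuous (fun s : R => pos2 (1 - s))}.
  by apply: (@continuous_comp _ _ _ (fun s : R => 1 - s) pos2) => //; exact: continuous_pos2.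
have cV : {for z, continuous (fun s : R => (pos2 s + pos2 (1 - s))^-1)}.
  by apply: cvgV; [exact: lt0r_neq0 (smoothstep_den z)|apply: cvgD].
have c2 : {for z, continuous (fun s : R => 2 * Num.max s 0)} by apply: cvgM => //; exact: cvg_cst.
have c3 : {for z, continuous (fun s : R => 2 * Num.max (1 - s) 0)} by apply: cvgM => //; exact: cvg_cst.
apply: cvgD; first exact: cvgM.
apply: cvgM => //; apply: cvgM; last exact: cvgB.
by apply: cvgN; exact: cvgM.
Qed.

(** At least 1 where the Euclidean distance to [c] is at most [r], and 0 from the distance
    [sqrt 2 * r] on. The square of the Euclidean norm is a polynomial; boxes serve only to locate
    the support. *)
Definition bump (c : H) (r : R) (p : H) : R :=
  pos2 (2 + - r ^- 2 * ((p.1.1 - c.1.1) * (p.1.1 - c.1.1) +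
    (p.1.2 - c.1.2) * (p.1.2 - c.1.2) + (p.2 - c.2) * (p.2 - c.2))).

Lemma C1at_bump c r p : C1at (bump c r) p.
Proof.
apply: (C1at_comp (f' := fun z => 2 * Num.max z 0)).
- exact: is_derive_pos2.
- by move=> z; apply: cvgM; [exact: cvg_cst|exact: continuous_max0].
apply: C1atD; first exact: C1at_cst.
apply: C1atM; first exact: C1at_cst.
have Cx : C1at (fun p : H => p.1.1 - c.1.1) p by apply: C1atD; [exact: C1at_x|exact: C1at_cst].
have Cy : C1at (fun p : H => p.1.2 - c.1.2) p by apply: C1atD; [exact: C1at_y|exact: C1at_cst].
have Ct : C1at (fun p : H => p.2 - c.2) p by apply: C1atD; [exact: C1at_t|exact: C1at_cst].
by apply: C1atD; [apply: C1atD|]; apply: C1atM.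
Qed.

Definition box (c : H) (r : R) : set H := [set p | [/\ `|p.1.1 - c.1.1| <= r,
  `|p.1.2 - c.1.2| <= r & `|p.2 - c.2| <= r]].

Lemma box_compact c r : compact (box c r).
Proof.
rewrite (_ : box c r = `[c.1.1 - r, c.1.1 + r]%classic `*` `[c.1.2 - r, c.1.2 + r]%classic `*`
    `[c.2 - r, c.2 + r]%classic).
  by apply: compact_setX; [apply: compact_setX|]; exact: segment_compact.
by apply/seteqP; split => -[[x y] t]; rewrite /box /= !in_itv/= !ler_distl;
  [move=> [] | move=> [[]]].
Qed.

Lemma bump_box c r p : 0 < r -> bump c r p != 0 -> box c (2 * r) p.
Proof.
move=> r0 hb; have : 0 < 2 + - r ^- 2 * ((p.1.1 - c.1.1) * (p.1.1 - c.1.1) +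
    (p.1.2 - c.1.2) * (p.1.2 - c.1.2) + (p.2 - c.2) * (p.2 - c.2)).
  by rewrite ltNge; apply: contra hb => /pos2_eq0; rewrite /bump => ->.
rewrite mulNr subr_gt0 mulrC ltr_pdivrMr ?exprn_gt0// => h.
have key (a s : R) : 0 <= s -> a * a + s < 2 * r ^+ 2 -> `|a| <= 2 * r.
  move=> s0 ha; rewrite leNgt; apply/negP => ra.
  have : (2 * r) * (2 * r) < `|a| * `|a| by rewrite ltr_pM// mulr_ge0// ltW.
  by rewrite -normrM -expr2 ger0_norm ?sqr_ge0// expr2; move: ha; rewrite expr2; nra.
have sq (a : R) : 0 <= a * a by rewrite -expr2 sqr_ge0.
split; [apply: (key _ ((p.1.2 - c.1.2) * (p.1.2 - c.1.2) + (p.2 - c.2) * (p.2 - c.2)))|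
  apply: (key _ ((p.1.1 - c.1.1) * (p.1.1 - c.1.1) + (p.2 - c.2) * (p.2 - c.2)))|
  apply: (key _ ((p.1.1 - c.1.1) * (p.1.1 - c.1.1) + (p.1.2 - c.1.2) * (p.1.2 - c.1.2)))];
  rewrite ?addr_ge0//; lra.
Qed.

Lemma bump_ge0 c r p : 0 <= bump c r p.
Proof. exact: pos2_ge0. Qed.

Lemma bump_ge1 c r p : 0 < r -> box c (r / 2) p -> 1 <= bump c r p.
Proof.
move=> r0 [h1 h2 h3]; have sq (z : R) : `|z| <= r / 2 -> z * z <= r ^+ 2 / 4.
  rewrite ler_norml => /andP[? ?]; rewrite expr2; nra.
have := sq _ h1; have := sq _ h2; have := sq _ h3 => s3 s2 s1.
have : 1 <= 2 + - r ^- 2 * ((p.1.1 - c.1.1) * (p.1.1 - c.1.1) +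
    (p.1.2 - c.1.2) * (p.1.2 - c.1.2) + (p.2 - c.2) * (p.2 - c.2)).
  have : r ^- 2 * ((p.1.1 - c.1.1) * (p.1.1 - c.1.1) +
    (p.1.2 - c.1.2) * (p.1.2 - c.1.2) + (p.2 - c.2) * (p.2 - c.2)) <= 1.
    by rewrite mulrC ler_pdivrMr ?exprn_gt0// mul1r; have := sqr_ge0 r; lra.
  by rewrite mulNr; lra.
by rewrite /bump /pos2 => h; rewrite max_l ?(le_trans _ h)// expr2; nra.
Qed.

Lemma C1at_sum (s : seq H) (r : H -> R) p : C1at (fun p => \sum_(i <- s) bump i (r i) p) p.
Proof.
elim: s => [|i s ih]; under eq_fun do rewrite ?big_nil ?big_cons; first exact: C1at_cst.
by apply: C1atD => //; exact: C1at_bump.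
Qed.

Lemma R3_hausdorff : hausdorff_space H.
Proof. exact: norm_hausdorff. Qed.

Lemma cpt_in_subset (A B O : set H) : A `<=` B -> cpt_in B O -> cpt_in A O.
Proof.
move=> AB [cB BO]; have cAB := closureS AB; split; last exact: subset_trans cAB BO.
by apply: subclosed_compact cB cAB; exact: closed_closure.
Qed.

Lemma cpt_in_compact (A K O : set H) : compact K -> A `<=` K -> K `<=` O -> cpt_in A O.
Proof.
move=> cK AK KO; have clK := compact_closed R3_hausdorff cK.
apply: (cpt_in_subset AK); split; first by rewrite -(closure_id _).1.
by rewrite -(closure_id _).1.
Qed.

(** Finitely many bumps add up to at least 1 near [K], and [smoothstep] levels the sum to the
    constant 1 there. Being 1 in a neighbourhood, not only on [K], keeps the derivatives of a field
    on [K] unchanged under multiplication by [chi]. *)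
Lemma cutoff (K O : set H) : compact K -> open O -> K `<=` O ->
  exists chi : H -> R, [/\ C1c O chi, forall p, 0 <= chi p <= 1 &
    forall p, K p -> \forall p' \near p, chi p' = 1].
Proof.
move=> cK oO KO.
have /choice[r hr] : forall p, exists r : R, 0 < r /\ (K p -> box p (2 * r) `<=` O).
  move=> p; have [Kp|nKp] := pselect (K p); last by exists 1; split => // /nKp.
  have /near3P[e [e0 he]] : \forall p' \near p, O p' by apply: open_nbhs_nbhs; split => //; exact: KO.
  exists (e / 4); split; first by rewrite divr_gt0.
  move=> _ p' [h1 h2 h3]; have lt : 2 * (e / 4) < e by lra.
  by apply: he; [exact: le_lt_trans h1 lt|exact: le_lt_trans h2 lt|exact: le_lt_trans h3 lt].
have oB p : open (interior (box p (r p / 2))) by exact: open_interior.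
have inB p : interior (box p (r p / 2)) p.
  have r2 : 0 < r p / 2 by rewrite divr_gt0//; case: (hr p).
  by apply/near3P; exists (r p / 2); split => // p' /ltW h1 /ltW h2 /ltW h3.
pose PH : ptopologicalType := HB.pack H (isPointed.Build H (0, 0, 0)).
have cK' : @cover_compact H K.
  by move: (cK); rewrite -[compact K]/(@compact PH K) (@compact_cover PH).
clear PH; move: cK' => /(_ H K (fun p => interior (box p (r p / 2))))[].
- by move=> p _; exact: oB.
- by move=> p Kp; exists p => //; exact: inB.
move=> s0 sK sC; pose s : seq H := finmap.enum_fset s0.
pose S p := \sum_(i <- s) bump i (r i) p.
have S0 p : 0 <= S p by apply: sumr_ge0 => i _; exact: bump_ge0.
exists (fun p => smoothstep (S p)); split.
- split.
    apply: C1at_C1 => p; apply: (C1at_comp is_derive_smoothstep continuous_smoothstep').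
    exact: C1at_sum.
  pose C := \big[setU/set0]_(i <- s) box i (2 * r i).
  have cC : compact C by apply: bigsetU_compact => i _; exact: box_compact.
  have CE p : C p <-> exists2 i, i \in s & box i (2 * r i) p.
    by rewrite /C -bigcup_seq; split => [[i] |[i]] /=; exists i.
  apply: (cpt_in_compact cC); last first.
    by move=> p /CE[i /sK /set_mem Ki]; have [_ ] := hr i; apply.
  move=> p /= hp; apply/CE; apply: contrapT => hn; move: hp; apply/negP; rewrite negbK.
  rewrite /S big_seq big1 ?smoothstep_le0// => i si; apply/eqP/negPn/negP => hb.
  by apply: hn; exists i => //; apply: bump_box hb; case: (hr i).
- by move=> p; exact: smoothstep_itv.
move=> p /sC[i /= si0 ip]; have si : i \in s by exact: si0.
have : \forall p' \near p, box i (r i / 2) p' by exact: ip.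
apply: filterS => p' hp'; apply: smoothstep_ge1; rewrite /S.
rewrite (big_rem i)//= (le_trans (bump_ge1 _ hp')) ?lerDl//; first by case: (hr i).
by apply: sumr_ge0 => j _; exact: bump_ge0.
Qed.

End cutoff.

(** * Divergence formulas for subgraphs *)

Section finitely_supported.
Context d (T : measurableType d) (R : realType) (mu : {measure set T -> \bar R}).
Implicit Types (f : T -> R) (D : set T) (M : R).

Lemma fs_indic_integrable D : measurable D -> (mu D < +oo)%E ->
  mu.-integrable setT (EFin \o (\1_D : T -> R)).
Proof.
move=> mD Dfin; apply/integrableP; split; first exact/measurable_EFinP/measurable_indic.
rewrite (eq_integral (fun x => (\1_D x)%:E)) ?integral_indic ?setIT// => x _ /=.
by rewrite ger0_norm.
Qed.

Lemma fs_indic_Rintegral D : measurable D -> (\int[mu]_x \1_D x)%R = fine (mu D).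
Proof. by move=> mD; rewrite /Rintegral integral_indic// setIT. Qed.

Lemma fs_cst_integrable D M : measurable D -> (mu D < +oo)%E ->
  mu.-integrable setT (EFin \o (fun x => M * \1_D x)).
Proof. by move=> mD Dfin; exact: (integrableZl measurableT M (fs_indic_integrable mD Dfin)). Qed.

Lemma fs_integrable f D M : measurable_fun setT f -> measurable D -> (mu D < +oo)%E ->
  (forall x, `|f x| <= M) -> (forall x, ~ D x -> f x = 0) ->
  mu.-integrable setT (EFin \o f).
Proof.
move=> mf mD Dfin fM f0.
apply: (le_integrable _ _ _ (fs_cst_integrable M mD Dfin)) => //; first exact/measurable_EFinP.
move=> x _ /=; rewrite lee_fin indicE; have [/set_mem xD|/negP xD] := boolP (x \in D).
  by rewrite mulr1 (le_trans (fM x))// ler_norm.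
by rewrite f0 ?normr0// => /mem_set.
Qed.

Lemma fs_Rintegral_le f (g : T -> R) : mu.-integrable setT (EFin \o f) ->
  mu.-integrable setT (EFin \o g) -> (forall x, `|f x| <= g x) ->
  `|(\int[mu]_x f x)%R| <= (\int[mu]_x g x)%R.
Proof.
move=> If Ig fg; apply: (le_trans (le_normr_Rintegral measurableT If)).
apply: le_Rintegral => //; have := integrable_norm If; exact.
Qed.

End finitely_supported.

Section fiber.
Variable R : realType.
Local Notation leb := (@lebesgue_measure R).

Lemma lebesgue_itv_fine (a b : R) (x y : bool) :
  fine (leb [set` Interval (BSide x a) (BSide y b)]) = Num.max (b - a) 0.
Proof.
rewrite lebesgue_measure_itv/= lte_fin; case: ltP => ab /=.
  by rewrite max_l// subr_ge0 ltW.
by rewrite max_r// subr_le0.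
Qed.

Lemma lebesgue_itv_lty (a b : R) (x y : bool) :
  (leb [set` Interval (BSide x a) (BSide y b)] < +oo)%E.
Proof. by rewrite lebesgue_measure_itv/= lte_fin; case: ifP => _; rewrite ltry. Qed.

(** Neither half line has finite measure, but the difference of the indicators is a signed indicator
    of the interval between [u'] and [u], whatever their order. *)
Lemma Rintegral_half_line_diff (u' u : R) (k : R) :
  leb.-integrable setT (EFin \o (fun s => k * (\1_(`]u', +oo[) s - \1_(`]u, +oo[) s))) /\
  (\int[leb]_s (k * (\1_(`]u', +oo[) s - \1_(`]u, +oo[) s)))%R = k * (u - u').
Proof.
have E : (fun s => k * (\1_(`]u', +oo[) s - \1_(`]u, +oo[) s)) =
   (fun s => k * \1_(`]u', u]) s - k * \1_(`]u, u']) s).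
  apply/funext => s; rewrite -mulrBr; congr (k * _).
  rewrite !indicE !mem_setE !in_itv/= !andbT.
  by do 2 case: ltP => ? /=; rewrite ?subrr ?subr0 ?sub0r//; lra.
have I (a b : R) : leb.-integrable setT (EFin \o (fun s => k * \1_(`]a, b]%classic : set R) s)).
  by apply: (fs_cst_integrable (mu := leb)); [exact: measurable_itv|exact: lebesgue_itv_lty].
rewrite E; split; first exact: integrableB (I _ _) (I _ _).
rewrite RintegralB//.
have J (a b : R) : (\int[leb]_s (k * \1_(`]a, b]%classic : set R) s))%R = k * Num.max (b - a) 0.
  rewrite RintegralZl//; last first.
    by apply: (fs_indic_integrable (mu := leb)); [exact: measurable_itv|exact: lebesgue_itv_lty].
  by rewrite fs_indic_Rintegral ?lebesgue_itv_fine//; exact: measurable_itv.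
by rewrite !J -mulrBr; congr (k * _); rewrite /Num.max; do 2 case: ifPn; rewrite -?leNgt; lra.
Qed.

(* Moving the end point of a half line by [- be * h], up to an error of order
   [h ^+ 2], changes the integral of [f] at rate [be * f u]. *)
Lemma fiber_estimate (f : R -> R) (A : set R) (M L N u be h c b0 : R) :
  measurable_fun setT f -> measurable A ->
  (forall s, `|f s| <= M) -> (forall s s', `|f s - f s'| <= L * `|s - s'|) ->
  (forall s, N < `|s| -> f s = 0) -> 0 <= L -> 0 <= h -> 0 <= c -> `|be| <= b0 ->
  (forall s, f s != 0 -> u - be * h + c * h ^+ 2 < s -> A s) ->
  (forall s, f s != 0 -> s < u - be * h - c * h ^+ 2 -> ~ A s) ->
  `|(\int[leb]_s (f s * (\1_A s - \1_(`]u, +oo[) s)))%R - h * (be * f u)|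
    <= (2 * c * M + L * b0 ^+ 2) * h ^+ 2.
Proof.
move=> mf mA fM fL fN L0 h0 c0 beb0 hA1 hA2.
have M0 : 0 <= M by exact: le_trans (fM 0).
pose u' := u - be * h.
pose g1 s := f s * (\1_A s - \1_(`]u, +oo[) s).
pose g2 s := f u * (\1_(`]u', +oo[) s - \1_(`]u, +oo[) s).
have mhalf (w : R) : measurable (`]w, +oo[%classic : set R) by exact: measurable_itv.
have mg1 : measurable_fun setT g1.
  by apply: measurable_funM => //; apply: measurable_funB; apply: measurable_indic.
have Ig1 : leb.-integrable setT (EFin \o g1).
  apply: (@fs_integrable _ _ _ leb g1 `[- N, N]%classic M) => //.
  - exact: lebesgue_itv_lty.
  - move=> s; rewrite /g1 normrM -[leRHS]mulr1 ler_pM// !indicE.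
    by case: (_ \in _); case: (_ \in _); rewrite ?subrr ?subr0 ?sub0r ?normrN ?normr0 ?normr1.
  - move=> s /=; rewrite in_itv/= -ler_norml => /negP; rewrite -ltNge => /fN.
    by rewrite /g1 => ->; rewrite mul0r.
have [Ig2 Eg2] := Rintegral_half_line_diff u' u (f u); rewrite -/g2 in Ig2 Eg2.
have -> : h * (be * f u) = (\int[leb]_s g2 s)%R by rewrite Eg2 /u'; ring.
rewrite -RintegralB//.
(* [I1] is the window, of length [2 * c * h ^+ 2], in which [A] is not controlled; the error there
   is at most [M]. [I2] is the interval between [u] and [u'], of length at most [b0 * h]; replacing
   [f s] by [f u] there costs at most [L * (b0 * h)]. *)
pose I1 : set R := `[u' - c * h ^+ 2, u' + c * h ^+ 2]%classic.
pose I2 : set R := `[Num.min u u', Num.max u u']%classic.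
have J1 := @fs_cst_integrable _ _ _ leb I1 M (measurable_itv _) (lebesgue_itv_lty _ _ _ _).
have J2 := @fs_cst_integrable _ _ _ leb I2 (L * (b0 * h)) (measurable_itv _) (lebesgue_itv_lty _ _ _ _).
apply: (@le_trans _ _ (\int[leb]_s (M * \1_I1 s + L * (b0 * h) * \1_I2 s))%R).
  apply: fs_Rintegral_le; [exact: (integrableB measurableT Ig1 Ig2)|exact: (integrableD measurableT J1 J2)|].
  suff key (s : R) : `|g1 s - g2 s| <= M * \1_I1 s + L * (b0 * h) * \1_I2 s by exact: key.
  rewrite (_ : g1 s - g2 s = f s * (\1_A s - \1_(`]u', +oo[) s) +
    (f s - f u) * (\1_(`]u', +oo[) s - \1_(`]u, +oo[) s)); last by rewrite /g1 /g2; ring.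
  apply: (le_trans (ler_normD _ _)); apply: lerD.
    rewrite normrM; have [sI1|nI1] := boolP (s \in I1).
      rewrite [X in _ <= M * X]indicE sI1 ler_pM// !indicE.
      by case: (_ \in _); case: (_ \in _); rewrite ?subrr ?subr0 ?sub0r ?normrN ?normr0 ?normr1.
    have [->|fs0] := eqVneq (f s) 0; first by rewrite normr0 mul0r mulr_ge0.
    rewrite (_ : \1_A s - \1_(`]u', +oo[) s = 0) ?normr0 ?mulr0 ?mulr_ge0//.
    move: nI1; rewrite /I1 mem_setE in_itv/= negb_and -!ltNge => /orP[lt|lt].
      have nA := hA2 s fs0 lt; rewrite !indicE memNset// mem_setE in_itv/= andbT.
      have -> : (u' < s) = false.
        by apply/negbTE; rewrite -leNgt (ltW (lt_le_trans lt _))// gerBl mulr_ge0// sqr_ge0.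
      by rewrite subrr.
    have Ay := hA1 s fs0 lt; rewrite !indicE mem_set// mem_setE in_itv/= andbT.
    by rewrite (_ : u' < s) ?subrr// (le_lt_trans _ lt)// lerDl mulr_ge0// sqr_ge0.
  rewrite normrM; have [sI2|nI2] := boolP (s \in I2).
    rewrite [X in _ <= _ * X]indicE sI2 ler_pM//.
      apply: (le_trans (fL _ _)); rewrite ler_wpM2l//.
      have bh : `|u - u'| <= b0 * h by rewrite /u' opprB addrC subrK normrM (ger0_norm h0) ler_wpM2r.
      apply: le_trans bh; move: sI2; rewrite /I2 mem_setE in_itv/=.
      rewrite /Num.min /Num.max; case: ifPn; rewrite -?leNgt => uu /andP[? ?].
        by rewrite (ler0_norm (_ : u - u' <= 0)) ?ler_norml; lra.
      by rewrite (ger0_norm (_ : 0 <= u - u')) ?ler_norml; lra.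
    rewrite !indicE.
    by case: (_ \in _); case: (_ \in _); rewrite ?subrr ?subr0 ?sub0r ?normrN ?normr0 ?normr1.
  rewrite (_ : \1_(`]u', +oo[) s - \1_(`]u, +oo[) s = 0) ?normr0 ?mulr0.
    by rewrite !mulr_ge0// (le_trans _ beb0).
  move: nI2; rewrite /I2 mem_setE in_itv/= negb_and -!ltNge !indicE !mem_setE !in_itv/= !andbT => /orP[].
    by rewrite lt_min => /andP[/ltW su /ltW su']; rewrite !ltNge su su' subrr.
  by rewrite gt_max => /andP[-> ->]; rewrite subrr.
rewrite RintegralD// !RintegralZl//; try (apply: (fs_indic_integrable (mu := leb));
  [exact: measurable_itv|exact: lebesgue_itv_lty]).
rewrite !fs_indic_Rintegral; try exact: measurable_itv.
rewrite !lebesgue_itv_fine.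
have ch : 0 <= c * h ^+ 2 by rewrite mulr_ge0// sqr_ge0.
rewrite (_ : u' + c * h ^+ 2 - (u' - c * h ^+ 2) = 2 * (c * h ^+ 2)); last by ring.
rewrite max_l ?mulr_ge0//.
have mm : Num.max (Num.max u u' - Num.min u u') 0 <= b0 * h.
  have bh : `|u - u'| <= b0 * h by rewrite /u' opprB addrC subrK normrM (ger0_norm h0) ler_wpM2r.
  have b0h : 0 <= b0 * h by rewrite mulr_ge0// (le_trans _ beb0).
  rewrite ge_max b0h andbT (le_trans _ bh)// /Num.min /Num.max.
  by case: ifPn => _; rewrite ?ler_norm // distrC ler_norm.
have b0h : 0 <= L * (b0 * h) by rewrite !mulr_ge0// (le_trans _ beb0).
have := ler_wpM2l b0h mm; rewrite !expr2; lra.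
Qed.

End fiber.

(** * Differentiation of integrals along volume-preserving flows *)

Section flows.
Variable R : realType.
Local Notation H := (R * R * R)%type.
Local Notation leb := (@lebesgue_measure R).
Local Notation leb2 := (@leb2 R).
Local Notation leb3 := (@leb3 R).
Let O3 : H := ((0, 0), 0).

Lemma boxE (c : H) (r : R) : box c r =
  `[c.1.1 - r, c.1.1 + r]%classic `*` `[c.1.2 - r, c.1.2 + r]%classic `*`
    `[c.2 - r, c.2 + r]%classic.
Proof.
by apply/seteqP; split => -[[x y] t]; rewrite /box /= !in_itv/= !ler_distl;
  [move=> [] | move=> [[]]].
Qed.

Lemma measurable_box (c : H) (r : R) : measurable (box c r).
Proof. by rewrite boxE; apply: measurableX; first apply: measurableX; exact: measurable_itv. Qed.

Lemma leb3_box_lty (c : H) (r : R) : (leb3 (box c r) < +oo)%E.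
Proof.
have mI (a b : R) : measurable (`[a, b]%classic : set (measurableTypeR R)) by exact: measurable_itv.
have f (a b : R) : leb `[a, b] \is a fin_num.
  by rewrite ge0_fin_numE//; exact: lebesgue_itv_lty.
have f2 (a b c' d : R) : leb2 (`[a, b]%classic `*` `[c', d]%classic) \is a fin_num.
  by rewrite /leb2 product_measure1E; try exact: mI; apply: fin_numM; exact: f.
rewrite boxE /leb3 product_measure1E//; last by apply: measurableX; exact: mI.
rewrite -ge0_fin_numE ?mule_ge0//.
by apply: fin_numM; [exact: f2|exact: f].
Qed.

(** The properties shared by [flowX] and [flowY], so that one argument serves both. In [3 * N + 1]
    one coordinate is shifted by [h] and [t] by at most [2 * N * |h|]; all [v (T h p)] with
    [|h| <= 1] are thereby supported in one box. *)
Record admissible_flow (T : R -> H -> H) : Prop := {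
  flow0 : forall p, T 0 p = p;
  flowK : forall h p, T h (T (- h) p) = p;
  flow_mp : forall h, measure_preserving leb3 leb3 (T h);
  flow_box : forall (h N : R) p, `|h| <= 1 -> box O3 N (T h p) -> box O3 (3 * N + 1) p }.

Lemma flowX_admissible : admissible_flow (@flowX R).
Proof.
split.
- by move=> [[x y] t]; rewrite /flowX/= mulr0 !addr0.
- by move=> h [[x y] t]; rewrite /flowX/=; congr ((_, _), _); ring.
- exact: flowX_measure_preserving.
- move=> h N [[x y] t]; rewrite /box/flowX/= => h1 []; rewrite !subr0 !ler_norml.
  by move: h1; rewrite ler_norml => /andP[h1 h2] /andP[a1 a2] /andP[b1 b2] /andP[c1 c2];
    split; apply/andP; split; nra.
Qed.

Lemma flowY_admissible : admissible_flow (@flowY R).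
Proof.
split.
- by move=> [[x y] t]; rewrite /flowY/= mulr0 addr0 subr0.
- by move=> h [[x y] t]; rewrite /flowY/=; congr ((_, _), _); ring.
- exact: flowY_measure_preserving.
- move=> h N [[x y] t]; rewrite /box/flowY/= => h1 []; rewrite !subr0 !ler_norml.
  by move: h1; rewrite ler_norml => /andP[h1 h2] /andP[a1 a2] /andP[b1 b2] /andP[c1 c2];
    split; apply/andP; split; nra.
Qed.

Section derivative_along_flow.
Variables (T : R -> H -> H) (v Vv : H -> R) (E : set H) (N M : R).
Hypotheses (adT : admissible_flow T) (mE : measurable E).
Hypotheses (cv : continuous v) (cVv : continuous Vv).
Hypothesis dv : forall p (h : R), is_derive h 1 (fun z => v (T z p)) (Vv (T h p)).
Hypotheses (vM : forall p, `|v p| <= M) (VvM : forall p, `|Vv p| <= M).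
Hypothesis vN : forall p, v p != 0 -> box O3 N p.

Let N0 p : v p != 0 -> box O3 (3 * N + 1) p.
Proof. by move=> /vN; rewrite -{1}(flow0 adT p); apply: (flow_box adT); rewrite normr0. Qed.

Let M0 : 0 <= M. Proof. exact: le_trans (vM O3). Qed.

Let mv : measurable_fun setT v. Proof. exact: continuous_measurable_fun_R3. Qed.
Let mVv : measurable_fun setT Vv. Proof. exact: continuous_measurable_fun_R3. Qed.
Let mvT h : measurable_fun setT (fun p => v (T h p)).
Proof. by apply: measurableT_comp => //; have [] := flow_mp adT h. Qed.
Let mI : measurable_fun setT (\1_E : H -> R). Proof. exact: measurable_indic. Qed.

Let B := box O3 (3 * N + 1).
Let mB : measurable B. Proof. exact: measurable_box. Qed.
Let Bfin : (leb3 B < +oo)%E. Proof. exact: leb3_box_lty. Qed.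

Let ind_le (A : set H) p (x : R) : `|\1_A p * x| <= `|x|.
Proof.
rewrite normrM ler_piMl// indicE; case: (_ \in _) => /=; by rewrite ?normr1 ?normr0.
Qed.

Let IvT h : `|h| <= 1 -> leb3.-integrable setT (EFin \o (fun p => \1_E p * v (T h p))).
Proof.
move=> h1; apply: (@fs_integrable _ _ _ leb3 _ B M) => //.
- exact: (measurable_funM mI (mvT h)).
- by move=> p; rewrite (le_trans (ind_le _ _ _)).
- move=> p nB; rewrite (_ : v _ = 0) ?mulr0//; apply/eqP/negPn/negP => /vN.
  by move/(flow_box adT h1).
Qed.

(** The orbit of a point outside [B] avoids the support of [v] for all times below 1, so the
    derivative at time 0 vanishes. *)
Lemma flow_Vv_eq0 p : ~ B p -> Vv p = 0.
Proof.
move=> nB.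
have := dv p 0; rewrite (flow0 adT) => D.
have K : is_derive (0 : R) 1 (fun z => v (T z p)) 0.
  apply: near_eq_is_derive (is_derive_cst (0 : R) (0 : R) (1 : R)).
  apply/nbhs_ballP; exists 1 => //= h; rewrite /ball/= sub0r normrN => /ltW h1.
  apply/esym/eqP/negPn/negP => /vN; by move/(flow_box adT h1).
by have [_ <-] := D; have [_ ->] := K.
Qed.

Lemma flow_integrable : leb3.-integrable setT (EFin \o (fun p => \1_E p * Vv p)).
Proof.
apply: (@fs_integrable _ _ _ leb3 _ B M) => //.
- exact: (measurable_funM mI mVv).
- by move=> p; rewrite (le_trans (ind_le _ _ _)).
- by move=> p /flow_Vv_eq0 ->; rewrite mulr0.
Qed.

(** Dominated convergence: the difference quotients with step [n.+1%:R^-1] converge pointwise to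
    [Vv], and the mean value bound keeps them below [M] on [B], outside of which they vanish. *)
Lemma flow_derivative :
  (fun n : nat => n.+1%:R * ((\int[leb3]_p (\1_E p * v (T n.+1%:R^-1 p)))%R -
     (\int[leb3]_p (\1_E p * v p))%R)) @ \oo --> (\int[leb3]_p (\1_E p * Vv p))%R.
Proof.
have h1 n : `|n.+1%:R^-1 : R| <= 1.
  by rewrite ger0_norm// invf_le1// ler1n.
pose f_ (n : nat) p := (\1_E p * (n.+1%:R * (v (T n.+1%:R^-1 p) - v p)))%:E.
pose f p := (\1_E p * Vv p)%:E.
have ptw p : f_ ^~ p @ \oo --> f p.
  apply/cvg_EFin; first by near=> n.
  rewrite /comp /=; apply: cvgM; first exact: cvg_cst.
  apply/cvgrPdist_le => e e0.
  have := is_derive_boundP (dv p 0) e0; rewrite (flow0 adT) => /nbhs_ballP[r /= r0 hr].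
  near=> n.
  have nr : ball (0 : R) r n.+1%:R^-1.
    rewrite /ball/= sub0r normrN ger0_norm//; near: n.
    exact: (near_infty_natSinv_lt (PosNum r0)).
  have := hr _ nr; rewrite !subr0 => H.
  have n0 : 0 < n.+1%:R^-1 :> R by rewrite invr_gt0.
  rewrite (_ : _ - _ = n.+1%:R * (Vv p / n.+1%:R - (v (T n.+1%:R^-1 p) - v p))); last first.
    by rewrite [RHS]mulrBr mulrCA divff ?mulr1.
  rewrite normrM ger0_norm// -ler_pdivlMl// distrC (le_trans H)//.
  by rewrite gtr0_norm// mulrC.
have bound n p : (`|f_ n p| <= (M * \1_B p)%:E)%E.
  rewrite /f_ /= lee_fin; apply: (le_trans (ind_le _ _ _)).
  rewrite indicE; have [/set_mem pB|/negP pB] := boolP (p \in B).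
    rewrite mulr1 normrM ger0_norm// -ler_pdivlMl// mulrC.
    have := @mvt_bound R (fun z => v (T z p)) (fun z => Vv (T z p)) 0 n.+1%:R^-1 0 M
      (fun z _ => dv p z).
    rewrite mul0r !subr0 (flow0 adT) => K; apply: (le_trans (K _)).
      by move=> z _; rewrite subr0.
    by rewrite ger0_norm.
  have nB : ~ B p by move=> /mem_set.
  have -> : v (T n.+1%:R^-1 p) = 0.
    by apply/eqP/negPn/negP => /vN; move/(flow_box adT (h1 n)).
  have -> : v p = 0 by apply/eqP/negPn/negP => /N0.
  by rewrite subrr mulr0 normr0 mulr0.
have mf_ n : measurable_fun setT (f_ n).
  have mB' := measurable_funB (mvT n.+1%:R^-1) mv.
  have k1 : measurable_fun setT (fun p => n.+1%:R * (v (T n.+1%:R^-1 p) - v p)).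
    by apply: measurable_funM mB'; exact: measurable_cst.
  have k2 := measurable_funM mI k1; move/measurable_EFinP : k2; exact.
have mf : measurable_fun setT f.
  by have k2 := measurable_funM mI mVv; move/measurable_EFinP : k2; exact.
have Ig := @fs_cst_integrable _ _ _ leb3 B M mB Bfin.
have H1 : {ae leb3, forall p, setT p -> f_ ^~ p @ \oo --> f p}.
  by apply: aeW => p _; exact: ptw.
have H2 : {ae leb3, forall p n, setT p -> (`|f_ n p| <= (M * \1_B p)%:E)%E}.
  by apply: aeW => p n _; exact: bound.
have [_ _ C] := @dominated_convergence _ _ _ leb3 setT measurableT f_ f _ mf_ mf H1 Ig H2.
have {}C : (fun n => fine (\int[leb3]_p f_ n p)%E) @ \oo --> (\int[leb3]_p (\1_E p * Vv p))%R.
  apply: fine_cvg; rewrite /Rintegral fineK; first exact: C.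
  exact: integrable_fin_num flow_integrable.
apply: cvg_trans C; apply: near_eq_cvg; near=> n.
have Iv0 : leb3.-integrable setT (EFin \o (fun p => \1_E p * v p)).
  have := IvT (h := 0); rewrite normr0 ler01 => /(_ isT).
  by under eq_fun do rewrite (flow0 adT).
have Ivn := IvT (h1 n).
rewrite -(RintegralB measurableT Ivn Iv0) -RintegralZl//; last first.
  exact: (integrableB measurableT Ivn Iv0).
by apply: eq_Rintegral => p _ /=; ring.
Unshelve. all: by end_near. Qed.

End derivative_along_flow.
End flows.

Lemma leb2_square_lty (R : realType) (a b : R) :
  (@leb2 R (`[a, b]%classic `*` `[a, b]%classic) < +oo)%E.
Proof.
have mI (x y : R) : measurable (`[x, y]%classic : set (measurableTypeR R)) by exact: measurable_itv.
have f (x y : R) : (@lebesgue_measure R) `[x, y] \is a fin_num.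
  by rewrite ge0_fin_numE//; exact: lebesgue_itv_lty.
have : @leb2 R (`[a, b]%classic `*` `[a, b]%classic) \is a fin_num.
  by rewrite /leb2 product_measure1E; try exact: mI; apply: fin_numM; exact: f.
by rewrite ge0_fin_numE// /leb2.
Qed.

Lemma leb2_sigma_finite (R : realType) : sigma_finite setT (@leb2 R).
Proof.
exists (fun n : nat => `[- n%:R, n%:R]%classic `*` `[- n%:R, n%:R]%classic).
  apply/esym; rewrite -subTset => -[x y] _; exists (Num.bound (Num.max `|x| `|y|)) => //=.
  have := mathcomp.classical.unstable.ltr_bound (Num.max `|x| `|y|).
  rewrite gt_max => /andP[/ltW + /ltW].
  by rewrite !ler_norml !in_itv/=.
move=> n; split; last exact: leb2_square_lty.
by apply: measurableX; exact: measurable_itv.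
Qed.

HB.instance Definition _ (R : realType) := Measure.on (@leb2 R).
HB.instance Definition _ (R : realType) :=
  Measure_isSigmaFinite.Build _ _ _ (@leb2 R) (@leb2_sigma_finite R).

Section divergence_formula.
Variable R : realType.
Local Notation H := (R * R * R)%type.
Local Notation leb := (@lebesgue_measure R).
Local Notation leb2 := (@leb2 R).
Local Notation leb3 := (@leb3 R).
Let O3 : H := ((0, 0), 0).
Variables (T : R -> H -> H) (v Vv : H -> R) (E : set H) (N M L : R).
Hypotheses (adT : admissible_flow T) (mE : measurable E).
Hypotheses (cv : continuous v) (cVv : continuous Vv).
Hypothesis dv : forall p (h : R), is_derive h 1 (fun z => v (T z p)) (Vv (T h p)).
Hypotheses (vM : forall p, `|v p| <= M) (VvM : forall p, `|Vv p| <= M).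
Hypothesis vN : forall p, v p != 0 -> box O3 N p.
Variables (u be : R * R -> R) (D2 : set (R * R)) (c h0 b0 : R).
Hypotheses (L0 : 0 <= L) (c0 : 0 <= c) (h0_gt0 : 0 < h0).
Hypotheses (mD2 : measurable D2) (D2fin : (leb2 D2 < +oo)%E).
Hypothesis vL : forall q s s', `|v (Phi (s, q)) - v (Phi (s', q))| <= L * `|s - s'|.
Hypothesis vD2 : forall q s, v (Phi (s, q)) != 0 -> D2 q.
Hypothesis bb0 : forall q, D2 q -> `|be q| <= b0.
Hypothesis mm : measurable_fun setT (fun q => be q * v (Phi (u q, q))).
Hypothesis Eu : forall q s, v (Phi (s, q)) != 0 -> (E (Phi (s, q)) <-> u q < s).
Hypothesis hE1 : forall h q s, 0 < h <= h0 -> v (Phi (s, q)) != 0 ->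
  u q - be q * h + c * h ^+ 2 < s -> E (T (- h) (Phi (s, q))).
Hypothesis hE2 : forall h q s, 0 < h <= h0 -> v (Phi (s, q)) != 0 ->
  s < u q - be q * h - c * h ^+ 2 -> ~ E (T (- h) (Phi (s, q))).

Let mv : measurable_fun setT v. Proof. exact: continuous_measurable_fun_R3. Qed.
Let mTE h : measurable (T h @^-1` E).
Proof. by rewrite -[_ @^-1` _]setTI; have [mT _] := flow_mp adT h; exact: mT. Qed.
Let m q := be q * v (Phi (u q, q)).
Let M0 : 0 <= M. Proof. exact: le_trans (vM O3). Qed.

Let m_eq0 q : ~ D2 q -> m q = 0.
Proof.
move=> nD; rewrite /m (_ : v _ = 0) ?mulr0//.
by apply/eqP/negPn/negP => /vD2.
Qed.

Lemma fiber_integrable : leb2.-integrable setT (EFin \o m).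
Proof.
apply: (@fs_integrable _ _ _ leb2 m D2 (`|b0| * M) mm mD2 D2fin _ m_eq0).
move=> q; have [Dq|nD] := pselect (D2 q).
  by rewrite /m normrM ler_pM// (le_trans (bb0 Dq))// ler_norm.
by rewrite m_eq0// normr0 mulr_ge0.
Qed.

Let G (h : R) (p : H) := v p * (\1_(T (- h) @^-1` E) p - \1_E p).

Let mG h : measurable_fun setT (G h).
Proof.
apply: measurable_funM mv _; apply: measurable_funB; apply: measurable_indic => //; exact: mTE.
Qed.

Let indB (A B : set H) p : `|(\1_A p - \1_B p : R)| <= 1.
Proof.
by rewrite !indicE; case: (_ \in _); case: (_ \in _);
  rewrite ?subrr ?subr0 ?sub0r ?normrN ?normr0 ?normr1.
Qed.

Let GM h p : `|G h p| <= M.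
Proof. by rewrite /G normrM -[leRHS]mulr1 ler_pM. Qed.

Let GN h p : ~ box O3 N p -> G h p = 0.
Proof. by move=> nB; rewrite /G (_ : v p = 0) ?mul0r//; apply/eqP/negPn/negP => /vN. Qed.

Let IG h : leb3.-integrable setT (EFin \o G h).
Proof.
exact: (@fs_integrable _ _ _ leb3 _ (box O3 N) M (mG h) (measurable_box O3 N)
  (leb3_box_lty O3 N) (GM h) (@GN h)).
Qed.

Let IvA (A : set H) : measurable A -> leb3.-integrable setT (EFin \o (fun p => \1_A p * v p)).
Proof.
move=> mA; have mAv : measurable_fun setT (fun p => \1_A p * v p).
  have mI : measurable_fun setT (\1_A : H -> R) by exact: measurable_indic.
  exact: (measurable_funM mI mv).
apply: (@fs_integrable _ _ _ leb3 (fun p => \1_A p * v p) (box O3 N) M mAv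
  (measurable_box O3 N) (leb3_box_lty O3 N)).
- move=> p; rewrite normrM (le_trans _ (vM p))// ler_piMl// indicE.
  by case: (_ \in _); rewrite ?normr1 ?normr0.
- by move=> p nB; rewrite (_ : v p = 0) ?mulr0//; apply/eqP/negPn/negP => /vN.
Qed.

Let J_diff h : (\int[leb3]_p (\1_E p * v (T h p)))%R - (\int[leb3]_p (\1_E p * v p))%R
  = (\int[leb3]_p G h p)%R.
Proof.
have -> : (\int[leb3]_p (\1_E p * v (T h p)))%R =
    (\int[leb3]_p (\1_(T (- h) @^-1` E) p * v p))%R.
  rewrite /Rintegral; congr fine.
  have mEv : measurable_fun setT (fun p => (\1_E p * v (T h p))%:E).
    apply/measurable_EFinP.
    have mvT : measurable_fun setT (fun p => v (T h p)).
      by apply: measurableT_comp => //; have [] := flow_mp adT h.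
    have mI : measurable_fun setT (\1_E : H -> R) by exact: measurable_indic.
    exact: (measurable_funM mI mvT).
  rewrite (measure_preserving_integral (flow_mp adT (- h)) mEv).
  by apply: eq_integral => p _; rewrite (flowK adT).
rewrite -(RintegralB measurableT (IvA (mTE _)) (IvA mE)).
by apply: eq_Rintegral => p _; rewrite /G mulrBr !(mulrC (v p)).
Qed.

Let F h q := (\int[leb]_s G h (Phi (s, q)))%R.

Let IGs h q : leb.-integrable setT (EFin \o (fun s => G h (Phi (s, q)))).
Proof.
have mPhi : measurable_fun setT (@Phi R) by have [] := @Phi_measure_preserving R.
apply: (@fs_integrable _ _ _ leb _ `[- N, N]%classic M) => //.
- have : measurable_fun setT (G h \o @Phi R) by apply: measurableT_comp.
  by move=> K; exact: (measurable_fun_pair1 q K).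
- exact: lebesgue_itv_lty.
- move=> s /= sN; apply: GN => -[/= + _ _]; rewrite subr0 ler_norml => sN'.
  by apply: sN; rewrite in_itv.
Qed.

Let F_eq0 h q : ~ D2 q -> F h q = 0.
Proof.
move=> nD; rewrite /F (_ : (fun s => _) = fun=> 0); first by rewrite Rintegral_cst// mul0r.
apply/funext => s; rewrite /G (_ : v _ = 0) ?mul0r//.
by apply/eqP/negPn/negP => /vD2.
Qed.

Let G_fubini h : leb2.-integrable setT (EFin \o F h) /\
  (\int[leb3]_p G h p)%R = (\int[leb2]_q F h q)%R.
Proof.
have PhiP := @Phi_measure_preserving R.
have IP := @measure_preserving_integrable _ _ _ _ R (leb \x leb2)%E leb3 _ PhiP _ (IG h).
have FE : fubini_G leb ((EFin \o G h) \o @Phi R) = EFin \o F h.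
  apply/funext => q; rewrite /fubini_G /F /Rintegral /= fineK//.
  exact: integrable_fin_num (IGs h q).
split.
  have mF : measurable_fun setT (F h).
    have K : measurable_fun setT (fubini_G leb ((EFin \o G h) \o @Phi R)).
      exact: measurable_fubini_G IP.
    by move: K; rewrite FE => /measurable_EFinP.
  apply: (@fs_integrable _ _ _ leb2 (F h) D2 (\int[leb]_s (M * \1_(`[- N, N]%classic) s))%R
    mF mD2 D2fin _ (@F_eq0 h)) => q.
  have K := @fs_cst_integrable _ _ _ leb `[- N, N]%classic M (measurable_itv _) (lebesgue_itv_lty _ _ _ _).
  apply: (fs_Rintegral_le (IGs h q) K) => s; rewrite indicE; case: (boolP (_ \in _)) => [_|/negP sN].
    by rewrite mulr1; exact: GM.
  rewrite mulr0 GN ?normr0// => -[/= + _ _]; rewrite subr0 ler_norml => sN'.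
  by apply: sN; rewrite mem_setE in_itv.
rewrite /Rintegral; congr fine.
have mGE : measurable_fun setT (fun p => (G h p)%:E) by exact/measurable_EFinP.
rewrite (@measure_preserving_integral _ _ _ _ R (leb \x leb2)%E leb3 _ PhiP _ mGE).
transitivity (\int[leb2]_q (fubini_G leb ((EFin \o G h) \o @Phi R)) q)%E; last by rewrite FE.
by apply/esym; exact: (integral21_prod_meas1 IP).
Qed.

Let C := 2 * c * M + L * b0 ^+ 2.

Let F_estimate h q : 0 < h <= h0 -> `|F h q - h * m q| <= C * h ^+ 2 * \1_D2 q.
Proof.
move=> hh; have /andP[h_gt0 _] := hh.
rewrite indicE; have [/set_mem Dq|/negP nD] := boolP (q \in D2); last first.
  have nD' : ~ D2 q by move=> /mem_set.
  by rewrite m_eq0// mulr0 mulr0 subr0 F_eq0// normr0.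
rewrite mulr1 /F.
have mPhi : measurable_fun setT (@Phi R) by have [] := @Phi_measure_preserving R.
have mPq : measurable_fun setT (fun s => Phi (s, q)) by exact: (measurable_fun_pair1 q mPhi).
have mf : measurable_fun setT (fun s => v (Phi (s, q))) by exact: (measurableT_comp mv mPq).
pose A : set R := (fun s => Phi (s, q)) @^-1` (T (- h) @^-1` E).
have mA : measurable A.
  by rewrite /A -[_ @^-1` _]setTI; apply: mPq => //; exact: mTE.
rewrite (_ : (\int[leb]_s G h (Phi (s, q)))%R =
  (\int[leb]_s (v (Phi (s, q)) * (\1_A s - \1_(`]u q, +oo[%classic) s)))%R); last first.
  apply: eq_Rintegral => s _; rewrite /G.
  have [->|vs] := eqVneq (v (Phi (s, q))) 0; first by rewrite !mul0r.
  congr (_ * (_ - _)); rewrite indicE [RHS]indicE; congr ((nat_of_bool _)%:R).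
  have [e1 e2] := Eu vs; case: (ltP (u q) s) => us.
    by rewrite (mem_set (e2 us)); apply/esym/mem_set; rewrite /= in_itv/= us.
  rewrite memNset; last by move=> /e1; rewrite ltNge us.
  by apply/esym/memNset => /=; rewrite in_itv/= andbT ltNge us.
apply: (@fiber_estimate R (fun s => v (Phi (s, q))) A M L N (u q) (be q) h c b0) => //.
- move=> s sN; apply/eqP/negPn/negP => /vN[/= + _ _]; rewrite subr0.
  by rewrite leNgt sN.
- exact: ltW.
- exact: bb0.
- by move=> s vs; exact: hE1.
- by move=> s vs; exact: hE2.
Qed.

(** [T h] preserves volume, so moving the argument of [v] amounts to moving [E]: the difference of
    integrals becomes that of [v] over [T h E] minus that over [E]. In the coordinates [Phi], and
    where [v] does not vanish, both sets are half lines on each fibre, ending at [u q] and, up to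
    [c * h ^+ 2], at [u q - be q * h]. By [fiber_estimate] and Fubini the difference is [h] times
    the integral of [m] up to order [h ^+ 2]; division by [h] identifies the limit in
    [flow_derivative]. *)
Lemma divergence_formula : (\int[leb3]_(p in E) (Vv p)%:E)%E = (\int[leb2]_q m q)%R%:E.
Proof.
have D := flow_derivative adT mE cv cVv dv vM VvM vN.
have C0 : 0 <= C.
  by apply: addr_ge0; [rewrite !mulr_ge0|rewrite mulr_ge0 ?sqr_ge0].
have est h : 0 < h <= h0 ->
    `|(\int[leb3]_p G h p)%R - h * (\int[leb2]_q m q)%R| <= C * h ^+ 2 * fine (leb2 D2).
  move=> hh; have [IF ->] := G_fubini h.
  have Im := fiber_integrable.
  have Ihm : leb2.-integrable setT (EFin \o (fun q => h * m q)) by exact: (integrableZl measurableT h Im).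
  rewrite -(@RintegralZl _ _ _ leb2 setT m h measurableT Im).
  rewrite -(@RintegralB _ _ _ leb2 setT (F h) (fun q => h * m q) measurableT IF Ihm).
  have Id := @fs_indic_integrable _ _ _ leb2 D2 mD2 D2fin.
  rewrite -(fs_indic_Rintegral leb2 mD2) -(@RintegralZl _ _ _ leb2 setT \1_D2 (C * h ^+ 2) measurableT Id).
  apply: fs_Rintegral_le; first exact: (integrableB measurableT IF Ihm).
    exact: (@fs_cst_integrable _ _ _ leb2 D2 (C * h ^+ 2) mD2 D2fin).
  by move=> q; exact: F_estimate.
have lim2 : (fun n : nat => n.+1%:R * ((\int[leb3]_p (\1_E p * v (T n.+1%:R^-1 p)))%R -
     (\int[leb3]_p (\1_E p * v p))%R)) @ \oo --> (\int[leb2]_q m q)%R.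
  apply/cvgrPdist_le => e e0.
  have f0 : 0 <= fine (leb2 D2) by rewrite fine_ge0.
  have K0 : 0 < C * fine (leb2 D2) + 1 by rewrite ltr_wpDl// mulr_ge0.
  have eK0 : 0 < e / (C * fine (leb2 D2) + 1) by exact: divr_gt0.
  near=> n.
  have n0 : 0 < n.+1%:R^-1 :> R by rewrite invr_gt0.
  have nh : 0 < (n.+1%:R^-1 : R) <= h0.
    rewrite n0/= ltW//; near: n; exact: (near_infty_natSinv_lt (PosNum h0_gt0)).
  have := est _ nh; rewrite -J_diff => H.
  rewrite distrC (_ : _ - _ = n.+1%:R * ((\int[leb3]_p (\1_E p * v (T n.+1%:R^-1 p)))%R -
     (\int[leb3]_p (\1_E p * v p))%R - n.+1%:R^-1 * (\int[leb2]_q m q)%R)); last first.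
    by rewrite [RHS]mulrBr mulrA divff ?mul1r.
  rewrite normrM ger0_norm// -ler_pdivlMl// (le_trans H)//.
  have hK : n.+1%:R^-1 * (C * fine (leb2 D2) + 1) <= e.
    rewrite -ler_pdivlMr// ltW//; near: n; exact: (near_infty_natSinv_lt (PosNum eK0)).
  have hK' : n.+1%:R^-1 * (C * fine (leb2 D2)) <= e by rewrite (le_trans _ hK)// ler_pM2l// lerDl.
  rewrite (_ : C * _ * _ = n.+1%:R^-1 * (n.+1%:R^-1 * (C * fine (leb2 D2)))); last by ring.
  by rewrite ler_pM2l.
have EI : (\int[leb3]_(p in E) (Vv p)%:E)%E = (\int[leb3]_p (\1_E p * Vv p)%:E)%E.
  rewrite integral_mkcond; apply: eq_integral => p _.
  by rewrite patchE indicE; case: ifPn => pE; rewrite ?mul1r ?mul0r.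
rewrite EI -[LHS]fineK; last first.
  have K := flow_integrable adT mE cVv dv VvM vN.
  exact: (@integrable_fin_num _ _ _ leb3 setT measurableT _ K).
by congr (_%:E); exact: cvg_unique D lim2.
Unshelve. all: by end_near. Qed.

End divergence_formula.

(** * Divergence formulas for compactly supported C^1 fields *)

Section compactly_supported_fields.
Variable R : realType.
Local Notation H := (R * R * R)%type.
Local Notation leb2 := (@leb2 R).
Local Notation leb3 := (@leb3 R).
Let O3 : H := ((0, 0), 0).
Implicit Types (v : H -> R) (O : set H).

Lemma continuous_compact_norm_bound (T : topologicalType) (f : T -> R) (K : set T) :
  compact K -> continuous f -> exists M : R, 0 < M /\ forall p, K p -> `|f p| <= M.
Proof.
move=> cK cf; have /compact_bounded[M [_ hM]] : compact (f @` K).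
  by apply: continuous_compact => //; exact: continuous_subspaceT.
have M1 : M < `|M| + 1 by have := ler_norm M; lra.
exists (`|M| + 1); split; first by have := normr_ge0 M; lra.
by move=> p Kp; apply: (hM _ M1); exists p.
Qed.

Lemma C1_Xf_continuous v : C1 v -> continuous (Xf v).
Proof.
move=> [_ [cx [_ ct]]] p; rewrite /Xf; apply: cvgD; first exact: cx.
apply: cvgM; last exact: ct.
by apply: cvgM; [exact: cvg_cst|exact: continuous_y3].
Qed.

Lemma C1_Yf_continuous v : C1 v -> continuous (Yf v).
Proof.
move=> [_ [_ [cy ct]]] p; rewrite /Yf; apply: cvgB; first exact: cy.
apply: cvgM; last exact: ct.
by apply: cvgM; [exact: cvg_cst|exact: continuous_x3].
Qed.

Lemma near_cst_grad v p (k : R) : (\forall p' \near p, v p' = k) ->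
  [/\ dx v p = 0, dy v p = 0 & dt v p = 0].
Proof.
move=> vk; apply: has_grad_dE; apply: (@has_grad_near_eq _ (fun=> k)).
  by apply: filterS vk => q ->.
by split; exact: is_derive_cst.
Qed.

Lemma notin_support_near v p : ~ closure [set p | v p != 0] p -> \forall p' \near p, v p' = 0.
Proof.
move=> nc; have o : open (~` closure [set p | v p != 0]).
  by rewrite openC; exact: closed_closure.
near=> q; have : (~` closure [set p | v p != 0]) q.
  by near: q; apply: open_nbhs_nbhs; split.
by move=> nq; apply/eqP/negPn/negP => vq; apply: nq; exact: subset_closure.
Unshelve. all: by end_near. Qed.

Lemma C1c_bounds O v : C1c O v -> exists M N : R, [/\ 0 < M, 0 < N,
  forall p, [/\ `|v p| <= M, `|Xf v p| <= M & `|Yf v p| <= M] &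
  forall p, closure [set p | v p != 0] p -> box O3 N p].
Proof.
move=> [v1 [cK _]]; set K := closure _ in cK *.
have [M1 [M10 h1]] := continuous_compact_norm_bound cK (C1_continuous v1).
have [M2 [M20 h2]] := continuous_compact_norm_bound cK (C1_Xf_continuous v1).
have [M3 [M30 h3]] := continuous_compact_norm_bound cK (C1_Yf_continuous v1).
have [Nx [Nx0 hx]] := continuous_compact_norm_bound cK (@continuous_x3 R).
have [Ny [Ny0 hy]] := continuous_compact_norm_bound cK (@continuous_y3 R).
have [Nt [Nt0 ht]] := continuous_compact_norm_bound cK (@continuous_t3 R).
exists (M1 + M2 + M3), (Nx + Ny + Nt); split; [lra|lra| |].
- move=> p; have [Kp|nKp] := pselect (K p).
    by have := h1 _ Kp; have := h2 _ Kp; have := h3 _ Kp; split; lra.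
  have vN := notin_support_near nKp; have [X Y T] := near_cst_grad vN.
  rewrite /Xf /Yf X Y T (nbhs_singleton vN) !mulr0 addr0 subr0 normr0.
  by split; lra.
- move=> p Kp; rewrite /box/= !subr0.
  by have := hx _ Kp; have := hy _ Kp; have := ht _ Kp; split; lra.
Qed.

Lemma Phi_flowX (s s' : R) q : Phi (s, q) = flowX (s - s') (Phi (s', q)).
Proof. by case: q => y t; rewrite /Phi /flowX/=; congr ((_, _), _); ring. Qed.

(** A fibre of [Phi] is an orbit of [flowX], so [Xf v] is the derivative of [v] along it. *)
Lemma C1_vertical_lipschitz v (M : R) : C1 v -> (forall p, `|Xf v p| <= M) ->
  forall q (s s' : R), `|v (Phi (s, q)) - v (Phi (s', q))| <= M * `|s - s'|.
Proof.
move=> v1 vM q s s'.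
have := @mvt_bound R (fun z => v (flowX z (Phi (s', q)))) (fun z => Xf v (flowX z (Phi (s', q))))
   0 (s - s') 0 M.
rewrite mul0r !subr0 -Phi_flowX.
have -> : flowX 0 (Phi (s', q)) = Phi (s', q).
  by rewrite -{1}(subrr s') -Phi_flowX.
apply; first by move=> z _; exact: C1_flowX.
by move=> z _; rewrite subr0.
Qed.

Section divergence_C1c.
Variables (O : set H) (v : H -> R) (E : set H) (u be : R * R -> R) (c h0 b0 : R).
Hypotheses (vO : C1c O v) (mE : measurable E) (c0 : 0 <= c) (h0_gt0 : 0 < h0).
Hypothesis bb0 : forall q, `|be q| <= b0.
Hypothesis mm : measurable_fun setT (fun q => be q * v (Phi (u q, q))).
Hypothesis Eu : forall q s, v (Phi (s, q)) != 0 -> (E (Phi (s, q)) <-> u q < s).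

Let flow_hyp (T : R -> H -> H) :=
  (forall (h : R) q s, 0 < h <= h0 -> v (Phi (s, q)) != 0 ->
     u q - be q * h + c * h ^+ 2 < s -> E (T (- h) (Phi (s, q)))) /\
  (forall (h : R) q s, 0 < h <= h0 -> v (Phi (s, q)) != 0 ->
     s < u q - be q * h - c * h ^+ 2 -> ~ E (T (- h) (Phi (s, q)))).

Let general (T : R -> H -> H) (Vv : H -> R) : admissible_flow T -> continuous Vv ->
  (forall p (h : R), is_derive h 1 (fun z => v (T z p)) (Vv (T h p))) ->
  (exists M : R, forall p, `|Vv p| <= M) -> flow_hyp T ->
  (\int[leb3]_(p in E) (Vv p)%:E)%E = (\int[leb2]_q (be q * v (Phi (u q, q))))%R%:E.
Proof.
move=> adT cVv dv [M' hM'] [h1 h2].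
have [M [N [M0 N0 hM hN]]] := C1c_bounds vO; have [v1 _] := vO.
(* In the box of radius [N] the left coordinate [t - 2 * y * x] has absolute value at most
   [N + 2 * N * N]. *)
pose A := N + 2 * N * N.
have vb q s : v (Phi (s, q)) != 0 -> box O3 N (Phi (s, q)).
  by move=> vq; apply: hN; apply: subset_closure.
have vA q s : v (Phi (s, q)) != 0 -> (`[- A, A]%classic `*` `[- A, A]%classic) q.
  move=> /vb; rewrite /Phi/box/= !subr0; case: q => y t/=; rewrite !ler_norml !in_itv/=.
  by move=> [/andP[a1 a2] /andP[b1 b2] /andP[d1 d2]]; split; apply/andP; split; rewrite /A; nra.
have mA : measurable (`[- A, A]%classic `*` `[- A, A]%classic).
  by apply: measurableX; exact: measurable_itv.
have vM p : `|v p| <= Num.max M M' by rewrite le_max; have [-> _ _] := hM p.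
have VvM p : `|Vv p| <= Num.max M M' by rewrite le_max hM' orbT.
have vL q s s' : `|v (Phi (s, q)) - v (Phi (s', q))| <= M * `|s - s'|.
  by apply: C1_vertical_lipschitz => // p; have [] := hM p.
have vN p : v p != 0 -> box O3 N p by move=> vp; apply: hN; exact: subset_closure.
exact: (divergence_formula adT mE (C1_continuous v1) cVv dv vM VvM vN (ltW M0) c0 h0_gt0 mA
  (leb2_square_lty _ _) vL vA (fun q _ => bb0 q) mm Eu h1 h2).
Qed.

Lemma divergence_X : flow_hyp (@flowX R) ->
  (\int[leb3]_(p in E) (Xf v p)%:E)%E = (\int[leb2]_q (be q * v (Phi (u q, q))))%R%:E.
Proof.
have [v1 _] := vO; apply: general; first exact: flowX_admissible.
- exact: C1_Xf_continuous.
- by move=> p h; exact: C1_flowX.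
- by have [M [_ [_ _ hM _]]] := C1c_bounds vO; exists M => p; have [] := hM p.
Qed.

Lemma divergence_Y : flow_hyp (@flowY R) ->
  (\int[leb3]_(p in E) (Yf v p)%:E)%E = (\int[leb2]_q (be q * v (Phi (u q, q))))%R%:E.
Proof.
have [v1 _] := vO; apply: general; first exact: flowY_admissible.
- exact: C1_Yf_continuous.
- by move=> p h; exact: C1_flowY.
- by have [M [_ [_ _ hM _]]] := C1c_bounds vO; exists M => p; have [] := hM p.
Qed.

End divergence_C1c.

(** Seen from the support of [v], the whole space is the region above the constant graph at height
    [- N - 1], which lies below the support. The flows preserve the whole space, so this graph has
    speed [be = 0] and no flux. *)
Lemma C1c_integral0 O v : C1c O v ->
  (\int[leb3]_p (Xf v p)%:E)%E = 0%E /\ (\int[leb3]_p (Yf v p)%:E)%E = 0%E.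
Proof.
move=> vO; have [M [N [_ _ _ hN]]] := C1c_bounds vO.
have vN q (s : R) : v (Phi (s, q)) != 0 -> - N <= s.
  by move=> vq; have [] := hN _ (@subset_closure _ [set p | v p != 0] _ vq); rewrite /= subr0 ler_norml => /andP[].
have mm : measurable_fun setT (fun q : R * R => 0 * v (Phi (- N - 1, q))).
  by under eq_fun do rewrite mul0r; exact: measurable_cst.
have Eu q (s : R) : v (Phi (s, q)) != 0 -> (setT (Phi (s, q)) <-> - N - 1 < s).
  by move=> /vN sN; split => // _; lra.
have F2 T (h : R) q (s : R) : 0 < h <= 1 -> v (Phi (s, q)) != 0 ->
   s < - N - 1 - 0 * h - 0 * h ^+ 2 -> ~ setT (T (- h) (Phi (s, q)) : H).
  by move=> _ /vN sN; rewrite !mul0r !subr0 => ?; lra.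
have b0 (q : R * R) : `|(0 : R)| <= 0 by rewrite normr0.
have E0 : (\int[leb2]_q ((fun=> 0 : R) q * v (Phi ((fun=> - N - 1) q, q))))%R%:E = 0%E.
  rewrite /Rintegral (eq_integral (fun=> 0%E)) ?integral0// => q _.
  by rewrite mul0r.
split.
- rewrite (@divergence_X O v setT (fun=> - N - 1) (fun=> 0) 0 1 0) => //.
  by split => // h q s; exact: (F2 (@flowX R)).
- rewrite (@divergence_Y O v setT (fun=> - N - 1) (fun=> 0) 0 1 0) => //.
  by split => // h q s; exact: (F2 (@flowY R)).
Qed.

End compactly_supported_fields.

(** * The foliation of the domain by projected segments *)

Section leaves.
Variable R : realType.
Variables (D : set (R * R)) (u U : R * R -> R) (k Mu : R).
Implicit Types q : R * R.

(** Left projection, at abscissa [y'], of the horizontal line through [Phi (x, q)] in the direction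
    [b X + Y]. *)
Definition parabola q (x b y' : R) : R * R :=
  (y', q.2 - 4 * x * (y' - q.1) - 2 * b * (y' - q.1) ^+ 2).

(* The left projection to [W] of the maximal horizontal segment of the graph of [u]
   through the point over [q]: a parabola along which [u] is affine with slope [b]. *)
Definition leaf q (b y1 y2 : R) := [/\ y1 < 0 < y2, y1 < q.1 < y2,
  forall y', y1 < y' < y2 -> D (parabola q (u q) b y') /\
    u (parabola q (u q) b y') = u q + b * (y' - q.1),
  ~ D (parabola q (u q) b y1) & ~ D (parabola q (u q) b y2)].

Lemma leaf_in q b y1 y2 : leaf q b y1 y2 -> D q.
Proof.
move=> [_ qy /(_ _ qy)[+ _] _ _].
by rewrite /parabola subrr mulr0 subr0 expr0n/= mulr0 subr0 -surjective_pairing.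
Qed.

(** As [u] is affine along the leaf, every point of it generates the same parabola. *)
Lemma leaf_move q b y1 y2 y' : leaf q b y1 y2 -> y1 < y' < y2 ->
  leaf (parabola q (u q) b y') b y1 y2.
Proof.
move=> [y0 qy H n1 n2] yy'; have [Dq' uq'] := H _ yy'.
have E z : parabola (parabola q (u q) b y') (u (parabola q (u q) b y')) b z = parabola q (u q) b z.
  by rewrite uq' /parabola/=; congr (_, _); ring.
split => //; rewrite ?E//.
move=> z /H[Dz uz]; rewrite E; split => //.
by rewrite uz uq'/=; ring.
Qed.

Hypothesis k0 : 0 < k.
Hypothesis UL : forall q q', `|U q - U q'| <= k * dist2 q q'.
Hypothesis Uu : forall q, D q -> U q = u q.
Hypothesis Dop : forall q, D q -> exists r : R, 0 < r /\ forall q', dist2 q q' < r -> D q'.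
Hypothesis uM : forall q, D q -> `|u q| <= Mu.
Hypothesis leafE : forall q, D q -> exists b y1 y2, leaf q b y1 y2.

Let uL q q' : D q -> D q' -> `|u q - u q'| <= k * dist2 q q'.
Proof. by move=> Dq Dq'; rewrite -!Uu. Qed.

Let Mu0 q : D q -> 0 <= Mu. Proof. by move=> /uM; exact: le_trans. Qed.

Let leaf_pt q b y1 y2 (d : R) : leaf q b y1 y2 -> y1 < q.1 + d < y2 ->
  D (q.1 + d, q.2 - 4 * u q * d - 2 * b * d ^+ 2) /\
  u (q.1 + d, q.2 - 4 * u q * d - 2 * b * d ^+ 2) = u q + b * d.
Proof.
move=> [_ _ H _ _] /H; rewrite /parabola (_ : q.1 + d - q.1 = d)//.
by ring.
Qed.

Let Kb := 2 * k * (1 + 4 * Mu).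

(** Along the leaf [u] changes by [|b| d], while the point moves by at most
    [d (1 + 4 Mu + 2 |b| d)]. In the Lipschitz inequality the choice [d <= 1 / (4 k)] lets half of
    [|b|] absorb the quadratic term, whence the factor 2 in [Kb]. *)
Lemma leaf_slope_bound q b y1 y2 : leaf q b y1 y2 -> `|b| <= Kb.
Proof.
move=> lf; have Dq := leaf_in lf; have [_ /andP[q1 q2] _ _ _] := lf.
pose d := Num.min ((4 * k)^-1) ((y2 - q.1) / 2).
have d0 : 0 < d by rewrite lt_min invr_gt0 mulr_gt0//= divr_gt0// subr_gt0.
have d1 : d <= (4 * k)^-1 by rewrite ge_min lexx.
have d1' : d * (4 * k) <= 1 by rewrite -ler_pdivlMr ?mulr_gt0// mul1r.
have d2 : d <= (y2 - q.1) / 2 by rewrite ge_min lexx orbT.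
have [Dp up] := leaf_pt (d := d) lf (ltac:(apply/andP; split; lra)).
have := uL Dp Dq; rewrite up addrC addKr normrM (gtr0_norm d0).
have cN : - b <= `|b| by rewrite -normrN ler_norm.
move: (`|b|) (normr_ge0 b) cN (ler_norm b); rewrite /dist2/= => c c0 cN cP H.
have h1 : `|q.1 + d - q.1| <= d * (1 + 4 * Mu + 2 * c * d).
  rewrite addrC addKr (gtr0_norm d0); have M0 := Mu0 Dq.
  have : 0 <= d * Mu by rewrite mulr_ge0// ltW.
  have : 0 <= d * (c * d) by rewrite !mulr_ge0// ltW.
  by move=> ? ?; lra.
have h2 : `|q.2 - 4 * u q * d - 2 * b * d ^+ 2 - q.2| <= d * (1 + 4 * Mu + 2 * c * d).
  have := uM Dq; rewrite !ler_norml !expr2 => /andP[m1 m2]; apply/andP; split; nra.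
have : c * d <= k * (d * (1 + 4 * Mu + 2 * c * d)).
  by apply: (le_trans H); rewrite ler_pM2l// ge_max h1 h2.
rewrite (_ : k * _ = k * (1 + 4 * Mu + 2 * c * d) * d); last by ring.
rewrite ler_pM2r// /Kb => H'; have : 4 * k * c * d <= c by nra.
nra.
Qed.

(** After a displacement [d] the two parabolas are [2 |b - b'| d^2] apart, while the values of [u]
    differ by [|b - b'| d]; for small [d] the Lipschitz bound forces equality. *)
Lemma leaf_uniq q b b' y1 y2 y1' y2' : leaf q b y1 y2 -> leaf q b' y1' y2' -> b = b'.
Proof.
move=> lf lf'; have Dq := leaf_in lf.
have [_ /andP[q1 q2] _ _ _] := lf; have [_ /andP[q1' q2'] _ _ _] := lf'.
pose d := Num.min ((4 * k)^-1) (Num.min ((y2 - q.1) / 2) ((y2' - q.1) / 2)).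
have d0 : 0 < d by rewrite !lt_min invr_gt0 mulr_gt0//= !divr_gt0// subr_gt0.
have d1 : d <= (4 * k)^-1 by rewrite ge_min lexx.
have d1' : d * (4 * k) <= 1 by rewrite -ler_pdivlMr ?mulr_gt0// mul1r.
have d2 : d <= (y2 - q.1) / 2 by rewrite !ge_min lexx !orbT.
have d3 : d <= (y2' - q.1) / 2 by rewrite !ge_min lexx !orbT.
have [Dp up] := leaf_pt (d := d) lf (ltac:(apply/andP; split; lra)).
have [Dp' up'] := leaf_pt (d := d) lf' (ltac:(apply/andP; split; lra)).
have := uL Dp Dp'; rewrite up up' /dist2/= subrr normr0.
rewrite (_ : _ - _ = (b - b') * d); last by ring.
rewrite [_ - 2 * b * _ - _](_ : _ = - (2 * d * ((b - b') * d))); last by ring.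
rewrite max_r// normrN [X in k * X]normrM (gtr0_norm (_ : 0 < 2 * d)) ?mulr_gt0//.
move=> H.
have : `|(b - b') * d| <= 0.
  by move: (`|_|) (normr_ge0 ((b - b') * d)) H => z z0 H; nra.
by rewrite normr_le0 mulf_eq0 (gt_eqF d0) orbF subr_eq0 => /eqP.
Qed.

(** The value 0 outside [D] lets flux integrals run over the whole plane. *)
Definition slope q : R := if pselect (D q) is left Dq then projT1 (cid (leafE Dq)) else 0.

Lemma slopeP q : D q -> exists y1 y2, leaf q (slope q) y1 y2.
Proof. by rewrite /slope => Dq; case: pselect => // Dq'; case: cid. Qed.

Lemma slope_out q : ~ D q -> slope q = 0.
Proof. by rewrite /slope; case: pselect. Qed.

Lemma leaf_slope q b y1 y2 : leaf q b y1 y2 -> slope q = b.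
Proof. by move=> lf; have [z1 [z2 lf']] := slopeP (leaf_in lf); exact: leaf_uniq lf' lf. Qed.

Lemma slope_bound q : `|slope q| <= `|Kb|.
Proof.
have [Dq|nD] := pselect (D q); last by rewrite slope_out// normr0.
by have [y1 [y2 /leaf_slope_bound/le_trans->//]] := slopeP Dq; exact: ler_norm.
Qed.

(** A displacement below this bound moves a point along its leaf by less than [r]; the cap at 1
    turns the quadratic term into a linear one. *)
Definition extent (r : R) := Num.min 1 (r / (1 + 4 * Mu + 2 * `|Kb|)).

Lemma extent_gt0 q (r : R) : D q -> 0 < r -> 0 < extent r.
Proof.
move=> /Mu0 M0 r0; have K0 := normr_ge0 Kb; rewrite /extent lt_min ltr01/= divr_gt0//.
by move: (`|Kb|) K0 => z z0; lra.
Qed.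

(** The ends of a leaf lie outside [D], hence not in the ball of radius [r] around [q]; so the leaf
    continues for at least [extent r] on either side. *)
Lemma slope_extent q (r d : R) : D q -> (forall q', dist2 q q' < r -> D q') -> 0 < r -> `|d| < extent r ->
  D (q.1 + d, q.2 - 4 * u q * d - 2 * slope q * d ^+ 2) /\
  u (q.1 + d, q.2 - 4 * u q * d - 2 * slope q * d ^+ 2) = u q + slope q * d /\
  slope (q.1 + d, q.2 - 4 * u q * d - 2 * slope q * d ^+ 2) = slope q.
Proof.
move=> Dq Dr r0 dr; have [y1 [y2 lf]] := slopeP Dq.
have K0 := normr_ge0 Kb.
pose A := 1 + 4 * Mu + 2 * `|Kb|.
have A1 : 1 <= A by rewrite /A; have := Mu0 Dq; move: (`|Kb|) K0 => z z0; lra.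
have far (y' : R) : `|y' - q.1| < extent r -> D (parabola q (u q) (slope q) y').
  rewrite /extent lt_min => /andP[e1]; rewrite -/A ltr_pdivlMr; last by lra.
  move=> e2; apply: Dr; rewrite /dist2/=.
  have := uM Dq; have := slope_bound q.
  move: (u q) (slope q) => x s; move: e1 e2; rewrite [`|q.1 - _|]distrC.
  have [c ->] : exists c, y' = q.1 + c by exists (y' - q.1); ring.
  rewrite (_ : q.1 + c - q.1 = c); last by ring.
  rewrite (_ : q.2 - _ = c * (4 * x) + c * (c * (2 * s))); last by ring.
  move=> c1 cA sK xM; rewrite gt_max; apply/andP; split.
    by apply: le_lt_trans cA; rewrite ler_peMr.
  apply: le_lt_trans cA; apply: (le_trans (ler_normD _ _)); rewrite !normrM !(ger0_norm (ler0n _ _)).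
  rewrite -mulrDr ler_wpM2l//; rewrite /A.
  move: (`|Kb|) K0 sK => z z0 sK; move: (`|c|) (normr_ge0 c) c1 => c' c0 c1.
  move: (`|s|) (normr_ge0 s) sK => s' s0 sK; nra.
have [_ /andP[q1 q2] H n1 n2] := lf.
have e1 : extent r <= q.1 - y1.
  rewrite leNgt; apply/negP => h; apply: n1; apply: far.
  by rewrite distrC gtr0_norm// subr_gt0.
have e2 : extent r <= y2 - q.1.
  rewrite leNgt; apply/negP => h; apply: n2; apply: far.
  by rewrite gtr0_norm// subr_gt0.
have dd : y1 < q.1 + d < y2 by move: dr; rewrite ltr_norml => /andP[d1 d2]; apply/andP; split; lra.
have [Dp up] := leaf_pt lf dd; split => //; split => //.
have := leaf_slope (leaf_move lf dd).
by rewrite /parabola (_ : q.1 + d - q.1 = d)//; ring.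
Qed.

(** Two leaves are compared after a common displacement [h]. With [d] the distance of [q] and [q'],
    the values of [u] differ by at least [|b - b'| h - k d] and the points by at most
    [2 d + 4 k d h + 2 |b - b'| h^2]; as [4 k h <= 1], the last term is absorbed. The radius [r]
    ensures that both leaves are long enough for a fixed [h]. *)
Lemma slope_lip (r : R) : 0 < r -> exists C : R, 0 <= C /\ forall q q', D q -> D q' ->
  (forall p, dist2 q p < r -> D p) -> (forall p, dist2 q' p < r -> D p) ->
  `|slope q - slope q'| <= C * dist2 q q'.
Proof.
move=> r0; pose h := Num.min ((4 * k)^-1) (extent r / 2).
exists (2 * (3 * k + 4 * k * k * `|h|) / `|h|); split.
  by rewrite divr_ge0// mulr_ge0// addr_ge0// ?mulr_ge0// ltW.
move=> q q' Dq Dq' qr qr'.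
have e0 := extent_gt0 Dq r0.
have h0 : 0 < h by rewrite lt_min invr_gt0 mulr_gt0//= divr_gt0.
have h1 : h * (4 * k) <= 1 by rewrite -ler_pdivlMr ?mulr_gt0// mul1r ge_min lexx.
have h2 : h < extent r.
  by apply: (@le_lt_trans _ _ (extent r / 2)); [rewrite ge_min lexx orbT|lra].
have hr : `|h| < extent r by rewrite gtr0_norm.
rewrite (gtr0_norm h0) in hr *.
have [Dp [up _]] := slope_extent Dq qr r0 (ltac:(by rewrite gtr0_norm)) (d := h).
have [Dp' [up' _]] := slope_extent Dq' qr' r0 (ltac:(by rewrite gtr0_norm)) (d := h).
have := uL Dp Dp'; rewrite up up'.
have := uL Dq Dq'.
have := dist2_ge0 q q'.
have : `|q.1 - q'.1| <= dist2 q q' by rewrite le_max lexx.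
have : `|q.2 - q'.2| <= dist2 q q' by rewrite le_max lexx orbT.
move: (dist2 q q') => d e2 e1 d0 ex; rewrite /dist2/= => H.
pose b := `|slope q - slope q'|; rewrite -/b.
have b0 : 0 <= b by exact: normr_ge0.
rewrite mulrAC ler_pdivlMr//.
have L1 : b * h - k * d <= `|u q + slope q * h - (u q' + slope q' * h)|.
  rewrite (_ : _ - (_ + _) = (slope q - slope q') * h + (u q - u q')); last by ring.
  have := lerB_normD ((slope q - slope q') * h) (u q - u q').
  by rewrite normrM (gtr0_norm h0) -/b; lra.
have L2 : Num.max `|q.1 + h - (q'.1 + h)|
   `|q.2 - 4 * u q * h - 2 * slope q * h ^+ 2 - (q'.2 - 4 * u q' * h - 2 * slope q' * h ^+ 2)|
   <= 2 * d + 4 * k * d * h + 2 * b * h * h.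
  have p1 : 0 <= k * d * h by rewrite !mulr_ge0// ltW.
  have p2 : 0 <= b * h * h by rewrite !mulr_ge0// ltW.
  rewrite ge_max; apply/andP; split.
    rewrite (_ : _ - _ = q.1 - q'.1); last by ring.
    by lra.
  rewrite (_ : _ - (_ - _ - _) = (q.2 - q'.2) - 4 * h * (u q - u q')
    - 2 * h * h * (slope q - slope q')); last by ring.
  apply: (le_trans (ler_normB _ _)); rewrite (le_trans (lerD (ler_normB _ _) (lexx _)))//.
  rewrite !normrM -/b !(ger0_norm (ler0n _ _)) !(gtr0_norm h0).
  by have := ler_wpM2l (ltW h0) ex; lra.
have := le_trans L1 (le_trans H (ler_wpM2l (ltW k0) L2)).
have bh : 0 <= b * h by rewrite mulr_ge0// ltW.
have : (h * (4 * k)) * (b * h) <= 1 * (b * h) by rewrite ler_wpM2r.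
by move=> ? ?; lra.
Qed.

End leaves.

(** What the later arguments use of the leaves. [U] is a global Lipschitz extension of [u] and [b]
    the slope. [fol_extent] and [fol_blip] are uniform over the points whose ball of radius [r]
    stays in [D]; no uniformity up to the boundary is claimed. *)
Record foliation (R : realType) (D : set (R * R)) (u U b : R * R -> R) (k Mu b0 : R) : Prop := {
  fol_k : 0 < k;
  fol_lip : forall q q', `|U q - U q'| <= k * dist2 q q';
  fol_ext : forall q, D q -> U q = u q;
  fol_open : forall q, D q -> exists r : R, 0 < r /\ forall q', dist2 q q' < r -> D q';
  fol_u : forall q, D q -> `|u q| <= Mu;
  fol_b : forall q, `|b q| <= b0;
  fol_out : forall q, ~ D q -> b q = 0;
  fol_leaf : forall q, D q -> exists y1 y2, leaf D u q (b q) y1 y2;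
  fol_slope : forall q b' y1 y2, leaf D u q b' y1 y2 -> b q = b';
  fol_extent : forall r : R, 0 < r -> exists e : R, 0 < e /\ forall q d, D q ->
    (forall q', dist2 q q' < r -> D q') -> `|d| < e ->
    D (q.1 + d, q.2 - 4 * u q * d - 2 * b q * d ^+ 2) /\
    u (q.1 + d, q.2 - 4 * u q * d - 2 * b q * d ^+ 2) = u q + b q * d;
  fol_blip : forall r : R, 0 < r -> exists C : R, 0 <= C /\ forall q q', D q -> D q' ->
    (forall p, dist2 q p < r -> D p) -> (forall p, dist2 q' p < r -> D p) ->
    `|b q - b q'| <= C * dist2 q q' }.

Lemma foliation_exists (R : realType) (D : set (R * R)) (u U : R * R -> R) (k Mu : R) :
  0 < k -> (forall q q', `|U q - U q'| <= k * dist2 q q') ->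
  (forall q, D q -> U q = u q) ->
  (forall q, D q -> exists r : R, 0 < r /\ forall q', dist2 q q' < r -> D q') ->
  (forall q, D q -> `|u q| <= Mu) ->
  (forall q, D q -> exists b y1 y2, leaf D u q b y1 y2) ->
  exists (b : R * R -> R) (b0 : R), foliation D u U b k Mu b0.
Proof.
move=> k0 UL Uu Dop uM leafE; exists (slope leafE), `|2 * k * (1 + 4 * Mu)|; split => //.
- exact: slope_bound k0 UL Uu uM leafE.
- exact: slope_out.
- exact: slopeP.
- exact: leaf_slope k0 UL Uu leafE.
- move=> r r0; have [[q0 Dq0]|nD] := pselect (exists q, D q); last first.
    by exists 1; split => // q d Dq; exfalso; apply: nD; exists q.
  exists (extent k Mu r); split; first exact: (extent_gt0 k uM Dq0 r0).
  by move=> q d Dq qr dr; have [h1 [h2 _]] := slope_extent k0 UL Uu uM leafE Dq qr r0 dr.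
- exact: (slope_lip k0 UL Uu uM leafE).
Qed.

Section foliated_domain.
Variable R : realType.
Variables (D : set (R * R)) (u U b : R * R -> R) (k Mu b0 : R).
Hypothesis fol : foliation D u U b k Mu b0.
Implicit Types q : R * R.

Let k0 := fol_k fol.
Let uL q q' : D q -> D q' -> `|u q - u q'| <= k * dist2 q q'.
Proof. by move=> Dq Dq'; rewrite -!(fol_ext fol)//; exact: (fol_lip fol). Qed.

Lemma fol_near q : D q -> exists r C e : R, [/\ 0 < r, 0 <= C, 0 < e,
  forall q', dist2 q q' < r -> D q' /\ `|b q - b q'| <= C * dist2 q q' &
  forall q' (d : R), dist2 q q' < r -> `|d| < e ->
    D (q'.1 + d, q'.2 - 4 * u q' * d - 2 * b q' * d ^+ 2) /\
    u (q'.1 + d, q'.2 - 4 * u q' * d - 2 * b q' * d ^+ 2) = u q' + b q' * d].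
Proof.
move=> Dq; have [r [r0 hr]] := fol_open fol Dq.
have r2 : 0 < r / 2 by rewrite divr_gt0.
have nr q' : dist2 q q' < r / 2 -> D q' /\ forall p, dist2 q' p < r / 2 -> D p.
  move=> qq'; split; first by apply: hr; apply: lt_trans qq' _; lra.
  by move=> p q'p; apply: hr; have := dist2_triangle q q' p; lra.
have [C [C0 hC]] := fol_blip fol r2.
have [e [e0 he]] := fol_extent fol r2.
have qq : dist2 q q < r / 2 by rewrite dist2xx.
exists (r / 2), C, e; split => //.
  by move=> q' /nr[Dq' hq']; split => //; apply: hC => //; exact: (nr _ qq).2.
by move=> q' d /nr[Dq' hq'] de; exact: he.
Qed.

(* Following the leaf through [(y + d, t)] back to the vertical line through [q = (y, t)]
   expresses [u (y + d, t)] in terms of the values of [u] on that line. *)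
Lemma Bop_slope q : D q -> derivable (fun s : R => U (q.1, s)) q.2 1 -> Bop u q = b q.
Proof.
case: q => y t Dq /= dU.
have [r [C [e [r0 C0 e0 hC he]]]] := fol_near Dq.
pose a := 'D_1 (fun s : R => U (y, s)) t.
have dUt : is_derive t 1 (fun s : R => U (y, s)) a by exact: DeriveDef.
have nearD2 : \forall s \near t, U (y, s) = u (y, s).
  apply/nbhs_ballP; exists r => //= s; rewrite /ball/= => ts; apply: (fol_ext fol).
  by have [] := hC (y, s); rewrite // /dist2/= subrr normr0 gt_max r0.
have dut : is_derive t 1 (fun s : R => u (y, s)) a.
  by apply: near_eq_is_derive dUt; apply: filterS nearD2 => s ->.
pose x := u (y, t).
have M0 : 0 <= Mu by exact: le_trans (normr_ge0 _) (fol_u fol Dq).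
have B0 : 0 <= b0 by exact: le_trans (normr_ge0 _) (fol_b fol (y, t)).
(* The leaf through [(z, t)], with [z = y + d], meets the line over [y] at a point [t'] where [u]
   equals [u (z, t) - b (z, t) * d]. This yields the derivative in [y]; its term [4 * x * a] cancels
   in [Bop] against the derivative of [u ^+ 2]. *)
have duy : is_derive y 1 (fun s : R => u (s, t)) (4 * x * a + b (y, t)).
  apply: is_derive_bound => ep ep0.
  pose A := 4 * Mu + 2 * b0 + 1.
  have A0 : 0 < A by rewrite /A; lra.
  pose W := `|a| * (4 * k + 2 * b0) + C + 1.
  have W0 : 0 < W.
    have : 0 <= `|a| * (4 * k + 2 * b0) by rewrite mulr_ge0// addr_ge0// mulr_ge0// ltW.
    by rewrite /W; lra.
  have epA : 0 < ep / (2 * A) by rewrite divr_gt0// mulr_gt0.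
  have /nbhs_ballP[s0 /= s00 hs] := is_derive_boundP dut epA.
  have nb (w : R) : 0 < w -> \forall z \near y, `|y - z| < w.
    by move=> w0; apply/nbhs_ballP; exists w.
  near=> z.
  have [d zd] : exists d, z = y + d by exists (z - y); ring.
  have dE : `|d| = `|y - z| by rewrite zd opprD addrA subrr add0r normrN.
  have d1 : `|d| < 1.
    by rewrite dE; near: z; apply: nb; rewrite ?divr_gt0// ?mulr_gt0//.
  have de : `|d| < e by rewrite dE; near: z; apply: nb; rewrite ?divr_gt0// ?mulr_gt0//.
  have dr : `|d| < r by rewrite dE; near: z; apply: nb; rewrite ?divr_gt0// ?mulr_gt0//.
  have ds : `|d| < s0 / A.
    by rewrite dE; near: z; apply: nb; rewrite ?divr_gt0// ?mulr_gt0//.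
  have dw : `|d| < ep / (2 * W).
    by rewrite dE; near: z; apply: nb; rewrite ?divr_gt0// ?mulr_gt0//.
  have qz : dist2 (y, t) (z, t) = `|d|.
    by rewrite /dist2/= subrr normr0 max_l// dE.
  have [Dz bz] := hC (z, t) (ltac:(by rewrite qz)).
  have [] := he (z, t) (- d) (ltac:(by rewrite qz)) (ltac:(by rewrite normrN)).
  have := uL Dz Dq; rewrite dist2C qz /=.
  move: bz; rewrite qz distrC => bz uz; rewrite zd (_ : y + d - d = y); last by ring.
  rewrite -zd; set t' := (t - _ - _); move=> Dt' ut'.
  have bM := fol_b fol (z, t); have uM := fol_u fol Dz.
  have t't : t' - t = 4 * u (z, t) * d - 2 * b (z, t) * d ^+ 2 by rewrite /t'; ring.
  have t'A : `|t' - t| <= A * `|d|.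
    rewrite t't (_ : _ - _ = (4 * u (z, t) - 2 * b (z, t) * d) * d); last by ring.
    rewrite normrM ler_wpM2r// (le_trans (ler_normB _ _))// !normrM !(ger0_norm (ler0n _ _)).
    rewrite /A; move: (`|d|) (normr_ge0 d) d1 => c c0 c1.
    move: (`|b _|) (normr_ge0 (b (z, t))) bM => z1 z10 z1b.
    have : z1 * c <= b0 * 1 by rewrite ler_pM// ltW.
    by lra.
  have := hs t'; rewrite /ball/= distrC => /(_ (le_lt_trans t'A _)).
  rewrite mulrC -ltr_pdivlMr// => /(_ ds); rewrite ut' /= -/x => H.
  (* The first bracket is the first-order error of [u] on the line over [y], where
     [|t' - t| <= A * |d|]. The factor in the second is of order [d], with constant [W], by the
     Lipschitz bounds on [u] and on [b] near [q]. *)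
  have E : u (z, t) - x - (4 * x * a + b (y, t)) * d =
     (u (z, t) + b (z, t) * - d - x - a * (t' - t)) +
     (a * (4 * (u (z, t) - x) - 2 * b (z, t) * d) + (b (z, t) - b (y, t))) * d.
    by rewrite t't; ring.
  rewrite (_ : z - y = d); last by rewrite zd; ring.
  rewrite E (le_trans (ler_normD _ _))// (_ : ep * `|d| = ep / 2 * `|d| + ep / 2 * `|d|); last by field.
  apply: lerD.
    apply: (le_trans H); rewrite (_ : ep / 2 = ep / (2 * A) * A); last by field; lra.
    by rewrite -[leRHS]mulrA ler_wpM2l// ltW.
  rewrite normrM ler_wpM2r//.
  apply: (@le_trans _ _ (W * `|d|)); last first.
    rewrite mulrC -ler_pdivlMr//; apply: (le_trans (ltW dw)).
    by rewrite invfM mulrA.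
  rewrite (le_trans (ler_normD _ _))// /W.
  rewrite (_ : _ * `|d| = `|a| * (4 * (k * `|d|) + 2 * (b0 * `|d|)) + C * `|d| + `|d|); last by ring.
  rewrite -addrA; apply: lerD; last by have := normr_ge0 d; lra.
  rewrite normrM ler_wpM2l// (le_trans (ler_normB _ _))// !normrM !(ger0_norm (ler0n _ _)).
  apply: lerD; first by rewrite ler_wpM2l.
  by rewrite -mulrA ler_wpM2l// ler_wpM2r.
have dsq : is_derive t 1 (fun s : R => u (y, s) ^+ 2) (2 * x * a).
  have := is_derive_mul dut dut; apply: is_derive_eqf => //.
  by rewrite -/x; ring.
rewrite /Bop !derive1E /=.
have [_ ->] := duy; have [_ ->] := dsq.
by ring.
Unshelve. all: by end_near. Qed.

End foliated_domain.

(** * Left and right projections *)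

Section projections.
Variable R : realType.
Local Notation H := (R * R * R)%type.
Implicit Types (p : H) (q : R * R) (D : set (R * R)).

(** With [x] the first coordinate of [p], the point [p] is the product of [projl p] with
    [exp (x X)], and also that of [exp (x X)] with [projr p]. The two projections share [y] and
    differ by [4 * y * x] in [t]. *)
Definition projl p : R * R := (p.1.2, p.2 - 2 * p.1.2 * p.1.1).
Definition projr p : R * R := (p.1.2, p.2 + 2 * p.1.2 * p.1.1).

Lemma projl_Phi (s : R) q : projl (Phi (s, q)) = q.
Proof. by case: q => y t; rewrite /projl /Phi/=; congr (_, _); ring. Qed.

Lemma Phi_projl p : Phi (p.1.1, projl p) = p.
Proof. by case: p => [[x y] t]; rewrite /projl /Phi/=; congr ((_, _), _); ring. Qed.

Lemma projr_Phi (s : R) q : projr (Phi (s, q)) = (q.1, q.2 + 4 * q.1 * s).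
Proof. by case: q => y t; rewrite /projr /Phi/=; congr (_, _); ring. Qed.

Lemma DVE D p : DV D p <-> D (projl p).
Proof.
split=> [[q [s [Dq ->]]]|Dp]; first by rewrite -[X in projl X]/(Phi (s, (q.1, q.2))) projl_Phi -surjective_pairing.
by exists (projl p), p.1.1; split => //; rewrite -{1}(Phi_projl p).
Qed.

Lemma EgraphE D u p : Egraph D u p <-> D (projl p) /\ u (projl p) < p.1.1.
Proof.
split=> [[q [s [Dq [us ->]]]]|[Dp up]].
  by rewrite -[X in projl X]/(Phi (s, (q.1, q.2))) projl_Phi -surjective_pairing.
by exists (projl p), p.1.1; split => //; split => //; rewrite -{1}(Phi_projl p).
Qed.

Lemma SgraphE D u p : Sgraph D u p <-> D (projl p) /\ u (projl p) = p.1.1.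
Proof.
split=> [[q Dq <-]|[Dp up]].
  by rewrite -[X in projl X]/(Phi (u q, (q.1, q.2))) projl_Phi -surjective_pairing.
by exists (projl p) => //; rewrite up -[RHS](Phi_projl p).
Qed.

Lemma projr_right (s : R) q : projr ((s, q.1), q.2 - 2 * q.1 * s) = q.
Proof. by case: q => y t; rewrite /projr/=; congr (_, _); ring. Qed.

Lemma right_projr p : ((p.1.1, (projr p).1), (projr p).2 - 2 * (projr p).1 * p.1.1) = p.
Proof. by case: p => [[x y] t]; rewrite /projr/=; congr ((_, _), _); ring. Qed.

Lemma VDE D p : VD D p <-> D (projr p).
Proof.
split=> [[q [s [Dq ->]]]|Dp]; first by rewrite projr_right.
by exists (projr p), p.1.1; split => //; rewrite right_projr.
Qed.

Lemma Egraph_rE D u p : Egraph_r D u p <-> D (projr p) /\ u (projr p) < p.1.1.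
Proof.
split=> [[q [s [Dq [us ->]]]]|[Dp up]]; first by rewrite projr_right.
by exists (projr p), p.1.1; split => //; split => //; rewrite right_projr.
Qed.

Lemma Sgraph_rE D u p : Sgraph_r D u p <-> D (projr p) /\ u (projr p) = p.1.1.
Proof.
split=> [[q Dq <-]|[Dp up]]; first by rewrite projr_right.
by exists (projr p) => //; rewrite up right_projr.
Qed.

Lemma continuous_pair2 (T U V : topologicalType) (f : T -> U) (g : T -> V) :
  continuous f -> continuous g -> continuous (fun z : T => (f z, g z)).
Proof. by move=> cf cg z; exact: (cvg_pair (cf z) (cg z)). Qed.

Lemma continuous_projl : continuous projl.
Proof.
apply: continuous_pair2; first exact: continuous_y3.
move=> p; apply: cvgB; first exact: continuous_t3.
apply: cvgM; last exact: continuous_x3.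
by apply: cvgM; [exact: cvg_cst|exact: continuous_y3].
Qed.

Lemma continuous_projr : continuous projr.
Proof.
apply: continuous_pair2; first exact: continuous_y3.
move=> p; apply: cvgD; first exact: continuous_t3.
apply: cvgM; last exact: continuous_x3.
by apply: cvgM; [exact: cvg_cst|exact: continuous_y3].
Qed.

Lemma open_DV D : open D -> open (DV D).
Proof.
move=> oD; rewrite (_ : DV D = projl @^-1` D); last by apply/seteqP; split => p /DVE.
by apply: open_comp => // p _; exact: continuous_projl.
Qed.

Lemma open_VD D : open D -> open (VD D).
Proof.
move=> oD; rewrite (_ : VD D = projr @^-1` D); last by apply/seteqP; split => p /VDE.
by apply: open_comp => // p _; exact: continuous_projr.
Qed.

Lemma open_lt_graph D (u : R * R -> R) (pr : H -> R * R) : open D ->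
  (forall q, D q -> {for q, continuous u}) -> continuous pr ->
  open [set p | D (pr p) /\ u (pr p) < p.1.1].
Proof.
move=> oD cu cpr; rewrite openE => p [Dp up].
have c1 : {for p, continuous (u \o pr)} by apply: continuous_comp; [exact: cpr|exact: cu].
have nD : \forall p' \near p, D (pr p') by apply: cpr; exact: open_nbhs_nbhs.
have nu : \forall p' \near p, 0 < p'.1.1 - (u \o pr) p'.
  have c2 : {for p, continuous (fun p' => p'.1.1 - (u \o pr) p')}.
    by apply: cvgB; [exact: continuous_x3|exact: c1].
  by apply: (cvgr_gt _ c2); rewrite /= subr_gt0.
near=> p'; split; first by near: p'.
by rewrite -subr_gt0; near: p'.
Unshelve. all: by end_near. Qed.

Lemma measurable_fun_open_support D (f : R * R -> R) : open D ->
  (forall q, D q -> {for q, continuous f}) -> (forall q, ~ D q -> f q = 0) ->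
  measurable_fun setT f.
Proof.
move=> oD cf f0; apply: measurable_fun_preimage_open => A oA.
have oDA : open (D `&` f @^-1` A).
  rewrite openE => q [Dq fq]; apply: filterI; first exact: open_nbhs_nbhs.
  by apply: (cf _ Dq); exact: open_nbhs_nbhs.
have mD : measurable D by exact: open_measurable_R2.
have [A0|nA0] := pselect (A 0).
  rewrite (_ : _ @^-1` _ = (D `&` f @^-1` A) `|` ~` D).
    by apply: measurableU; [exact: open_measurable_R2|exact: measurableC].
  apply/seteqP; split => q; first by have [Dq|nD] := pselect (D q); [left|right].
  by move=> [[]//|/f0 fq]; rewrite /preimage/= fq.
rewrite (_ : _ @^-1` _ = D `&` f @^-1` A); first exact: open_measurable_R2.
apply/seteqP; split => [q Aq|q []//]; split => //.
by apply: contrapT => /f0 fq; apply: nA0; rewrite -fq.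
Qed.

(** Finitely many of the local neighbourhoods cover [K], and monotonicity in [r] allows the smallest
    of their radii; the filter of small positive numbers encodes this choice. *)
Lemma compact_uniform_radius (K : set (R * R)) (P : R * R -> R -> Prop) : compact K ->
  (forall q (r r' : R), 0 < r' <= r -> P q r -> P q r') ->
  (forall q, K q -> exists r : R, 0 < r /\ forall q', dist2 q q' < r -> P q' r) ->
  exists r : R, 0 < r /\ forall q, K q -> P q r.
Proof.
move=> /compact_near_coveringP cK Pmono Ploc.
have N1 : \forall r \near (0 : R)^'+, K `<=` (fun q => P q r).
  apply: (cK R _ (fun r q => P q r)) => q /Ploc[r [r0 hr]].
  exists ([set q' | dist2 q q' < r], [set r' | 0 < r' < r]) => /=.
    split; first by rewrite dist2_ball; exact: nbhsx_ballx.
    by near=> r'; apply/andP; split; near: r'; [exact: nbhs_right_gt|exact: nbhs_right_lt].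
  move=> [q' r'] /= [/hr + /andP[r'0 /ltW r'r]].
  by apply: Pmono; rewrite r'0.
have N2 : \forall r \near (0 : R)^'+, 0 < r by exact: nbhs_right_gt.
have [r [hr r0]] : exists r : R, K `<=` (fun q => P q r) /\ 0 < r.
  exact: (filter_ex (F := (0 : R)^'+) (filterI N1 N2)).
by exists r.
Unshelve. all: by end_near. Qed.

Lemma compact_ball_subset (K D : set (R * R)) : compact K -> open D -> K `<=` D ->
  exists r : R, 0 < r /\ forall q, K q -> forall q', dist2 q q' < r -> D q'.
Proof.
move=> cK oD KD; apply: (compact_uniform_radius (P := fun q r => forall q', dist2 q q' < r -> D q')) => //.
  by move=> q r r' /andP[_ rr'] hr q' qq'; apply: hr; exact: lt_le_trans qq' rr'.
move=> q Kq; have : nbhs q D by apply: open_nbhs_nbhs; split => //; exact: KD.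
move=> /nbhs_ballP[r /= r0 hr]; exists (r / 2); split; first by rewrite divr_gt0.
move=> q' qq' q2 q'q2; apply: hr; rewrite -dist2_ball/=.
by have := dist2_triangle q q' q2; lra.
Qed.

End projections.

(** * The ruled graph over the lens-shaped domain *)

Section lens_domain.
Variable R : realType.
Variables (tbar : R) (g1 g2 : R -> R) (I : set R) (D : set (R * R)).
Hypothesis IE : forall s, I s <-> 0 < s < tbar.

Lemma supnorm_ge (f : R -> R) (s : R) : lip1_on I f -> I s -> `|f s| <= supnorm I f.
Proof.
move=> [k fk] Is; apply: ub_le_sup; last by exists s.
exists (`|f s| + `|k| * tbar) => _ [s' Is' <-].
have := fk _ _ Is' Is; have := lerB_dist (f s') (f s).
have ss' : `|s' - s| <= tbar.
  by move: Is Is' => /IE/andP[? ?] /IE/andP[? ?]; rewrite ler_norml; apply/andP; split; lra.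
have h1 : k * `|s' - s| <= `|k| * tbar.
  by apply: (@le_trans _ _ (`|k| * `|s' - s|)); [rewrite ler_wpM2r// ler_norm|rewrite ler_wpM2l].
lra.
Qed.

Lemma lipconst_ge (f : R -> R) (s s' : R) : lip1_on I f -> I s -> I s' -> s != s' ->
  `|f s - f s'| / `|s - s'| <= lipconst I f.
Proof.
move=> [k fk] Is Is' ss'; apply: ub_le_sup; last by exists s, s'.
exists k => _ [a [b [Ia [Ib [ab ->]]]]].
by rewrite ler_pdivrMr ?normr_gt0 ?subr_eq0//; exact: fk.
Qed.

Lemma lipconst_bound (f : R -> R) (s s' : R) : lip1_on I f -> I s -> I s' ->
  `|f s - f s'| <= lipconst I f * `|s - s'|.
Proof.
move=> fL Is Is'; have [->|ss'] := eqVneq s s'; first by rewrite !subrr normr0 mulr0.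
by rewrite -ler_pdivrMr ?normr_gt0 ?subr_eq0//; exact: lipconst_ge.
Qed.

Hypothesis tbar0 : 0 < tbar.

Lemma supnorm_ge0 (f : R -> R) : lip1_on I f -> 0 <= supnorm I f.
Proof.
have t0 := tbar0; move=> fL; have It : I (tbar / 2) by apply/IE/andP; split; lra.
by apply: le_trans (supnorm_ge fL It).
Qed.

Lemma lipconst_ge0 (f : R -> R) : lip1_on I f -> 0 <= lipconst I f.
Proof.
have t0 := tbar0; move=> fL; apply: (@le_trans _ _ (`|f (tbar / 2) - f (tbar / 3)| / `|tbar / 2 - tbar / 3|)).
  by rewrite divr_ge0.
by apply: lipconst_ge => //; [apply/IE/andP; split|apply/IE/andP; split|rewrite gt_eqF//]; lra.
Qed.

Hypotheses (g1L : lip1_on I g1) (g2L : lip1_on I g2).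
Hypothesis g1c : {within `[0, tbar]%classic, continuous g1}.
Hypothesis g12 : forall s, I s -> g1 s < 0 < g2 s.
Hypotheses (g10 : g1 0 = 0) (g1t : g1 tbar = 0).

Hypothesis DE : forall q, D q <-> I q.2 /\ g1 q.2 < q.1 < g2 q.2.

Lemma lens_open q : D q -> exists r : R, 0 < r /\ forall q', dist2 q q' < r -> D q'.
Proof.
case: q => y t /DE[/= tI /andP[y1 y2]].
have [k1 hk1] := g1L; have [k2 hk2] := g2L.
pose K := 1 + `|k1| + `|k2|.
have K1 : 1 <= K by rewrite /K -addrA lerDl addr_ge0.
have /IE/andP[t0 t1] := tI.
pose r := Num.min (Num.min t (tbar - t)) (Num.min ((y - g1 t) / (2 * K)) ((g2 t - y) / (2 * K))).
exists r; split.
  by rewrite !lt_min t0 subr_gt0 t1/= !divr_gt0// ?subr_gt0// mulr_gt0//; lra.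
move=> [y' t']; rewrite /dist2/= gt_max !lt_min -!andbA !ltr_pdivlMr ?mulr_gt0//; try lra.
move=> /and5P[a1 a2 a3 a4 /and4P[b1 b2 b3 b4]].
have It' : I t' by apply/IE; move: b1 b2; rewrite !ltr_norml => /andP[? ?] /andP[? ?]; apply/andP; split; lra.
apply/DE; split => //=; have L1 := hk1 _ _ tI It'; have L2 := hk2 _ _ tI It'.
have k1K : k1 * `|t - t'| <= K * `|t - t'|.
  by rewrite ler_wpM2r// /K; have := ler_norm k1; have := normr_ge0 k2; lra.
have k2K : k2 * `|t - t'| <= K * `|t - t'|.
  by rewrite ler_wpM2r// /K; have := ler_norm k2; have := normr_ge0 k1; lra.
move: L1 L2; rewrite !ler_norml => /andP[c1 c2] /andP[c3 c4].
have d0 : `|y - y'| <= K * `|y - y'| by rewrite ler_peMl.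
have d1 := ler_norm (y - y'); have d2 := ler_norm (- (y - y')); rewrite normrN in d2.
by apply/andP; split; lra.
Qed.

Lemma lens_bounded : exists A : R, forall q, D q -> `|q.1| <= A /\ `|q.2| <= A.
Proof.
exists (supnorm I g1 + supnorm I g2 + tbar) => -[y t] /DE[/= tI /andP[y1 y2]].
have := supnorm_ge g1L tI; have := supnorm_ge g2L tI.
have := supnorm_ge0 g1L; have := supnorm_ge0 g2L.
move: tI => /IE/andP[t0 t1] s1 s2; rewrite !ler_norml => /andP[a1 a2] /andP[a3 a4].
by split; lra.
Qed.

(** Each slice of [D] at constant [t] is an interval around 0. This permits the deformation to the
    axis used in [to_right_increasing]. *)
Lemma lens_scale q (a : R) : D q -> 0 <= a <= 1 -> D (a * q.1, q.2).
Proof.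
case: q => y t /DE[/= tI /andP[y1 y2]] /andP[a0 a1]; apply/DE; split => //=.
have /andP[n1 n2] := g12 tI.
have [->|an0] := eqVneq a 0; first by rewrite mul0r n1.
have a_gt0 : 0 < a by rewrite lt_neqAle eq_sym an0.
have p1 : 0 < a * (y - g1 t) by rewrite mulr_gt0// subr_gt0.
have p2 : 0 < a * (g2 t - y) by rewrite mulr_gt0// subr_gt0.
have p3 : 0 <= (1 - a) * - g1 t by rewrite mulr_ge0 ?subr_ge0// oppr_ge0 ltW.
have p4 : 0 <= (1 - a) * g2 t by rewrite mulr_ge0 ?subr_ge0// ltW.
by apply/andP; split; lra.
Qed.

Lemma lens_right_limit : g1 x @[x --> 0^'+] --> 0 /\ g1 x @[x --> tbar^'-] --> 0.
Proof.
by move: g1c => /(continuous_within_itvP _ tbar0)[_]; rewrite g10 g1t.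
Qed.

Lemma lens_near_corner (c : R) (w : R) : c = 0 \/ c = tbar -> 0 < w ->
  exists s, [/\ I s, `|c - s| < w & `|g1 s| < w].
Proof.
have [l0 lt] := lens_right_limit; move=> [->|->] w0.
- have N1 : \forall s \near (0 : R)^'+, `|g1 s| < w.
    by move/cvgrPdist_lt : l0 => /(_ _ w0); apply: filterS => s; rewrite sub0r normrN.
  have N2 : \forall s \near (0 : R)^'+, 0 < s < Num.min tbar w.
    by near=> s; apply/andP; split; near: s; [exact: nbhs_right_gt|apply: nbhs_right_lt; rewrite lt_min tbar0].
  have [s [h1 /andP[s0]]] := filter_ex (F := (0 : R)^'+) (filterI N1 N2).
  rewrite lt_min => /andP[s1 s2]; exists s; split => //; first by apply/IE; rewrite s0.
  by rewrite sub0r normrN gtr0_norm.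
- have N1 : \forall s \near tbar^'-, `|g1 s| < w.
    by move/cvgrPdist_lt : lt => /(_ _ w0); apply: filterS => s; rewrite sub0r normrN.
  have N2 : \forall s \near tbar^'-, Num.max 0 (tbar - w) < s < tbar.
    by near=> s; apply/andP; split; near: s; [apply: nbhs_left_gt; rewrite gt_max tbar0/= gtrBl|exact: nbhs_left_lt].
  have [s [h1]] := filter_ex (F := tbar^'-) (filterI N1 N2).
  rewrite gt_max => /andP[/andP[s0 s1] s2]; exists s; split => //; first by apply/IE; rewrite s0.
  by rewrite gtr0_norm; lra.
Unshelve. all: by end_near. Qed.

(** The Lipschitz bound on [I] extends by continuity to the end points, where [g1] vanishes. *)
Lemma lens_left_lip (c s : R) : c = 0 \/ c = tbar -> I s -> `|g1 s| <= lipconst I g1 * `|c - s|.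
Proof.
move=> hc Is; apply/ler_addgt0Pr => e e0.
have L0 := lipconst_ge0 g1L.
pose w := e / (1 + lipconst I g1).
have w0 : 0 < w by rewrite divr_gt0//; lra.
have [s' [Is' cs gs]] := lens_near_corner hc w0.
have wE : w * (1 + lipconst I g1) = e by rewrite /w mulfVK//; lra.
have := lipconst_bound g1L Is Is'; have := lerB_dist (g1 s) (g1 s').
have h1 : `|s - s'| <= `|c - s| + w.
  by have := ler_distD c s s'; rewrite (distrC s c); lra.
have h2 : lipconst I g1 * `|s - s'| <= lipconst I g1 * (`|c - s| + w) by rewrite ler_wpM2l.
by nra.
Qed.

Lemma lens_closure q : (forall w : R, 0 < w -> exists q', D q' /\ dist2 q q' < w) -> closure D q.
Proof.
move=> h A /nbhs_ballP[w /= w0 wA]; have [q' [Dq' qq']] := h _ w0.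
by exists q'; split => //; apply: wA; rewrite -dist2_ball.
Qed.

Lemma lens_boundary_left (s : R) : I s -> (closure D `\` interior D) (g1 s, s).
Proof.
move=> Is; split; last by move=> /interior_subset/DE[_ /=]; rewrite ltxx.
have /andP[n1 n2] := g12 Is.
apply: lens_closure => w w0; exists (g1 s + Num.min (w / 2) (- g1 s), s).
have m0 : 0 < Num.min (w / 2) (- g1 s) by rewrite lt_min divr_gt0//= oppr_gt0.
have m1 : Num.min (w / 2) (- g1 s) <= w / 2 by rewrite ge_min lexx.
have m2 : Num.min (w / 2) (- g1 s) <= - g1 s by rewrite ge_min lexx orbT.
split; first by apply/DE; split => //=; apply/andP; split; lra.
rewrite /dist2/= subrr normr0 gt_max w0 andbT opprD addrA subrr sub0r normrN gtr0_norm//.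
lra.
Qed.

Lemma lens_boundary_corner (c : R) : c = 0 \/ c = tbar -> (closure D `\` interior D) (0, c).
Proof.
move=> hc; split; last first.
  by move=> /interior_subset/DE[/= /IE + _]; case: hc => ->; rewrite ltxx ?andbF.
apply: lens_closure => w w0; have [s [Is cs gs]] := lens_near_corner hc w0.
exists (0, s); split; first by apply/DE; split => //=; exact: g12.
by rewrite /dist2/= subrr normr0 gt_max w0.
Qed.

Section graph_leaves.
Variables (phi u U : R * R -> R) (k : R).
Let f1 := fun s => phi (g1 s, s).
Let f2 := fun s => phi (g2 s, s).
Hypotheses (g20 : g2 0 = 0) (g2t : g2 tbar = 0) (f1L : lip1_on I f1).
Hypothesis k0 : 0 < k.
Hypothesis UL : forall q q', `|U q - U q'| <= k * dist2 q q'.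
Hypothesis Uphi : forall q, (closure D `\` interior D) q -> U q = phi q.
Hypothesis small : 4 * lipconst I g1 * supnorm I f1 < 1.
Hypothesis SR : Sgraph D u = Rphi tbar g1 g2 f1 f2.

(** An end point is outside [I], but both boundary arcs reach the corner [(0, c)]; by continuity of
    [U] the value there is a limit of values of [f1]. *)
Lemma lens_corner_bound (c : R) : c = 0 \/ c = tbar -> `|f2 c| <= supnorm I f1.
Proof.
move=> hc; have -> : f2 c = U (0, c).
  rewrite (Uphi (lens_boundary_corner hc)) /f2; congr (phi (_, _)).
  by case: hc => ->.
apply/ler_addgt0Pr => e e0; have w0 : 0 < e / k by rewrite divr_gt0.
have [s [Is cs gs]] := lens_near_corner hc w0.
have := UL (0, c) (g1 s, s); rewrite (Uphi (lens_boundary_left Is)) -/(f1 s).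
have dE : dist2 (0, c) (g1 s, s) < e / k by rewrite /dist2/= sub0r normrN gt_max gs cs.
have := supnorm_ge f1L Is; have := lerB_dist (U (0, c)) (f1 s).
move: dE; rewrite ltr_pdivlMr// => *; lra.
Qed.

(** The point over [q] lies on a horizontal segment of [Rphi], which projects to a parabola. The
    whole open segment lies on the graph, so its projection stays in [D] and [u] is affine there;
    the ends project to [(g1 s, s)] and [(g2 l, l)], outside [D]. *)
Lemma lens_leaf q : D q -> exists b y1 y2, leaf D u q b y1 y2.
Proof.
move=> Dq.
have : Rphi tbar g1 g2 f1 f2 (Phi (u q, q)).
  by rewrite -SR; apply/SgraphE; rewrite projl_Phi.
move=> [h [s [l [/andP[h0 h1] [/IE Is [Il [[a [c E]] pE]]]]]]].
move: (E); rewrite /vsub/pcurve/= => -[aE cE tE].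
have /andP[gs _] := g12 Is.
have L0 := lipconst_ge0 g1L.
have B0 := supnorm_ge0 f1L.
(* A segment ending at a corner would give [y2 = 0], whereas a leaf has to cross the axis.
   Horizontality then reads [l' - s = 2 * g1 s * (f1 s + f2 l')], whose right side is at most [4 *
   lipconst I g1 * supnorm I f1 * |l' - s|]; this contradicts [small]. *)
have lI : I l.
  have corner l' : l' = 0 \/ l' = tbar -> l != l'.
    move=> hl; apply/eqP => ll; rewrite {}ll in aE cE tE.
    have g2l : g2 l' = 0 by case: hl => ->.
    have fl := lens_corner_bound hl; have fs := supnorm_ge f1L Is; have gls := lens_left_lip hl Is.
    have ls : `|l' - s| = `|2 * g1 s * (f1 s + f2 l')|.
      by congr (`|_|); move: tE; rewrite -aE -cE g2l => tE; lra.
    have ls0 : 0 < `|l' - s|.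
      by rewrite normr_gt0 subr_eq0; move: Is => /IE/andP[s0 s1]; case: hl => ->; [rewrite lt_eqF|rewrite gt_eqF].
    have ff : `|f1 s + f2 l'| <= 2 * supnorm I f1 by have := ler_normD (f1 s) (f2 l'); lra.
    have : `|l' - s| <= 4 * lipconst I g1 * supnorm I f1 * `|l' - s|.
      rewrite {1}ls !normrM (ger0_norm (ler0n _ _)).
      rewrite (_ : 4 * _ * _ * _ = 2 * (lipconst I g1 * `|l' - s|) * (2 * supnorm I f1)); last by ring.
      by apply: ler_pM => //; rewrite ?mulr_ge0// ler_wpM2l.
    by rewrite leNgt -[X in _ < X]mul1r ltr_pM2r// small.
  move: Il => /andP[l0 l1]; have := corner 0 (or_introl erefl); have := corner tbar (or_intror erefl).
  by move=> lt l0'; apply/IE; rewrite lt_neqAle eq_sym l0' l0 lt_neqAle lt l1.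
have /andP[_ gl] := g12 lI.
have c0 : 0 < c by rewrite -cE; lra.
pose b := a / c.
have abc : a = b * c by rewrite /b mulfVK// gt_eqF.
move: pE; case: q Dq => y t Dq; rewrite /Phi/vcomb/pcurve/= => -[xE yE TE].
move: xE yE TE; set x := u (y, t) => xE yE TE.
have yc : y = g1 s + h * c by rewrite yE -cE; ring.
have xc : x = f1 s + h * (b * c) by rewrite xE -abc -aE; ring.
have Tc : t = s + 2 * g1 s * f1 s + h * (a * (2 * g1 s) + c * (- 2 * f1 s)) - 2 * y * x.
  by rewrite -tE; move: TE => TE; lra.
(* The parameter [h'] on the segment corresponds to the abscissa [g1 s + h' * c]; the identity
   serves the interior as well as the ends [h' = 0] and [h' = 1]. *)
have line h' : parabola (y, t) x b (g1 s + h' * c) =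
    projl (vcomb h' (pcurve g1 f1 s) (pcurve g2 f2 l)).
  rewrite /parabola/projl/vcomb/pcurve/=; congr (_, _); first by rewrite -cE; ring.
  have -> : l + 2 * g2 l * f2 l = s + 2 * g1 s * f1 s + (a * (2 * g1 s) + c * (- 2 * f1 s)).
    by move: tE => tE; lra.
  have -> : f2 l = f1 s + b * c by rewrite -abc -aE; ring.
  have -> : g2 l = g1 s + c by rewrite -cE; ring.
  by rewrite Tc xc yc abc; ring.
exists b, (g1 s), (g2 l); split.
- by rewrite gs.
- by rewrite /= yc -(subrK (g1 s) (g2 l)) cE; apply/andP; split; nra.
- move=> y' /andP[y'1 y'2].
  pose h' := (y' - g1 s) / c.
  have hc : h' * c = y' - g1 s by rewrite /h' mulfVK// gt_eqF.
  have y'E : y' = g1 s + h' * c by rewrite hc; ring.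
  have hh : 0 < h' < 1.
    by rewrite /h' divr_gt0 ?subr_gt0//= ltr_pdivrMr// mul1r -cE; lra.
  have : Rphi tbar g1 g2 f1 f2 (vcomb h' (pcurve g1 f1 s) (pcurve g2 f2 l)).
    exists h', s, l; split; [exact: hh|split; [exact/IE|split; [exact: Il|split; [|by []]]]].
    by exists a, c; exact: E.
  rewrite -SR => /SgraphE[]; rewrite -line -y'E -/x => D' u'; split => //.
  rewrite u' /vcomb/pcurve/=.
  have -> : f2 l = f1 s + b * c by rewrite -abc -aE; ring.
  by rewrite xc yc y'E; ring.
- have := line 0; rewrite mul0r addr0 => -> /DE[_].
  by rewrite /projl/vcomb/pcurve/= (_ : (1 - 0) * _ + _ - _ = s) ?ltxx//; [|ring];
    rewrite subr0 mul1r mul0r addr0 ltxx.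
- have := line 1; rewrite (_ : g1 s + 1 * c = g2 l); last by rewrite -cE; ring.
  move=> -> /DE[_].
  rewrite /projl/vcomb/pcurve/= (_ : (1 - 1) * _ + _ - _ = l); last by ring.
  by rewrite subrr mul1r mul0r add0r ltxx andbF.
Qed.

End graph_leaves.
End lens_domain.

(** * Left and right divergence formulas *)

Section left_divergence.
Variable R : realType.
Variables (D : set (R * R)) (u U b : R * R -> R) (k Mu b0 : R).
Hypothesis fol : foliation D u U b k Mu b0.
Local Notation H := (R * R * R)%type.
Local Notation leb2 := (@leb2 R).
Local Notation leb3 := (@leb3 R).
Implicit Types (q : R * R) (v : H -> R).

Lemma fol_domain_open : open D.
Proof.
rewrite openE => q /(fol_open fol)[r [r0 hr]].
by apply/nbhs_ballP; exists r => //= q'; rewrite -dist2_ball; exact: hr.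
Qed.

Lemma fol_ext_continuous : continuous U.
Proof. exact: lip2_continuous (fol_lip fol). Qed.

Lemma fol_u_continuous q : D q -> {for q, continuous u}.
Proof.
move=> Dq; have nD : \forall q' \near q, U q' = u q'.
  have : nbhs q D by apply: open_nbhs_nbhs; split => //; exact: fol_domain_open.
  by apply: filterS => q' Dq'; exact: (fol_ext fol).
apply: (cvg_trans (near_eq_cvg nD)); rewrite -(fol_ext fol)//.
exact: fol_ext_continuous.
Qed.

Lemma fol_slope_continuous q : D q -> {for q, continuous b}.
Proof.
move=> Dq; have [r [C [e [r0 C0 _ hC _]]]] := fol_near fol Dq.
apply/cvgrPdist_lt => ep ep0.
have w0 : 0 < Num.min r (ep / (C + 1)) by rewrite lt_min r0 divr_gt0//; lra.
have nq : nbhs q [set q' | dist2 q q' < Num.min r (ep / (C + 1))].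
  by rewrite dist2_ball; exact: nbhsx_ballx.
apply: filterS nq => q' /=.
rewrite lt_min => /andP[qr qe]; have [_ h] := hC _ qr.
apply: (le_lt_trans h); move: qe; rewrite ltr_pdivlMr; last by lra.
by have := dist2_ge0 q q'; nra.
Qed.

Lemma fol_slope_measurable : measurable_fun setT b.
Proof.
apply: (measurable_fun_open_support fol_domain_open); first exact: fol_slope_continuous.
exact: (fol_out fol).
Qed.

Lemma Egraph_open : open (Egraph D u).
Proof.
rewrite (_ : Egraph D u = [set p | D (projl p) /\ u (projl p) < p.1.1]); last first.
  by apply/seteqP; split => p /EgraphE.
apply: open_lt_graph; [exact: fol_domain_open|exact: fol_u_continuous|exact: continuous_projl].
Qed.

Let mD : measurable D. Proof. exact: open_measurable_R2 fol_domain_open. Qed.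

Lemma graph_trace_measurable v : continuous v -> measurable_fun setT (fun q => v (Phi (U q, q))).
Proof.
move=> cv; apply: continuous_measurable_fun_R2.
have cP : continuous (fun q => Phi (U q, q)).
  apply: continuous_pair2; last first.
    move=> q; apply: cvgD; first exact: cvg_snd.
    apply: cvgM; last exact: fol_ext_continuous.
    by apply: cvgM; [exact: cvg_cst|exact: cvg_fst].
  by apply: continuous_pair2 => // q; [exact: fol_ext_continuous|exact: cvg_fst].
by move=> q; apply: continuous_comp; [exact: cP|exact: cv].
Qed.

Section field.
Variable v : H -> R.
Hypothesis vD : C1c (DV D) v.

Let cv : continuous v. Proof. by have [/C1_continuous] := vD. Qed.

Let D_of q (s : R) : v (Phi (s, q)) != 0 -> D q.
Proof.
move=> vq; have [_ [_ KD]] := vD.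
by have /KD/DVE := @subset_closure _ [set p | v p != 0] _ vq; rewrite projl_Phi.
Qed.

Let Eu q (s : R) : v (Phi (s, q)) != 0 -> (Egraph D u (Phi (s, q)) <-> U q < s).
Proof.
move=> /D_of Dq; rewrite EgraphE projl_Phi (fol_ext fol)//.
by split => [[]|].
Qed.

Let mE : measurable (Egraph D u). Proof. exact: open_measurable_R3 Egraph_open. Qed.

(** [flowX] moves along the fibres of [Phi] and raises the graph by exactly [h]: the speed is [- 1]
    on [D] and the error constant is 0. *)
Lemma left_divergence_X : (\int[leb3]_(p in Egraph D u) (Xf v p)%:E)%E =
  (\int[leb2]_q (- \1_D q * v (Phi (U q, q))))%R%:E.
Proof.
have b1 q : `|- \1_D q| <= 1 :> R.
  by rewrite normrN indicE; case: (_ \in _); rewrite ?normr1 ?normr0.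
have mm : measurable_fun setT (fun q => - \1_D q * v (Phi (U q, q))).
  have mI : measurable_fun setT (fun q => - (\1_D q : R)).
    by apply: measurable_funN; exact: measurable_indic.
  exact: (measurable_funM mI (graph_trace_measurable cv)).
apply: (@divergence_X _ (DV D) v (Egraph D u) U (fun q => - \1_D q) 0 1 1) => //.
have E q (s h : R) : flowX (- h) (Phi (s, q)) = Phi (s - h, q).
  by rewrite (Phi_flowX (s - h) s); congr flowX; ring.
split=> h q s _ /D_of Dq; rewrite E EgraphE projl_Phi -(fol_ext fol)// indicE mem_set//=;
  rewrite mul0r ?addr0 ?subr0 => hs.
- by split => //; lra.
- by move=> [_ ?]; lra.
Qed.

(** Flowing back by [h] keeps the height [s] and moves [q] to [(y - h, t + 4 s h)]. The leaf through
    [q] reaches the abscissa [y - h] at [t + 4 u h - 2 b h^2], where [u] equals [u q - b q * h].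
    Comparing the two points by the Lipschitz bound locates the flowed graph at [u q - b q * h] up
    to order [h^2], without a derivative of [u]. *)
Lemma left_divergence_Y : (\int[leb3]_(p in Egraph D u) (Yf v p)%:E)%E =
  (\int[leb2]_q (b q * v (Phi (U q, q))))%R%:E.
Proof.
have k0 := fol_k fol.
have mm : measurable_fun setT (fun q => b q * v (Phi (U q, q))).
  exact: (measurable_funM fol_slope_measurable (graph_trace_measurable cv)).
have [M [N [M0 N0 hM hN]]] := C1c_bounds vD.
have [_ [cK KD]] := vD.
have [r [r0 hr]] : exists r : R, 0 < r /\ forall q, (@projl R @` closure [set p | v p != 0]) q ->
    forall q', dist2 q q' < r -> D q'.
  apply: compact_ball_subset; last by move=> _ [p /KD/DVE Dp <-].
    apply: continuous_compact => //; apply: continuous_subspaceT; exact: continuous_projl.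
  exact: fol_domain_open.
have [e [e0 he]] := fol_extent fol r0.
have B0 : 0 <= b0 by exact: le_trans (normr_ge0 _) (fol_b fol (0, 0)).
(* The three bounds keep the leaf through [q] available, reduce the Lipschitz factor [4 * k * h] to
   [1 / 2], and keep the displaced point within [r] of [q]. *)
pose h0 := Num.min (e / 2) (Num.min ((8 * k)^-1) (r / (2 + 4 * N))).
have h0_gt0 : 0 < h0.
  rewrite !lt_min invr_gt0; apply/and3P; split; [by rewrite divr_gt0|by rewrite mulr_gt0|].
  by rewrite divr_gt0//; lra.
have c0 : 0 <= 4 * k * b0 by rewrite !mulr_ge0// ltW.
have close h q (s : R) : 0 < h <= h0 -> v (Phi (s, q)) != 0 ->
    D (q.1 - h, q.2 + 4 * s * h) /\
    `|u (q.1 - h, q.2 + 4 * s * h) - (u q - b q * h)| <= `|s - (u q - b q * h)| / 2 + 2 * k * b0 * h ^+ 2.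
  move=> /andP[h_gt0]; rewrite !le_min => /and3P[hh1 hh2 hh3] vq.
  have Kq : closure [set p | v p != 0] (Phi (s, q)) by exact: subset_closure.
  have /andP[s1 s2] : - N <= s <= N by have [+ _ _] := hN _ Kq; rewrite /= subr0 ler_norml.
  have Dq := D_of vq.
  have qr q' : dist2 q q' < r -> D q' by apply: hr; exists (Phi (s, q)) => //; rewrite projl_Phi.
  have hr' : h * (2 + 4 * N) <= r by rewrite -ler_pdivlMr//; lra.
  have hk : h * (8 * k) <= 1 by rewrite -ler_pdivlMr ?mulr_gt0// mul1r.
  have Dp : D (q.1 - h, q.2 + 4 * s * h).
    apply: qr; rewrite /dist2/= gt_max !ltr_norml; apply/andP; split; apply/andP; split; nra.
  split => //.
  have [] := he q (- h) Dq qr; first by rewrite normrN gtr0_norm//; lra.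
  rewrite sqrrN !mulrN opprK => Dp' up'.
  have := fol_lip fol (q.1 - h, q.2 + 4 * s * h) (q.1 - h, q.2 + 4 * u q * h - 2 * b q * h ^+ 2).
  rewrite (fol_ext fol Dp) (fol_ext fol Dp') up' => /le_trans; apply.
  rewrite /dist2/= subrr normr0 max_r//.
  rewrite (_ : _ - _ = 4 * h * (s - (u q - b q * h)) - 2 * h ^+ 2 * b q); last by ring.
  have bq := fol_b fol q.
  have h2 : 0 <= h ^+ 2 by exact: sqr_ge0.
  apply: (@le_trans _ _ (k * (4 * h * `|s - (u q - b q * h)| + 2 * h ^+ 2 * b0))).
    rewrite ler_wpM2l ?(ltW k0)//.
    apply: (le_trans (ler_normB _ _)); rewrite normrM (_ : `|4 * h| = 4 * h); last by rewrite ger0_norm// mulr_ge0// ltW.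
    rewrite lerD2l normrM (_ : `|2 * h ^+ 2| = 2 * h ^+ 2); last by rewrite ger0_norm// mulr_ge0.
    by rewrite ler_wpM2l// mulr_ge0.
  have : h * (8 * k) * `|s - (u q - b q * h)| <= 1 * `|s - (u q - b q * h)| by rewrite ler_wpM2r.
  by move: `|_| => z hz; lra.
apply: (@divergence_Y _ (DV D) v (Egraph D u) U b (4 * k * b0) h0 b0) => //; first exact: fol_b fol.
have E q (s h : R) : flowY (- h) (Phi (s, q)) = Phi (s, (q.1 - h, q.2 + 4 * s * h)).
  by rewrite /flowY /Phi/=; congr ((_, _), _); ring.
split=> h q s hh vq; have [Dp hp] := close _ _ _ hh vq; have Dq := D_of vq;
  rewrite E EgraphE projl_Phi (fol_ext fol)//=; move: hp; set x := u q - b q * h.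
- set y := u (_, _) => hp hs; split => //; rewrite -/y.
  have sx : 0 <= s - x.
    have : 0 <= 4 * k * b0 * h ^+ 2 by rewrite mulr_ge0// sqr_ge0.
    by lra.
  by move: hp; rewrite (ger0_norm sx) ler_norml => /andP[p1 p2]; lra.
- set y := u (_, _) => hp hs [_]; rewrite -/y => ys.
  have sx : s - x <= 0.
    have : 0 <= 4 * k * b0 * h ^+ 2 by rewrite mulr_ge0// sqr_ge0.
    by lra.
  by move: hp; rewrite (ler0_norm sx) ler_norml => /andP[p1 p2]; lra.
Qed.

End field.
End left_divergence.

(** * The right graph and the potential of the slope *)

Section right_graph.
Variable R : realType.
Variables (D : set (R * R)) (u U b : R * R -> R) (k Mu b0 A : R).
Hypothesis fol : foliation D u U b k Mu b0.
Hypothesis DA : forall q, D q -> `|q.1| <= A /\ `|q.2| <= A.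
Hypothesis Dscale : forall q (a : R), D q -> 0 <= a <= 1 -> D (a * q.1, q.2).
Variables (Dr : set (R * R)) (ur : R * R -> R).
Hypotheses (oDr : open Dr) (urL : loclip2_on Dr ur).
Hypothesis SS : Sgraph D u = Sgraph_r Dr ur.
Implicit Types (q : R * R) (p : R * R * R).

(** Left coordinates of the graph point whose right coordinates are [q]; its height is [ur q]. *)
Definition to_left q : R * R := (q.1, q.2 - 4 * q.1 * ur q).

Lemma left_to_right q : D q -> Dr (q.1, q.2 + 4 * q.1 * u q) /\ ur (q.1, q.2 + 4 * q.1 * u q) = u q.
Proof.
move=> Dq; have : Sgraph_r Dr ur (Phi (u q, q)).
  by rewrite -SS; apply/SgraphE; rewrite projl_Phi.
by move/Sgraph_rE; rewrite projr_Phi.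
Qed.

Lemma right_to_left q : Dr q -> D (to_left q) /\ u (to_left q) = ur q.
Proof.
move=> Dq; have : Sgraph D u ((ur q, q.1), q.2 - 2 * q.1 * ur q).
  by rewrite SS; apply/Sgraph_rE; rewrite projr_right.
move/SgraphE; rewrite /projl/= (_ : q.2 - _ - _ = q.2 - 4 * q.1 * ur q)//; ring.
Qed.

Lemma to_leftK q : D q -> to_left (q.1, q.2 + 4 * q.1 * u q) = q.
Proof.
by case: q => y t /left_to_right[_ /= e]; rewrite /to_left/= e; congr (_, _); ring.
Qed.

Lemma open_dist2 (O : set (R * R)) q : open O -> O q ->
  exists r : R, 0 < r /\ forall q', dist2 q q' < r -> O q'.
Proof.
move=> oO Oq; have /nbhs_ballP[r /= r0 hr] : nbhs q O by exact: open_nbhs_nbhs.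
by exists r; split => // q' qq'; apply: hr; rewrite -dist2_ball.
Qed.

Lemma ur_local q : Dr q -> exists r K : R, [/\ 0 < r, 0 <= K &
  forall q1 q2, dist2 q q1 < r -> dist2 q q2 < r -> Dr q1 /\ `|ur q1 - ur q2| <= K * dist2 q1 q2].
Proof.
move=> Dq; have [r1 [r10 [K hK]]] := urL Dq; have [r2 [r20 hr2]] := open_dist2 oDr Dq.
exists (Num.min r1 r2), `|K|; split => //; first by rewrite lt_min r10.
move=> q1 q2; rewrite !lt_min => /andP[a1 a2] /andP[a3 a4].
have D1 := hr2 _ a2; have D2 := hr2 _ a4; split => //.
apply: (@le_trans _ _ (K * dist2 q1 q2)).
  by apply: hK; split => //=; rewrite dist2C.
by rewrite ler_wpM2r ?dist2_ge0// ler_norm.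
Qed.

Lemma ur_continuous q : Dr q -> {for q, continuous ur}.
Proof.
move=> /ur_local[r [K [r0 K0 h]]]; apply/cvgrPdist_lt => e e0.
have nq : nbhs q [set q' | dist2 q q' < Num.min r (e / (K + 1))].
  by rewrite dist2_ball; apply: nbhsx_ballx; rewrite lt_min r0 divr_gt0//; lra.
apply: filterS nq => q' /=; rewrite lt_min => /andP[qr qe].
have [_ hq] := h q q' (ltac:(by rewrite dist2xx)) qr.
apply: (le_lt_trans hq); move: qe; rewrite ltr_pdivlMr; last by lra.
by have := dist2_ge0 q q'; nra.
Qed.

(* Scaling [y] to [0] deforms the increment of [t + 4 y u] into that of [t]; it cannot
   vanish on the way, since distinct points of the graph have distinct right projections. *)
Lemma to_right_increasing (y t1 t2 : R) : D (y, t1) -> D (y, t2) -> t1 < t2 ->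
  t1 + 4 * y * u (y, t1) < t2 + 4 * y * u (y, t2).
Proof.
move=> D1 D2 t12; rewrite ltNge; apply/negP => H.
(* The extension [U] makes [f] continuous. At a zero [a] of [f] the points [(a * y, t1)] and
   [(a * y, t2)] have the same right projection, hence the same height, and [t1 = t2] follows. *)
pose f (a : R) := t2 - t1 + 4 * (a * y) * (U (a * y, t2) - U (a * y, t1)).
have cU (t : R) : continuous (fun a : R => U (a * y, t)).
  move=> a; apply: (@continuous_comp _ _ _ (fun a : R => (a * y, t)) U); last exact: lip2_continuous (fol_lip fol) _.
  apply: (continuous_pair2 (f := fun a : R => a * y) (g := fun=> t)); last by move=> z; exact: cvg_cst.
  by move=> z; apply: cvgM; [exact: cvg_id|exact: cvg_cst].
have cf : continuous f.
  move=> a; apply: cvgD; first exact: cvg_cst.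
  apply: cvgM; last by apply: cvgB; exact: cU.
  by apply: cvgM; [exact: cvg_cst|apply: cvgM; [exact: cvg_id|exact: cvg_cst]].
have f0 : 0 <= f 0 by rewrite /f !mul0r mulr0 mul0r addr0; lra.
have f1 : f 1 <= 0 by rewrite /f !mul1r !(fol_ext fol)//; lra.
have [a] := @IVT R f 0 1 0 ler01 (continuous_subspaceT cf) (ltac:(by rewrite ge_min f1 orbT le_max f0)).
rewrite in_itv/= => a01 fa.
have D1a := Dscale D1 a01; have D2a := Dscale D2 a01.
move: fa; rewrite /f !(fol_ext fol)//= => fa.
have [_ e1] := left_to_right D1a; have [_ e2] := left_to_right D2a.
move: e1 e2 => /=; rewrite (_ : t1 + _ = t2 + 4 * (a * y) * u (a * y, t2)); last by lra.
by move=> -> e; move: fa; rewrite e subrr mulr0 addr0; lra.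
Qed.

(** Let [t] be the left coordinate of [p] and [t0] that of the graph point on the same right fibre,
    so that [t0 + 4 y u (y, t0) = t + 4 y s]. Since [t + 4 y u (y, t)] increases with [t], the signs
    of [t - t0] and of [y] decide both comparisons of [s] with [u], and always alike. *)
Lemma Egraph_agree p : DV D p -> VD Dr p -> (Egraph D u p <-> Egraph_r Dr ur p).
Proof.
move=> /DVE Dp /VDE Drp; rewrite EgraphE Egraph_rE.
have [] := right_to_left Drp; rewrite /to_left.
move: Dp Drp; case: p => [[s y] tau]; rewrite /projl/projr/=.
set t := tau - 2 * y * s => Dp Drp; set t' := tau + 2 * y * s in Drp *.
set t0 := t' - _ => D0 u0.
have t0E : t0 + 4 * y * u (y, t0) = t + 4 * y * s by rewrite u0 /t0 /t /t'; ring.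
rewrite -u0.
suff H : u (y, t) < s <-> u (y, t0) < s by split=> -[_ us]; split => //; apply/H.
have [tt|tt|<-] := ltgtP t t0; last by [].
- have := to_right_increasing Dp D0 tt.
  rewrite t0E; case: (ltgtP y 0) => [y0|y0|->] m.
  + by split => ? //; exfalso; nra.
  + by split => _; nra.
  + by exfalso; move: m t0E; rewrite !mulr0 !mul0r !addr0 => *; lra.
- have := to_right_increasing D0 Dp tt.
  rewrite t0E; case: (ltgtP y 0) => [y0|y0|->] m.
  + by split => _; nra.
  + by split => ? //; exfalso; nra.
  + by exfalso; move: m t0E; rewrite !mulr0 !mul0r !addr0 => *; lra.
Qed.

Lemma Sgraph_sub : Sgraph D u `<=` DV D `&` VD Dr.
Proof.
move=> p Sp; split; first by apply/DVE; case/SgraphE: Sp.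
by apply/VDE; move: Sp; rewrite SS => /Sgraph_rE[].
Qed.

Lemma Egraph_r_open : open (Egraph_r Dr ur).
Proof.
rewrite (_ : Egraph_r Dr ur = [set p | Dr (projr p) /\ ur (projr p) < p.1.1]); last first.
  by apply/seteqP; split => p /Egraph_rE.
apply: open_lt_graph; [exact: oDr|exact: ur_continuous|exact: continuous_projr].
Qed.

Definition slope_r q := b (to_left q).

(** The point at which the leaf through [q] crosses the axis [y = 0]; left and right coordinates
    coincide there. *)
Definition leaf_label q := q.2 - 2 * slope_r q * q.1 ^+ 2.

Lemma slope_r_toright q : D q -> slope_r (q.1, q.2 + 4 * q.1 * u q) = b q.
Proof. by move=> Dq; rewrite /slope_r to_leftK. Qed.

(** The leaf crosses the axis because [y1 < 0 < y2], and it is also the leaf through its crossing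
    point. *)
Lemma slope_r_label q : Dr q -> D (0, leaf_label q) /\ b (0, leaf_label q) = slope_r q.
Proof.
move=> Dq; have [Dl ul] := right_to_left Dq; have [y1 [y2 lf]] := fol_leaf fol Dl.
have [y0 _ h _ _] := lf; have [D0 _] := h _ y0; have := fol_slope fol (leaf_move lf y0).
have -> : parabola (to_left q) (u (to_left q)) (b (to_left q)) 0 = (0, leaf_label q).
  by rewrite /parabola ul /leaf_label /slope_r/=; congr (_, _); ring.
split => //; move: D0.
have -> // : parabola (to_left q) (u (to_left q)) (b (to_left q)) 0 = (0, leaf_label q).
by rewrite /parabola ul /leaf_label /slope_r/=; congr (_, _); ring.
Qed.

Let B0 : 0 <= b0. Proof. exact: le_trans (normr_ge0 _) (fol_b fol (0, 0)). Qed.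

Lemma Dr_y q : Dr q -> `|q.1| <= A.
Proof. by move=> /right_to_left[/DA[]]. Qed.

Let A0 q : D q -> 0 <= A. Proof. by move=> /DA[/(le_trans (normr_ge0 _))]. Qed.

(** [slope_r] is [b] read through [to_left], which is locally Lipschitz because [ur] is; [L]
    collects the bounds for [t - 4 y ur]. *)
Lemma slope_r_local q : Dr q -> exists r C : R, [/\ 0 < r, 0 <= C &
  forall q1 q2, dist2 q q1 < r -> dist2 q q2 < r ->
    Dr q1 /\ `|slope_r q1 - slope_r q2| <= C * dist2 q1 q2].
Proof.
move=> Dq; have [r1 [K [r10 K0 hK]]] := ur_local Dq.
have [Dl ul] := right_to_left Dq; have A_ge0 := A0 Dl.
have M0 : 0 <= Mu by exact: le_trans (normr_ge0 _) (fol_u fol Dl).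
have [r2 [r20 hr2]] := fol_open fol Dl.
have r22 : 0 < r2 / 2 by rewrite divr_gt0.
have [C [C0 hC]] := fol_blip fol r22.
pose L := 1 + 4 * A * K + 4 * Mu.
have L1 : 1 <= L by rewrite /L; have := mulr_ge0 A_ge0 K0; lra.
have toL q1 q2 : dist2 q q1 < r1 -> dist2 q q2 < r1 -> dist2 (to_left q1) (to_left q2) <= L * dist2 q1 q2.
  move=> h1 h2; have [D1 h] := hK _ _ h1 h2; have [D2 _] := hK _ _ h2 h2.
  have y1 := Dr_y D1; have [Dl2 ul2] := right_to_left D2.
  have u2 : `|ur q2| <= Mu by rewrite -ul2; exact: (fol_u fol).
  have d0 := dist2_ge0 q1 q2.
  have e1 : `|q1.1 - q2.1| <= dist2 q1 q2 by rewrite le_max lexx.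
  have e2 : `|q1.2 - q2.2| <= dist2 q1 q2 by rewrite le_max lexx orbT.
  rewrite [X in X <= _]/dist2 /to_left/= ge_max; apply/andP; split.
    by apply: (le_trans e1); rewrite ler_peMl.
  rewrite (_ : _ - _ - (_ - _) = (q1.2 - q2.2) - 4 * (q1.1 * (ur q1 - ur q2) + (q1.1 - q2.1) * ur q2)); last by ring.
  apply: (le_trans (ler_normB _ _)); rewrite normrM (ger0_norm (ler0n _ _)).
  have := ler_normD (q1.1 * (ur q1 - ur q2)) ((q1.1 - q2.1) * ur q2); rewrite !normrM.
  have : `|q1.1| * `|ur q1 - ur q2| <= A * (K * dist2 q1 q2) by rewrite ler_pM.
  have : `|q1.1 - q2.1| * `|ur q2| <= dist2 q1 q2 * Mu by rewrite ler_pM.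
  by rewrite /L; move: (`|_ + _ * ur q2|) => z *; lra.
exists (Num.min r1 (r2 / 2 / L)), (C * L); split.
- by rewrite lt_min r10 divr_gt0//; lra.
- by rewrite mulr_ge0//; lra.
have near q1 : dist2 q q1 < r1 -> dist2 q q1 < r2 / 2 / L ->
    D (to_left q1) /\ forall q', dist2 (to_left q1) q' < r2 / 2 -> D q'.
  move=> h1 h2; have hd : dist2 (to_left q) (to_left q1) < r2 / 2.
    apply: (le_lt_trans (toL q q1 _ h1)); first by rewrite dist2xx.
    by rewrite mulrC -ltr_pdivlMr//; lra.
  split; first by apply: hr2; apply: lt_trans hd _; lra.
  by move=> p hp; apply: hr2; have := dist2_triangle (to_left q) (to_left q1) p; lra.
move=> q1 q2; rewrite !lt_min => /andP[a1 a2] /andP[a3 a4].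
split; first by have [] := hK _ _ a1 a1.
have [n1 m1] := near _ a1 a2; have [n2 m2] := near _ a3 a4.
apply: (le_trans (hC _ _ n1 n2 m1 m2)); rewrite -mulrA ler_wpM2l//.
exact: toL.
Qed.

(* A primitive of the slope along the axis [y = 0], which every leaf crosses. *)
Lemma axis_primitive : exists Psi0 : R -> R, forall c, D (0, c) -> is_derive c 1 Psi0 (b (0, c)).
Proof.
pose f (c : R) := b (0, c).
have mf : measurable_fun setT f.
  exact: (measurable_fun_pair2 (0 : R) (fol_slope_measurable fol)).
have cf (c : R) : D (0, c) -> {for c, continuous f}.
  move=> Dc; apply: (@continuous_comp _ _ _ (fun c : R => (0 : R, c)) b); last exact: (fol_slope_continuous fol).
  by apply: (continuous_pair2 (f := fun=> 0 : R) (g := id)) => z; [exact: cvg_cst|exact: cvg_id].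
(* The lower limit lies below the trace of [D] on the axis; the slope is bounded and measurable
   there, hence integrable from [a]. *)
pose a := - A - 1.
exists (fun c => (\int[@lebesgue_measure R]_(t in `[a, c]) f t)%R) => c Dc.
have [_ cA] := DA Dc; have ac : a < c by move: cA; rewrite /= ler_norml => /andP[? _]; rewrite /a; lra.
have If : (@lebesgue_measure R).-integrable `[a, c + 1] (EFin \o f).
  apply: measurable_bounded_integrable.
  - exact: measurable_itv.
  - exact: lebesgue_itv_lty.
  - exact: measurable_funTS.
  - exists b0; split; first exact: num_real.
    by move=> M bM x _; apply: (le_trans (fol_b fol _)); exact: ltW.
have cc1 : c < c + 1 by rewrite ltrDl.
have [d1 d2] := continuous_FTC1_closed cc1 If ac (cf _ Dc).
by apply: DeriveDef => //; rewrite -derive1E.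
Qed.

(** With [t = c + 2 b y^2] the form [b dt - 2 y b^2 dy] equals [b dc + d (y^2 b^2)], so a primitive
    of [b] in the label plus [y^2 b^2] is a potential. To avoid derivatives of [b], this is stated
    as a first-order expansion with quadratic remainder. *)
Lemma potential_local (Psi0 : R -> R) : (forall c, D (0, c) -> is_derive c 1 Psi0 (b (0, c))) ->
  let psi q := Psi0 (leaf_label q) + q.1 ^+ 2 * slope_r q ^+ 2 in
  forall q, Dr q -> exists r C : R, [/\ 0 < r, 0 <= C & forall q1 q2, dist2 q q1 < r -> dist2 q q2 < r ->
    [/\ Dr q1, `|slope_r q1 - slope_r q2| <= C * dist2 q1 q2 &
      `|psi q2 - psi q1 - slope_r q1 * (q2.2 - q1.2) + 2 * q1.1 * slope_r q1 ^+ 2 * (q2.1 - q1.1)|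
        <= C * dist2 q1 q2 ^+ 2]].
Proof.
move=> dPsi psi q Dq; have [r1 [C1 [r10 C10 h1]]] := slope_r_local Dq.
have [Dl bl] := slope_r_label Dq; have A_ge0 := A0 Dl.
have [r2 [r20 hr2]] := fol_open fol Dl.
have r22 : 0 < r2 / 2 by rewrite divr_gt0.
have [C2 [C20 hC2]] := fol_blip fol r22.
pose L := 1 + 2 * C1 * A ^+ 2 + 4 * b0 * A.
have L0 : 1 <= L.
  have p1 : 0 <= C1 * A ^+ 2 by rewrite mulr_ge0// sqr_ge0.
  have p2 : 0 <= b0 * A by rewrite mulr_ge0.
  by rewrite /L; lra.
have labL q1 q2 : dist2 q q1 < r1 -> dist2 q q2 < r1 ->
    `|leaf_label q1 - leaf_label q2| <= L * dist2 q1 q2.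
  move=> a1 a2; have [D1 bb] := h1 _ _ a1 a2; have [D2 _] := h1 _ _ a2 a1.
  have y1 := Dr_y D1; have y2 := Dr_y D2.
  have e1 : `|q1.1 - q2.1| <= dist2 q1 q2 by rewrite le_max lexx.
  have e2 : `|q1.2 - q2.2| <= dist2 q1 q2 by rewrite le_max lexx orbT.
  have d0 := dist2_ge0 q1 q2.
  rewrite /leaf_label (_ : _ - _ - (_ - _) = (q1.2 - q2.2) - 2 * ((slope_r q1 - slope_r q2) * q1.1 ^+ 2
    + slope_r q2 * ((q1.1 + q2.1) * (q1.1 - q2.1)))); last by ring.
  apply: (le_trans (ler_normB _ _)); rewrite normrM (ger0_norm (ler0n _ _)).
  have := ler_normD ((slope_r q1 - slope_r q2) * q1.1 ^+ 2) (slope_r q2 * ((q1.1 + q2.1) * (q1.1 - q2.1))).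
  rewrite normrM (normrM (slope_r q2)) (normrM (q1.1 + q2.1)) normrX.
  have : `|slope_r q1 - slope_r q2| * `|q1.1| ^+ 2 <= C1 * dist2 q1 q2 * A ^+ 2.
    by rewrite ler_pM ?sqr_ge0// !expr2 ler_pM.
  have : `|slope_r q2| * (`|q1.1 + q2.1| * `|q1.1 - q2.1|) <= b0 * ((2 * A) * dist2 q1 q2).
    rewrite ler_pM ?mulr_ge0//; first exact: (fol_b fol).
    by rewrite ler_pM//; have := ler_normD q1.1 q2.1; lra.
  by rewrite /L; move: (`|_ + slope_r q2 * _|) => z *; lra.
exists (Num.min r1 (r2 / 2 / L)), (C1 + C2 * L ^+ 2 + A ^+ 2 * C1 ^+ 2 + b0 ^+ 2).
have K1 : 0 <= C2 * L ^+ 2 by rewrite mulr_ge0// sqr_ge0.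
have K2 : 0 <= A ^+ 2 * C1 ^+ 2 by rewrite mulr_ge0// sqr_ge0.
have K3 : 0 <= b0 ^+ 2 by rewrite sqr_ge0.
split; [by rewrite lt_min r10 divr_gt0//; lra|by rewrite !addr_ge0|].
move=> q1 q2; rewrite !lt_min => /andP[a1 a2] /andP[a3 a4].
have [D1 bb] := h1 _ _ a1 a3; have [D2 _] := h1 _ _ a3 a1.
have d0 := dist2_ge0 q1 q2.
have y2 := Dr_y D2.
split => //.
  by apply: (le_trans bb); rewrite ler_wpM2r//; lra.
have [Dl1 bl1] := slope_r_label D1; have [Dl2 bl2] := slope_r_label D2.
have near q' : dist2 q q' < r1 -> dist2 q q' < r2 / 2 / L -> `|leaf_label q - leaf_label q'| < r2 / 2.
  move=> n1 n2; apply: (le_lt_trans (labL q q' (ltac:(by rewrite dist2xx)) n1)).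
  by rewrite mulrC -ltr_pdivlMr//; lra.
have n1 := near _ a1 a2; have n2 := near _ a3 a4.
set c1 := leaf_label q1 in Dl1 bl1 n1; set c2 := leaf_label q2 in Dl2 bl2 n2.
have btw (z : R) : Num.min c1 c2 <= z <= Num.max c1 c2 ->
    `|leaf_label q - z| < r2 / 2 /\ `|c1 - z| <= `|c2 - c1|.
  move: n1 n2; rewrite !ltr_norml => /andP[n11 n12] /andP[n21 n22].
  have [c12|c12] := leP c1 c2 => /andP[z1 z2].
    by rewrite (@ler0_norm _ (c1 - z)) ?(@ger0_norm _ (c2 - c1)); [split; [apply/andP; split|]|..]; lra.
  by rewrite (@ger0_norm _ (c1 - z)) ?(@ler0_norm _ (c2 - c1)); [split; [apply/andP; split|]|..]; lra.
have Dz (z : R) : `|leaf_label q - z| < r2 / 2 -> D (0, z) /\ forall q', dist2 (0, z) q' < r2 / 2 -> D q'.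
  move=> hz; have dz : dist2 (0, leaf_label q) (0, z) < r2 / 2 by rewrite /dist2/= subrr normr0 gt_max r22.
  split; first by apply: hr2; apply: lt_trans dz _; lra.
  by move=> p hp; apply: hr2; have := dist2_triangle (0, leaf_label q) (0, z) p; lra.
have P : `|Psi0 c2 - Psi0 c1 - slope_r q1 * (c2 - c1)| <= C2 * `|c2 - c1| * `|c2 - c1|.
  apply: (@mvt_bound R Psi0 (fun z => b (0, z))) => z /btw[z1 z2].
    by apply: dPsi; have [] := Dz _ z1.
  have [w1 w2] := Dz _ z1; have [w3 w4] := Dz _ n1.
  rewrite -bl1; apply: (le_trans (hC2 _ _ w1 w3 w2 w4)); rewrite ler_wpM2l//.
  by rewrite /dist2/= subrr normr0 max_r// distrC.
have lab := labL _ _ a1 a3; rewrite -/c1 -/c2 distrC in lab.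
have e1 : `|q2.1 - q1.1| <= dist2 q1 q2 by rewrite distrC le_max lexx.
rewrite /psi -/c1 -/c2.
have E1 : q1.2 = c1 + 2 * slope_r q1 * q1.1 ^+ 2 by rewrite /c1 /leaf_label; ring.
have E2 : q2.2 = c2 + 2 * slope_r q2 * q2.1 ^+ 2 by rewrite /c2 /leaf_label; ring.
(* The terms linear in the increment of the slope cancel. What remains is the remainder of [Psi0],
   of order [(c2 - c1) ^+ 2], and the squares of the increments of slope and [y], so Lipschitz
   bounds suffice. *)
rewrite E1 E2 (_ : _ - _ - _ + _ = (Psi0 c2 - Psi0 c1 - slope_r q1 * (c2 - c1)) +
   q2.1 ^+ 2 * (slope_r q1 - slope_r q2) ^+ 2 - slope_r q1 ^+ 2 * (q2.1 - q1.1) ^+ 2); last by ring.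
apply: (le_trans (ler_normB _ _)); rewrite (le_trans (lerD (ler_normD _ _) (lexx _)))//.
rewrite (normrM (q2.1 ^+ 2)) (normrM (slope_r q1 ^+ 2)) !normrX.
have sq (x y : R) : 0 <= x -> x <= y -> x ^+ 2 <= y ^+ 2 by move=> x0 xy; rewrite !expr2 ler_pM.
have t1 : C2 * `|c2 - c1| * `|c2 - c1| <= C2 * (L ^+ 2 * dist2 q1 q2 ^+ 2).
  by rewrite -mulrA -exprMn ler_wpM2l// -expr2 sq.
have t2 : `|q2.1| ^+ 2 * `|slope_r q1 - slope_r q2| ^+ 2 <= A ^+ 2 * (C1 ^+ 2 * dist2 q1 q2 ^+ 2).
  by rewrite -[C1 ^+ 2 * _]exprMn ler_pM ?sqr_ge0// ?sq.
have t3 : `|slope_r q1| ^+ 2 * `|q2.1 - q1.1| ^+ 2 <= b0 ^+ 2 * dist2 q1 q2 ^+ 2.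
  by rewrite ler_pM ?sqr_ge0// sq//; exact: (fol_b fol).
have t4 : 0 <= C1 * dist2 q1 q2 ^+ 2 by rewrite mulr_ge0// sqr_ge0.
by have := le_trans P t1; lra.
Qed.

End right_graph.

(** * The divergence formula for the right graph *)

Section right_divergence.
Variable R : realType.
Local Notation H := (R * R * R)%type.
Local Notation leb2 := (@leb2 R).
Local Notation leb3 := (@leb3 R).
Implicit Types (v w : H -> R) (p : H).

Lemma grad_near_eq v w p : C1 w -> (\forall p' \near p, v p' = w p') ->
  [/\ dx v p = dx w p, dy v p = dy w p & dt v p = dt w p].
Proof.
move=> w1 vw; apply: has_grad_dE; apply: (@has_grad_near_eq _ w).
  by apply: filterS vw => q ->.
exact: C1_has_grad.
Qed.

Lemma XYf_near_eq v w p : C1 w -> (\forall p' \near p, v p' = w p') ->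
  Xf v p = Xf w p /\ Yf v p = Yf w p.
Proof. by move=> w1 /(grad_near_eq w1)[hx hy ht]; rewrite /Xf /Yf hx hy ht. Qed.

Lemma XYf_near0 v p : (\forall p' \near p, v p' = 0) -> Xf v p = 0 /\ Yf v p = 0.
Proof. by move=> /near_cst_grad[hx hy ht]; rewrite /Xf /Yf hx hy ht !mulr0 addr0 subr0. Qed.

Lemma XYfD v w p : C1 v -> C1 w ->
  Xf (fun p => v p + w p) p = Xf v p + Xf w p /\ Yf (fun p => v p + w p) p = Yf v p + Yf w p.
Proof.
move=> v1 w1; have := has_gradD (C1_has_grad p v1) (C1_has_grad p w1).
by move=> /has_grad_dE[hx hy ht]; rewrite /Xf /Yf hx hy ht; split; ring.
Qed.

Lemma C1c_XYf_integrable O v : C1c O v ->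
  leb3.-integrable setT (EFin \o Xf v) /\ leb3.-integrable setT (EFin \o Yf v).
Proof.
move=> vO; have [M [N [M0 N0 hM hN]]] := C1c_bounds vO; have [v1 _] := vO.
have nB p : ~ box ((0, 0), 0) N p -> Xf v p = 0 /\ Yf v p = 0.
  move=> nB; apply: XYf_near0; apply: notin_support_near => /hN; exact.
split; apply: (@fs_integrable _ _ _ leb3 _ (box ((0, 0), 0) N) M).
- exact: continuous_measurable_fun_R3 (C1_Xf_continuous v1).
- exact: measurable_box.
- exact: leb3_box_lty.
- by move=> p; have [] := hM p.
- by move=> p /nB[].
- exact: continuous_measurable_fun_R3 (C1_Yf_continuous v1).
- exact: measurable_box.
- exact: leb3_box_lty.
- by move=> p; have [] := hM p.
- by move=> p /nB[].
Qed.

Variables (D : set (R * R)) (u U b : R * R -> R) (k Mu b0 A : R).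
Hypothesis fol : foliation D u U b k Mu b0.
Hypothesis DA : forall q, D q -> `|q.1| <= A /\ `|q.2| <= A.
Hypothesis Dscale : forall q (a : R), D q -> 0 <= a <= 1 -> D (a * q.1, q.2).
Variables (Dr : set (R * R)) (ur : R * R -> R).
Hypotheses (oDr : open Dr) (urL : loclip2_on Dr ur).
Hypothesis SS : Sgraph D u = Sgraph_r Dr ur.

Let O := DV D `&` VD Dr.

Lemma open_common : open O.
Proof.
apply: openI; [apply: open_DV; exact: (fol_domain_open fol)|exact: open_VD].
Qed.

Lemma right_height_continuous p : VD Dr p -> {for p, continuous (fun p => p.1.1 - ur (projr p))}.
Proof.
move=> /VDE Dp; apply: cvgB; first exact: continuous_x3.
apply: (@continuous_comp _ _ _ (@projr R) ur); first exact: continuous_projr.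
exact: (ur_continuous oDr urL).
Qed.

(** Inside the right cylinder, where [K] stays, the graph is the zero set of the continuous function
    [p.1.1 - ur (projr p)]. *)
Lemma graph_compact (K : set H) : compact K -> K `<=` VD Dr -> compact (K `&` Sgraph D u).
Proof.
move=> cK KV; apply: (subclosed_compact _ cK); last by move=> ? [].
have clK := compact_closed (@R3_hausdorff R) cK.
rewrite -openC openE => p /= np.
have [Kp|nKp] := pselect (K p); last first.
  have oK : open (~` K) by rewrite openC.
  by apply: filterS (open_nbhs_nbhs (conj oK nKp)) => p' nK [].
have h0 : p.1.1 - ur (projr p) != 0.
  apply/eqP => h0; apply: np; split => //; rewrite SS; apply/Sgraph_rE; split.
    by apply/VDE; exact: KV.
  by apply/esym/eqP; rewrite -subr_eq0; apply/eqP.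
have := right_height_continuous (KV _ Kp) => ch.
have : \forall p' \near p, p'.1.1 - ur (projr p') != 0.
  exact: (cvgr_neq0 _ ch h0).
apply: filterS => p' np' [_ Sp']; move: Sp'; rewrite SS => /Sgraph_rE[_ e].
by move: np'; rewrite e subrr eqxx.
Qed.

Section right_field.
Variable v : H -> R.
Hypothesis vV : C1c (VD Dr) v.

Let K := closure [set p | v p != 0].

(** [chi] is 1 near the part of the graph in the support of [v]. The field [w1 = chi * v] lives
    where the cylinders overlap, so that [Egraph_agree] applies to it. The rest vanishes near the
    graph, which is the boundary of [Egraph_r] within the cylinder; it stays C^1 when multiplied by
    the indicator of [Egraph_r]. *)
Lemma right_field_split : exists w1 w2 : H -> R, [/\ C1c O w1, C1c (VD Dr) w2,
  forall p, Egraph_r Dr ur p -> Xf v p = Xf w1 p + Xf w2 p /\ Yf v p = Yf w1 p + Yf w2 p,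
  forall p, ~ Egraph_r Dr ur p -> Xf w2 p = 0 /\ Yf w2 p = 0 &
  forall q, D q -> w1 (Phi (u q, q)) = v (Phi (u q, q))].
Proof.
have [v1 [cK KV]] := vV; rewrite -/K in cK KV.
have cS := graph_compact cK KV.
have SO : K `&` Sgraph D u `<=` O by move=> p [_ /(Sgraph_sub SS)].
have [chi [[chi1 chiO] chi01 chiS]] := cutoff cS open_common SO.
pose w1 p := chi p * v p.
pose vc p := (1 - chi p) * v p.
pose w2 p : R := \1_(Egraph_r Dr ur) p * vc p.
have C1w1 : C1 w1 by apply: C1at_C1 => p; apply: C1atM; exact: C1_C1at.
have C1vc : C1 vc.
  apply: C1at_C1 => p; apply: C1atM; last exact: C1_C1at.
  have -> : (fun p => 1 - chi p) = (fun p => 1 + (-1) * chi p) by apply/funext => p'; ring.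
  by apply: C1atD; [exact: C1at_cst|apply: C1atM; [exact: C1at_cst|exact: C1_C1at]].
have oE := Egraph_r_open oDr urL.
have nearE p : Egraph_r Dr ur p -> \forall p' \near p, w2 p' = vc p'.
  move=> Ep; have := open_nbhs_nbhs (conj oE Ep); apply: filterS => p' Ep'.
  by rewrite /w2 indicE mem_set// mul1r.
have nearN p : ~ Egraph_r Dr ur p -> \forall p' \near p, w2 p' = 0.
  move=> nE; have [Kp|nKp] := pselect (K p); last first.
    by have := notin_support_near nKp; apply: filterS => p' vp'; rewrite /w2 /vc vp' !mulr0.
  have [Sp|nSp] := pselect (Sgraph D u p).
    by have := chiS p (conj Kp Sp); apply: filterS => p' cp'; rewrite /w2 /vc cp' subrr mul0r mulr0.
  have Vp := KV _ Kp; have /VDE Dp := Vp.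
  have h0 : p.1.1 - ur (projr p) < 0.
    rewrite subr_lt0 lt_neqAle; apply/andP; split.
      by apply/eqP => e; apply: nSp; rewrite SS; apply/Sgraph_rE.
    by rewrite leNgt; apply/negP => l; apply: nE; apply/Egraph_rE.
  have hl : \forall p' \near p, p'.1.1 - ur (projr p') < 0.
    by apply: (cvgr_lt _ (right_height_continuous Vp)).
  move: hl.
  apply: filterS => p' np'; rewrite /w2 indicE memNset ?mul0r// => /Egraph_rE[_].
  by move: np'; rewrite subr_lt0 ltNge => /negP + /ltW.
have C1w2 : C1 w2.
  apply: C1at_C1 => p; have [Ep|nE] := pselect (Egraph_r Dr ur p).
    apply: (C1at_near_eq _ (C1_C1at p C1vc)).
    by apply: filterS (nearE _ Ep) => p' ->.
  apply: (C1at_near_eq _ (C1at_cst 0 p)).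
  by apply: filterS (nearN _ nE) => p' ->.
exists w1, w2; split.
- split => //; apply: cpt_in_subset chiO => p /=; apply: contraNneq => c0.
  by rewrite /w1 c0 mul0r.
- split => //; have [_ vK] := vV; apply: cpt_in_subset vK => p /=; apply: contraNneq => c0.
  by rewrite /w2 /vc c0 !mulr0.
- move=> p /nearE Ep; have [ex ey] := XYf_near_eq C1vc Ep.
  have [hx hy] := XYfD p C1w1 C1vc.
  have -> : v = fun p => w1 p + vc p by apply/funext => p'; rewrite /w1 /vc; ring.
  by rewrite hx hy ex ey.
- by move=> p /nearN; exact: XYf_near0.
- move=> q Dq; have [vq|vq] := eqVneq (v (Phi (u q, q))) 0; first by rewrite /w1 vq mulr0.
  have Kq : K (Phi (u q, q)) by exact: subset_closure.
  have Sq : Sgraph D u (Phi (u q, q)) by apply/SgraphE; rewrite projl_Phi.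
  by rewrite /w1 (nbhs_singleton (chiS _ (conj Kq Sq))) mul1r.
Qed.

Let mE := open_measurable_R3 (Egraph_r_open oDr urL).
Let mEu := open_measurable_R3 (Egraph_open fol).

(** [Z] is [Xf] or [Yf]. The integral of [Z w2] is one over the whole space and vanishes; that of
    [Z w1] may be taken over the left epigraph, where the left formula applies. *)
Let transfer (Z : (H -> R) -> H -> R) (a : R * R -> R) :
  (forall O' v, C1c O' v -> leb3.-integrable setT (EFin \o Z v)) ->
  (forall O' v, C1c O' v -> (\int[leb3]_p (Z v p)%:E)%E = 0%E) ->
  (forall v p, (\forall p' \near p, v p' = 0) -> Z v p = 0) ->
  (forall v, C1c (DV D) v -> (\int[leb3]_(p in Egraph D u) (Z v p)%:E)%E =
     (\int[leb2]_q (a q * v (Phi (U q, q))))%R%:E) ->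
  (forall q, ~ D q -> a q = 0) ->
  (exists w1 w2 : H -> R, [/\ C1c O w1, C1c (VD Dr) w2,
    forall p, Egraph_r Dr ur p -> Z v p = Z w1 p + Z w2 p,
    forall p, ~ Egraph_r Dr ur p -> Z w2 p = 0 &
    forall q, D q -> w1 (Phi (u q, q)) = v (Phi (u q, q))]) ->
  (\int[leb3]_(p in Egraph_r Dr ur) (Z v p)%:E)%E =
  (\int[leb2]_q (a q * v (Phi (U q, q))))%R%:E.
Proof.
move=> IZ Z0 Zloc ZD a0 [w1 [w2 [w1O w2V ZE ZN wv]]].
have w1D : C1c (DV D) w1.
  have [h1 [h2 h3]] := w1O; split => //; split => //.
  by apply: subset_trans h3 _ => p [].
have I1 : leb3.-integrable (Egraph_r Dr ur) (EFin \o Z w1).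
  exact: (@integrableS _ _ _ leb3 setT _ _ measurableT mE (@subsetT _ _) (IZ _ _ w1O)).
have I2 : leb3.-integrable (Egraph_r Dr ur) (EFin \o Z w2).
  exact: (@integrableS _ _ _ leb3 setT _ _ measurableT mE (@subsetT _ _) (IZ _ _ w2V)).
transitivity (\int[leb3]_(p in Egraph_r Dr ur) ((Z w1 p)%:E + (Z w2 p)%:E))%E.
  by apply: eq_integral => p /set_mem Ep; rewrite (ZE _ Ep).
rewrite (@integralD _ _ _ leb3 (Egraph_r Dr ur) mE (fun p => (Z w1 p)%:E) (fun p => (Z w2 p)%:E) I1 I2).
have -> : (\int[leb3]_(p in Egraph_r Dr ur) (Z w2 p)%:E)%E = 0%E.
  rewrite -(Z0 _ _ w2V) integral_mkcond; apply: eq_integral => p _.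
  by rewrite patchE; case: ifPn => // /negP nE; rewrite ZN// => Ep; apply: nE; exact: mem_set.
rewrite adde0.
transitivity (\int[leb3]_(p in Egraph D u) (Z w1 p)%:E)%E.
  rewrite integral_mkcond [RHS]integral_mkcond; apply: eq_integral => p _; rewrite !patchE.
  have [Op|nO] := pselect (O p).
    have [Dp Vp] := Op; have [e1 e2] := Egraph_agree fol Dscale SS Dp Vp.
    case: ifPn => [/set_mem Er|/negP nEr]; first by rewrite mem_set//; exact: e2.
    by rewrite memNset// => /e1 /mem_set.
  rewrite (_ : Z w1 p = 0) ?if_same//; apply: Zloc; apply: notin_support_near => cp; apply: nO.
  by have [_ [_]] := w1O; apply.
rewrite (ZD _ w1D) /Rintegral; congr ((fine _)%:E).
apply: eq_integral => q _; congr (_%:E).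
have [Dq|nD] := pselect (D q); last by rewrite a0// !mul0r.
by rewrite (fol_ext fol)// wv.
Qed.

Lemma right_divergence_X : (\int[leb3]_(p in Egraph_r Dr ur) (Xf v p)%:E)%E =
  (\int[leb2]_q (- \1_D q * v (Phi (U q, q))))%R%:E.
Proof.
apply: transfer.
- by move=> O' w /C1c_XYf_integrable[].
- by move=> O' w /C1c_integral0[].
- by move=> w p /XYf_near0[].
- by move=> w wD; rewrite (left_divergence_X fol wD).
- by move=> q nD; rewrite indicE memNset// oppr0.
- have [w1 [w2 [h1 h2 h3 h4 h5]]] := right_field_split.
  by exists w1, w2; split => // p; [move=> /h3[]|move=> /h4[]].
Qed.

Lemma right_divergence_Y : (\int[leb3]_(p in Egraph_r Dr ur) (Yf v p)%:E)%E =
  (\int[leb2]_q (b q * v (Phi (U q, q))))%R%:E.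
Proof.
apply: transfer.
- by move=> O' w /C1c_XYf_integrable[].
- by move=> O' w /C1c_integral0[].
- by move=> w p /XYf_near0[].
- by move=> w wD; rewrite (left_divergence_Y fol wD).
- exact: (fol_out fol).
- have [w1 [w2 [h1 h2 h3 h4 h5]]] := right_field_split.
  by exists w1, w2; split => // p; [move=> /h3[]|move=> /h4[]].
Qed.

End right_field.
End right_divergence.

(** * Approximate calibrations *)

Section unit_normal.
Variable R : realType.
Implicit Types z : R.

Definition hypot z : R := Num.sqrt (1 + z ^+ 2).

Let pos z : 0 < 1 + z ^+ 2. Proof. by have := sqr_ge0 z; lra. Qed.

Lemma hypot_sqr z : hypot z ^+ 2 = 1 + z ^+ 2. Proof. by rewrite sqr_sqrtr// ltW. Qed.

Lemma hypot_ge1 z : 1 <= hypot z.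
Proof. by rewrite -[X in X <= _]sqrtr1 ler_sqrt; [rewrite lerDl sqr_ge0|exact: ltW]. Qed.

Lemma hypot_gt0 z : 0 < hypot z. Proof. exact: lt_le_trans ltr01 (hypot_ge1 z). Qed.

Lemma norm_le_hypot z : `|z| <= hypot z.
Proof. by rewrite -sqrtr_sqr ler_sqrt; [rewrite lerDr|exact: ltW]. Qed.

Lemma hypot_le z : hypot z <= 1 + `|z|.
Proof.
rewrite -[X in _ <= X]ger0_norm; last by rewrite addr_ge0.
rewrite -sqrtr_sqr ler_sqrt ?sqr_ge0// sqrrD expr1n mul1r real_normK ?num_real//.
by have := normr_ge0 z; lra.
Qed.

Lemma is_derive_hypot z : is_derive z 1 hypot (z / hypot z).
Proof.
have D1 : is_derive z 1 (fun z => 1 + z * z) (0 + (1 * z + z * 1)).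
  by apply: is_derive_add; apply: is_derive_mul.
have D2 := @is_derive1_sqrt R (1 + z * z) (pos z).
have := @is_derive_chain R Num.sqrt (fun z : R => 1 + z * z) z _ _ D2 D1.
apply: is_derive_eqf => //; rewrite /hypot expr2.
have : Num.sqrt (1 + z * z) != 0 by rewrite gt_eqF// sqrtr_gt0; exact: pos.
by move=> h; field.
Qed.

Lemma continuous_hypot : continuous hypot.
Proof. by move=> z; exact: is_derive_continuous (is_derive_hypot z). Qed.

Definition nu1 z := - (hypot z)^-1.
Definition nu2 z := z / hypot z.

Let hypot_neq0 z : hypot z != 0. Proof. by rewrite gt_eqF// hypot_gt0. Qed.

Lemma is_derive_nu1 z : is_derive z 1 nu1 (z / hypot z ^+ 3).
Proof.
have D := is_deriveV (hypot_neq0 z) (is_derive_hypot z).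
have := is_derive_mul (is_derive_cst (-1 : R) z 1) D; apply: is_derive_eqf => [x|].
  by rewrite mulN1r.
rewrite mul0r add0r mulN1r scaleNr opprK /GRing.scale/=.
by have h := hypot_neq0 z; field.
Qed.

Lemma is_derive_nu2 z : is_derive z 1 nu2 (hypot z ^+ 3)^-1.
Proof.
have D := is_deriveV (hypot_neq0 z) (is_derive_hypot z).
have := is_derive_mul (is_derive_id z 1) D; apply: is_derive_eqf => //.
rewrite scaleNr /GRing.scale/= mul1r; have h := hypot_neq0 z.
transitivity ((hypot z ^+ 2 - z ^+ 2) / hypot z ^+ 3); first by field.
by rewrite hypot_sqr addrK mul1r.
Qed.

Let continuous_cube : continuous (fun z => (hypot z ^+ 3)^-1).
Proof.
have -> : (fun z => (hypot z ^+ 3)^-1) = (fun z => (hypot z * (hypot z * hypot z))^-1) by [].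
move=> z; apply: cvgV; first by rewrite !mulf_neq0.
by apply: cvgM; [|apply: cvgM]; exact: continuous_hypot.
Qed.

Lemma C1at_nu1 (v : R * R * R -> R) p : C1at v p -> C1at (fun p => nu1 (v p)) p.
Proof.
apply: C1at_comp; first exact: is_derive_nu1.
by move=> z; apply: cvgM; [exact: cvg_id|exact: continuous_cube].
Qed.

Lemma C1at_nu2 (v : R * R * R -> R) p : C1at v p -> C1at (fun p => nu2 (v p)) p.
Proof. by apply: C1at_comp; [exact: is_derive_nu2|exact: continuous_cube]. Qed.

Lemma nu_unit z : nu1 z ^+ 2 + nu2 z ^+ 2 = 1.
Proof.
rewrite /nu1 /nu2; have h := hypot_neq0 z; have E := hypot_sqr z.
transitivity ((1 + z ^+ 2) / hypot z ^+ 2); first by field.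
by rewrite E divff// gt_eqF.
Qed.

Lemma hypot_cube_itv z : 0 <= (hypot z ^+ 3)^-1 <= 1.
Proof.
have h1 : 1 <= hypot z ^+ 3 by rewrite exprn_ege1// hypot_ge1.
by rewrite invr_ge0 invf_le1 ?h1 ?(lt_le_trans ltr01 h1)// andbT (le_trans ler01 h1).
Qed.

(** The right side is the tangent line of [hypot] at [z], evaluated at [x]. Both [hypot] and this
    line are 1-Lipschitz, and each contributes one [|x - z|]. *)
Lemma nu_dot_ge (x z : R) : hypot x - 2 * `|x - z| <= - nu1 z + x * nu2 z.
Proof.
have h0 := hypot_gt0 z; have zh := norm_le_hypot z; have E := hypot_sqr z.
have xz0 := normr_ge0 (x - z).
have t1 : hypot x <= hypot z + `|x - z|.
  have -> : hypot z + `|x - z| = `|hypot z + `|x - z| | by rewrite [RHS]ger0_norm// addr_ge0// ltW.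
  rewrite -sqrtr_sqr ler_sqrt ?sqr_ge0// sqrrD E real_normK ?num_real//.
  have : z * (x - z) <= hypot z * `|x - z|.
    by rewrite (le_trans (ler_norm _))// normrM ler_wpM2r.
  by rewrite mulr2n !expr2 => ?; lra.
have t2 : - nu1 z + x * nu2 z = hypot z + (z / hypot z) * (x - z).
  rewrite /nu1 /nu2 opprK; have h := hypot_neq0 z.
  transitivity ((1 + z ^+ 2 + z * (x - z)) / hypot z); first by field.
  by rewrite -E; field.
have t3 : - `|x - z| <= (z / hypot z) * (x - z).
  rewrite lerNl -mulrN (le_trans (ler_norm _))// normrM normrN ler_piMl//.
  by rewrite normrM normfV (gtr0_norm h0) ler_pdivrMr// mul1r.
by rewrite t2; lra.
Qed.

Lemma cauchy_schwarz_hypot (x a1 a2 : R) : Num.sqrt (a1 ^+ 2 + a2 ^+ 2) <= 1 ->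
  `|- a1 + x * a2| <= hypot x.
Proof.
move=> h; have {}h : a1 ^+ 2 + a2 ^+ 2 <= 1 by rewrite -(@ler_sqrt _ _ 1)// sqrtr1.
rewrite -sqrtr_sqr ler_sqrt; last exact: ltW.
have := sqr_ge0 (x * a1 + a2); have := mulr_ge0 (sqr_ge0 x) (_ : 0 <= 1 - a1 ^+ 2 - a2 ^+ 2).
rewrite !expr2 => /(_ (ltac:(rewrite !expr2 in h; lra))).
by rewrite !expr2 in h * => *; nra.
Qed.

End unit_normal.

Section exhaustion.
Variable R : realType.
Local Notation leb2 := (@leb2 R).

Lemma square_compact (a : R) : compact [set q : R * R | `|q.1| <= a /\ `|q.2| <= a].
Proof.
have -> : [set q : R * R | `|q.1| <= a /\ `|q.2| <= a] =
    [set x : R | `|x| <= a] `*` [set x : R | `|x| <= a] by [].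
have c : compact [set x : R | `|x| <= a].
  have -> : [set x : R | `|x| <= a] = `[- a, a]%classic.
    by apply/seteqP; split => x; rewrite /= in_itv/= ler_norml.
  exact: segment_compact.
exact: compact_setX.
Qed.

(** [C n] consists of the points at distance at least [n.+1%:R^-1] from the complement of [D], a
    closed and bounded set. As [D] is open with finite measure, the differences decrease to the
    empty set and continuity from above applies. *)
Lemma compact_exhaustion (D : set (R * R)) (a e : R) : open D ->
  (forall q, D q -> `|q.1| <= a /\ `|q.2| <= a) -> 0 < e ->
  exists C : set (R * R), [/\ compact C, C `<=` D & (leb2 (D `\` C) <= e%:E)%E].
Proof.
move=> oD Da e0.
pose C (n : nat) : set (R * R) := [set q | forall q', dist2 q q' < n.+1%:R^-1 -> D q'].
have CD n : C n `<=` D by move=> q; apply; rewrite dist2xx.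
have clC n : closed (C n).
  rewrite -openC openE => q /existsNP[q' /not_implyP[qq' nD]].
  apply/nbhs_ballP; exists (n.+1%:R^-1 - dist2 q q') => /=; first by rewrite subr_gt0.
  move=> q2; rewrite -dist2_ball/= => qq2 h; apply: nD; apply: h.
  move: qq2; rewrite ltrBrDr (dist2C q q2); exact: le_lt_trans (dist2_triangle _ _ _).
have cC n : compact (C n).
  by apply: (subclosed_compact (clC n) (@square_compact a)) => q /CD/Da.
have mD : measurable D by exact: open_measurable_R2.
have mC n : measurable (D `\` C n).
  by apply: measurableD => //; rewrite -[C n]setCK; apply: measurableC; apply: open_measurable_R2; rewrite openC.
have Dfin : (leb2 D < +oo)%E.
  apply: le_lt_trans (leb2_square_lty (- a) a); apply: le_measure; rewrite ?inE//.
    by apply: measurableX; exact: measurable_itv.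
  by move=> q /Da[]; rewrite !ler_norml /= !in_itv.
have cap0 : \bigcap_n (D `\` C n) = set0.
  rewrite -subset0 => q h; have [Dq _] := h 0%N I.
  have [r [r0 hr]] := open_dist2 oD Dq.
  have [N _ hN] := near_infty_natSinv_lt (PosNum r0).
  have [_] := h N I; apply => q' qq'; apply: hr; apply: lt_trans qq' _.
  by have := hN N (leqnn N).
have decr : {homo (fun n => D `\` C n) : n m / (n <= m)%N >-> (m <= n)%O}.
  move=> n m nm; apply/subsetPset => q [Dq nC]; split => // h; apply: nC => q' qq'.
  by apply: h; apply: lt_le_trans qq' _; rewrite lef_pV2 ?posrE// ler_nat ltnS.
have fin0 : (leb2 (D `\` C 0%N) < +oo)%E.
  have := @le_measure _ _ _ leb2 (D `\` C 0%N) D; rewrite !inE => /(_ (mC _) mD (@subDsetl _ _ _)).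
  by move=> /le_lt_trans; apply.
have := @nonincreasing_cvg_mu _ _ _ leb2 (fun n => D `\` C n) fin0 mC.
rewrite cap0 measure0 => /(_ measurable0 decr) cv.
have [N _ hN] : \forall n \near \oo, (leb2 (D `\` C n) < e%:E)%E.
  apply: (cv [set x | (x < e%:E)%E]).
  by apply: open_nbhs_nbhs; split; [exact: open_ereal_lt_ereal|rewrite /= lte_fin].
exists (C N); split => //; exact: ltW (hN N (leqnn N)).
Qed.

End exhaustion.

(** * The pulled-back potential and its difference quotients *)

Section potential_pullback.
Variable R : realType.
Local Notation H := (R * R * R)%type.
Variables (psi s : R * R -> R) (q0 : R * R) (r K : R).
Hypotheses (r0 : 0 < r) (K0 : 0 <= K).
Hypothesis est : forall q1 q2, dist2 q0 q1 < r -> dist2 q0 q2 < r ->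
  `|s q1 - s q2| <= K * dist2 q1 q2 /\
  `|psi q2 - psi q1 - s q1 * (q2.2 - q1.2) + 2 * q1.1 * s q1 ^+ 2 * (q2.1 - q1.1)|
    <= K * dist2 q1 q2 ^+ 2.
Implicit Types (p : H).

Let K1 : 0 < K + 1. Proof. exact: ltr_wpDl. Qed.

Definition projr_shift (e : R) p : R * R := (p.1.2, p.2 + 2 * p.1.2 * p.1.1 + e).

Lemma projr_shift_continuous e : continuous (projr_shift e).
Proof.
apply: continuous_pair2; first exact: continuous_y3.
move=> p; apply: cvgD; last exact: cvg_cst.
apply: cvgD; first exact: continuous_t3.
apply: cvgM; last exact: continuous_x3.
by apply: cvgM; [exact: cvg_cst|exact: continuous_y3].
Qed.

Lemma near_in_ball q1 : dist2 q0 q1 < r -> nbhs q1 [set q | dist2 q0 q < r].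
Proof.
move=> h; have nq : nbhs q1 [set q | dist2 q1 q < r - dist2 q0 q1].
  by rewrite dist2_ball; apply: nbhsx_ballx; rewrite subr_gt0.
by apply: filterS nq => q /= hq; have := dist2_triangle q0 q1 q; lra.
Qed.

Lemma slope_cont q1 : dist2 q0 q1 < r -> {for q1, continuous s}.
Proof.
move=> h1; apply/cvgrPdist_lt => e e0.
have nq : nbhs q1 [set q' | dist2 q1 q' < e / (K + 1)].
  by rewrite dist2_ball; apply: nbhsx_ballx; exact: divr_gt0.
near=> q2; have h2 : dist2 q0 q2 < r by near: q2; exact: near_in_ball.
have [h _] := est h1 h2; apply: (le_lt_trans h).
have : dist2 q1 q2 < e / (K + 1) by near: q2.
rewrite ltr_pdivlMr//.
by have := dist2_ge0 q1 q2; nra.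
Unshelve. all: by end_near. Qed.

(** [psi] as a function of three variables, constant in the first, so that [diff3_chain] applies. *)
Let V p := psi (p.1.2, p.2).

(** The quadratic remainder in [est] makes [psi] differentiable at every point of the ball, with no
    derivative of the slope involved. *)
Lemma potential_diff3 (x : R) q1 : dist2 q0 q1 < r ->
  diff3 V ((x, q1.1), q1.2) 0 (- (2 * q1.1 * s q1 ^+ 2)) (s q1).
Proof.
move=> h1 e e0; case: q1 h1 => y t h1.
pose w := Num.min (e / (K + 1)) r.
have nq : \forall p' \near ((x, y), t), dist2 (y, t) (p'.1.2, p'.2) < e / (K + 1) /\ dist2 q0 (p'.1.2, p'.2) < r.
  have cp : continuous (fun p : H => (p.1.2, p.2)).
    by apply: continuous_pair2; [exact: continuous_y3|exact: continuous_t3].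
  apply: filterI.
    have nb : nbhs (y, t) [set q' | dist2 (y, t) q' < e / (K + 1)].
      by rewrite dist2_ball; apply: nbhsx_ballx; exact: divr_gt0.
    exact: (cp ((x, y), t) _ nb).
  exact: (cp ((x, y), t) _ (near_in_ball h1)).
apply: filterS nq => -[[x' y'] t'] /= [d1 d2]; have [_ h] := est h1 d2.
rewrite /V/= mul0r add0r (_ : _ - (_ + _) = psi (y', t') - psi (y, t) - s (y, t) * (t' - t)
  + 2 * y * s (y, t) ^+ 2 * (y' - y)); last by ring.
apply: (le_trans h) => /=; have d0 := dist2_ge0 (y, t) (y', t').
have dE : dist2 (y, t) (y', t') <= `|x' - x| + `|y' - y| + `|t' - t|.
  rewrite /dist2/= ge_max (distrC y) (distrC t).
  by have := normr_ge0 (x' - x); have := normr_ge0 (y' - y); have := normr_ge0 (t' - t); move=> *; apply/andP; split; lra.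
apply: (@le_trans _ _ (e * dist2 (y, t) (y', t'))); last by rewrite ler_wpM2l// ltW.
rewrite expr2 mulrA ler_wpM2r//; move: d1; rewrite ltr_pdivlMr//.
by move=> ?; nra.
Qed.

Lemma potential_has_grad (e : R) p : dist2 q0 (projr_shift e p) < r ->
  let q := projr_shift e p in
  has_grad (fun p => psi (projr_shift e p)) p (2 * p.1.2 * s q)
    (- (2 * p.1.2 * s q ^+ 2) + 2 * p.1.1 * s q) (s q).
Proof.
case: p => [[x y] t] /= h; have D := potential_diff3 0 h; split => /=.
- have := @diff3_chain R V _ _ _ _ (fun=> 0 : R) (fun=> y) (fun z => (t + e) + 2 * y * z) x 0 0 (2 * y) _ D.
  rewrite /V/= => D'; apply: (is_derive_eqf _ _ (D' _ _ _ _)).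
  + by move=> z; rewrite /projr_shift/=; congr (psi (_, _)); ring.
  + by ring.
  + by rewrite /projr_shift/=; congr (_, _); ring.
  + exact: is_derive_line.
- have := @diff3_chain R V _ _ _ _ (fun=> 0 : R) (fun z => z) (fun z => (t + e) + 2 * x * z) y 0 1 (2 * x) _ D.
  rewrite /V/= => D'; apply: (is_derive_eqf _ _ (D' _ _ _ _)).
  + by move=> z; rewrite /projr_shift/=; congr (psi (_, _)); ring.
  + by ring.
  + by rewrite /projr_shift/=; congr (_, _); ring.
  + exact: is_derive_line.
- have := @diff3_chain R V _ _ _ _ (fun=> 0 : R) (fun=> y) (fun z => (2 * y * x + e) + 1 * z) t 0 0 1 _ D.
  rewrite /V/= => D'; apply: (is_derive_eqf _ _ (D' _ _ _ _)).
  + by move=> z; rewrite /projr_shift/=; congr (psi (_, _)); ring.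
  + by ring.
  + by rewrite /projr_shift/=; congr (_, _); ring.
  + exact: is_derive_line.
Qed.

Lemma potential_C1at (e : R) p : dist2 q0 (projr_shift e p) < r ->
  C1at (fun p => psi (projr_shift e p)) p.
Proof.
move=> h; exists (fun p => 2 * p.1.2 * s (projr_shift e p)),
  (fun p => - (2 * p.1.2 * s (projr_shift e p) ^+ 2) + 2 * p.1.1 * s (projr_shift e p)),
  (fun p => s (projr_shift e p)).
have cs : {for p, continuous (fun p => s (projr_shift e p))}.
  apply: (@continuous_comp _ _ _ (projr_shift e) s); first exact: projr_shift_continuous.
  exact: slope_cont.
split => //.
- have : nbhs p [set p' | dist2 q0 (projr_shift e p') < r].
    exact: (projr_shift_continuous (near_in_ball h)).
  by apply: filterS => p'; exact: potential_has_grad.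
- apply: cvgM; last exact: cs.
  by apply: cvgM; [exact: cvg_cst|exact: continuous_y3].
- apply: cvgD.
    apply: cvgN; apply: cvgM; last by rewrite expr2; under eq_fun do rewrite expr2; exact: cvgM.
    by apply: cvgM; [exact: cvg_cst|exact: continuous_y3].
  apply: cvgM; last exact: cs.
  by apply: cvgM; [exact: cvg_cst|exact: continuous_x3].
Qed.

End potential_pullback.

Section normal_field.
Variable R : realType.
Local Notation H := (R * R * R)%type.
Variables (psi s : R * R -> R) (e : R).
Hypothesis e0 : 0 < e.
Implicit Types (p : H) (q : R * R).

(** It depends on [p] through [projr p] alone, so it is constant along the right fibres. The form
    [+ -1 *] matches the closure rules for [C1at]. *)
Definition centered_quotient p : R :=
  (psi (projr_shift e p) + -1 * psi (projr_shift (- e) p)) * (2 * e)^-1.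

Variables (r K A : R) (p : H).
Hypotheses (er : e < r) (K0 : 0 <= K).
Hypothesis est : forall q1 q2, dist2 (projr p) q1 < r -> dist2 (projr p) q2 < r ->
  `|s q1 - s q2| <= K * dist2 q1 q2 /\
  `|psi q2 - psi q1 - s q1 * (q2.2 - q1.2) + 2 * q1.1 * s q1 ^+ 2 * (q2.1 - q1.1)|
    <= K * dist2 q1 q2 ^+ 2.

Let shiftE (c : R) : projr_shift c p = ((projr p).1, (projr p).2 + c). Proof. by []. Qed.

Let dist_shift (c : R) : dist2 (projr p) (projr_shift c p) = `|c|.
Proof.
by rewrite shiftE /dist2/= subrr normr0 max_r// opprD addrA subrr add0r normrN.
Qed.

Let inE1 : dist2 (projr p) (projr_shift e p) < r. Proof. by rewrite dist_shift gtr0_norm. Qed.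
Let inE2 : dist2 (projr p) (projr_shift (- e) p) < r.
Proof. by rewrite dist_shift normrN gtr0_norm. Qed.
Let in0 : dist2 (projr p) (projr p) < r. Proof. by rewrite dist2xx; exact: lt_trans e0 er. Qed.

Lemma centered_quotient_C1at : C1at centered_quotient p.
Proof.
apply: C1atM; last exact: C1at_cst.
apply: C1atD; first exact: (potential_C1at K0 est inE1).
by apply: C1atM; [exact: C1at_cst|exact: (potential_C1at K0 est inE2)].
Qed.

Let bp := s (projr_shift e p).
Let bm := s (projr_shift (- e) p).

Lemma centered_quotient_close : `|centered_quotient p - s (projr p)| <= K * e.
Proof.
have e_gt0 := e0; have [_ h1] := est in0 inE1; have [_ h2] := est in0 inE2.
move: h1 h2; rewrite !dist_shift normrN (gtr0_norm e_gt0) !shiftE /= subrr !mulr0 !addr0.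
rewrite (_ : (projr p).2 + e - (projr p).2 = e); last by rewrite addrC addKr.
rewrite (_ : (projr p).2 - e - (projr p).2 = - e); last by rewrite addrC addKr.
rewrite -!shiftE /centered_quotient; set a := psi (projr_shift e p); set c := psi (projr_shift (- e) p).
set z := psi _; set m := s _ => h1 h2.
rewrite (_ : _ - m = ((a - z - m * e) - (c - z - m * - e)) / (2 * e)); last first.
  by field; rewrite gt_eqF.
rewrite normrM (@ger0_norm _ (_^-1)) ?invr_ge0 ?mulr_ge0 ?(ltW e_gt0)//.
rewrite ler_pdivrMr ?mulr_gt0//; apply: (le_trans (ler_normB _ _)).
by rewrite (_ : K * e * (2 * e) = K * e ^+ 2 + K * e ^+ 2); [exact: lerD|ring].
Qed.

(** On functions of the right coordinates [X] acts as [4 y d_t] and [Y] as [d_y]. The quotient of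
    [- 2 y s^2] factors as [bp + bm] times the quotient [Bs] of the slope, which [est] bounds by
    [K]. *)
Lemma centered_quotient_fields : exists Bs : R,
  [/\ Xf centered_quotient p = 4 * (projr p).1 * Bs,
      Yf centered_quotient p = - 2 * (projr p).1 * (bp + bm) * Bs & `|Bs| <= K].
Proof.
have e_gt0 := e0.
exists ((bp - bm) / (2 * e)).
have G1 := potential_has_grad K0 est inE1; have G2 := potential_has_grad K0 est inE2.
have kg : has_grad (fun=> -1 : R) p 0 0 0 by split; exact: is_derive_cst.
have kg2 : has_grad (fun=> (2 * e)^-1 : R) p 0 0 0 by split; exact: is_derive_cst.
have := has_gradM (has_gradD G1 (has_gradM kg G2)) kg2.
rewrite -[X in has_grad X]/centered_quotient -/bp -/bm => /has_grad_dE[hx hy ht].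
split.
- by rewrite /Xf hx ht /projr/=; field; rewrite gt_eqF.
- by rewrite /Yf hy ht /projr/=; field; rewrite gt_eqF.
- rewrite normrM (@ger0_norm _ (_^-1)) ?invr_ge0 ?mulr_ge0 ?(ltW e_gt0)//.
  rewrite ler_pdivrMr ?mulr_gt0//; have [h _] := est inE1 inE2; apply: (le_trans h).
  rewrite ler_wpM2l// !shiftE /dist2/= subrr normr0 max_r//.
  by rewrite (_ : _ - _ = 2 * e); [rewrite ger0_norm// mulr_ge0// ltW|ring].
Qed.

(* Along a minimal graph [B_y + 4 y B B_t = 0]; here [B] is a difference quotient of
   a potential [psi] with [psi_t = b] and [psi_y = - 2 y b^2], and the error is [O(e)]. *)
Lemma normal_divergence : `|(projr p).1| <= A ->
  `|Xf (fun p => nu1 (centered_quotient p)) p + Yf (fun p => nu2 (centered_quotient p)) p|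
    <= 8 * A * K ^+ 2 * e.
Proof.
move=> yA; have e_gt0 := e0; have K_ge0 := K0.
have [gx [gy [gt [G _ _ _]]]] := centered_quotient_C1at.
have {}G := nbhs_singleton G.
have [Bs [EX EY BsK]] := centered_quotient_fields.
have [hx hy ht] := has_grad_dE G.
have [h1x _ h1t] := has_grad_dE (has_grad_comp (is_derive_nu1 _) G).
have [_ h2y h2t] := has_grad_dE (has_grad_comp (is_derive_nu2 _) G).
rewrite /Xf h1x h1t /Yf h2y h2t; set B := centered_quotient p.
set k := (hypot B ^+ 3)^-1.
have -> : B * k * gx p + 2 * p.1.2 * (B * k * gt p) + (k * gy p - 2 * p.1.1 * (k * gt p)) =
    k * (B * Xf centered_quotient p + Yf centered_quotient p).
  by rewrite /Xf /Yf hx hy ht; ring.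
(* The factor [B - (bp + bm) / 2] compares two approximations of the same slope, hence is at most
   [2 * K * e]; it makes the divergence small. *)
rewrite EX EY (_ : _ * _ + _ = 4 * (projr p).1 * Bs * (B - (bp + bm) / 2)); last by field.
have /andP[k0 k1] := hypot_cube_itv B; rewrite -/k in k0 k1.
have hB : `|B - (bp + bm) / 2| <= 2 * K * e.
  rewrite (_ : _ - _ = (B - s (projr p)) - ((bp - s (projr p)) + (bm - s (projr p))) / 2); last by field.
  have c0 := centered_quotient_close; rewrite -/B in c0.
  have [c1 _] := est in0 inE1; have [c2 _] := est in0 inE2.
  rewrite dist_shift distrC (gtr0_norm e_gt0) -/bp in c1.
  rewrite dist_shift distrC normrN (gtr0_norm e_gt0) -/bm in c2.
  apply: (le_trans (ler_normB _ _)); rewrite normrM (ger0_norm (_ : 0 <= 2^-1))//.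
  by have := ler_normD (bp - s (projr p)) (bm - s (projr p)); lra.
rewrite normrM (ger0_norm k0); apply: (@le_trans _ _ `|4 * (projr p).1 * Bs * (B - (bp + bm) / 2)|).
  by rewrite ler_piMl.
rewrite !normrM (ger0_norm (ler0n _ _)).
rewrite (_ : 8 * A * K ^+ 2 * e = 4 * A * K * (2 * K * e)); last by ring.
rewrite ler_pM ?mulr_ge0// ler_pM ?mulr_ge0// ler_wpM2l//.
Qed.

End normal_field.

Section test_field.
Variable R : realType.
Local Notation H := (R * R * R)%type.
Local Notation leb2 := (@leb2 R).
Local Notation leb3 := (@leb3 R).
Variables (D : set (R * R)) (u U b : R * R -> R) (k Mu b0 A : R).
Hypothesis fol : foliation D u U b k Mu b0.
Hypothesis DA : forall q, D q -> `|q.1| <= A /\ `|q.2| <= A.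
Variables (Dr : set (R * R)) (ur : R * R -> R).
Hypotheses (oDr : open Dr) (urL : loclip2_on Dr ur).
Hypothesis SS : Sgraph D u = Sgraph_r Dr ur.
Implicit Types (p : H) (q : R * R).

Let s := slope_r b ur.

(** One number [r] is both a radius and the inverse of the constant in the estimates, so that the
    property passes to smaller [r] as [compact_uniform_radius] requires. *)
Let local_potential (psi : R * R -> R) q (r : R) := forall q1 q2, dist2 q q1 < r -> dist2 q q2 < r ->
  [/\ Dr q1, `|s q1 - s q2| <= r^-1 * dist2 q1 q2 &
    `|psi q2 - psi q1 - s q1 * (q2.2 - q1.2) + 2 * q1.1 * s q1 ^+ 2 * (q2.1 - q1.1)|
      <= r^-1 * dist2 q1 q2 ^+ 2].

Lemma uniform_potential : exists psi : R * R -> R, forall K : set (R * R), compact K -> K `<=` Dr ->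
  exists r : R, 0 < r /\ forall q, K q -> local_potential psi q r.
Proof.
have [Psi0 dPsi] := axis_primitive fol DA.
exists (fun q => Psi0 (leaf_label b ur q) + q.1 ^+ 2 * s q ^+ 2) => K cK KD.
apply: (compact_uniform_radius cK) => [q r r' /andP[r'0 rr'] h q1 q2 d1 d2|q /KD Dq].
  have [D1 h1 h2] := h _ _ (lt_le_trans d1 rr') (lt_le_trans d2 rr').
  have ri : r^-1 <= r'^-1 by rewrite lef_pV2 ?posrE// (lt_le_trans r'0).
  split => //; first by apply: (le_trans h1); rewrite ler_wpM2r// dist2_ge0.
  by apply: (le_trans h2); rewrite ler_wpM2r// sqr_ge0.
have [r [C [r0 C0 h]]] := potential_local fol DA oDr urL SS dPsi Dq.
have C1 : 0 < C + 1 by lra.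
(* Halving leaves room for the ball around a centre near [q]; the second entry makes the inverse at
   least [C]. *)
exists (Num.min (r / 2) (C + 1)^-1); split; first by rewrite lt_min divr_gt0// invr_gt0.
move=> q' qq' q1 q2 d1 d2.
have m1 : Num.min (r / 2) (C + 1)^-1 <= r / 2 by rewrite ge_min lexx.
have Cr : C <= (Num.min (r / 2) (C + 1)^-1)^-1.
  apply: (@le_trans _ _ (C + 1)); first by lra.
  rewrite -[X in X <= _]invrK lef_pV2 ?posrE ?invr_gt0 ?lt_min ?divr_gt0 ?invr_gt0//.
  by rewrite ge_min lexx orbT.
have t1 := dist2_triangle q q' q1; have t2 := dist2_triangle q q' q2.
have [D1 h1 h2] := h q1 q2 (ltac:(lra)) (ltac:(lra)).
split => //; first by apply: (le_trans h1); rewrite ler_wpM2r// dist2_ge0.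
by apply: (le_trans h2); rewrite ler_wpM2r// sqr_ge0.
Qed.

Lemma graph_trace_compact (C : set (R * R)) : compact C -> compact [set Phi (U q, q) | q in C].
Proof.
move=> cC; apply: continuous_compact => //; apply: continuous_subspaceT.
apply: continuous_pair2; last first.
  move=> q; apply: cvgD; first exact: cvg_snd.
  apply: cvgM; last exact: (fol_ext_continuous fol).
  by apply: cvgM; [exact: cvg_cst|exact: cvg_fst].
by apply: continuous_pair2 => q; [exact: (fol_ext_continuous fol)|exact: cvg_fst].
Qed.

Let B0 : 0 <= b0. Proof. exact: le_trans (normr_ge0 _) (fol_b fol (0, 0)). Qed.

Lemma fol_domain_lty : (leb2 D < +oo)%E.
Proof.
have mD : measurable D by exact: open_measurable_R2 (fol_domain_open fol).
apply: le_lt_trans (leb2_square_lty (- A) A); apply: le_measure; rewrite ?inE//.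
  by apply: measurableX; exact: measurable_itv.
by move=> q /DA[]; rewrite !ler_norml /= !in_itv.
Qed.

(** The field is [chi] times the unit normal built from the centered quotient. Near [K] the cutoff
    is 1, so the divergence is that of the normal. It is also 1 on the graph over the compact set
    [C], where the flux density is close to [hypot (b q)]; on the small rest of [D], Cauchy-Schwarz
    bounds the loss. *)
Lemma test_field (O : set H) (K : set H) (eps : R) : open O -> O `<=` VD Dr ->
  compact K -> K `<=` O -> Sgraph D u `<=` O -> 0 < eps ->
  exists w1 w2 : H -> R, [/\ C1c O w1, C1c O w2,
    forall p, Num.sqrt (w1 p ^+ 2 + w2 p ^+ 2) <= 1,
    forall p, K p -> `|Xf w1 p + Yf w2 p| <= eps &
    (\int[leb2]_q (\1_D q * hypot (b q)))%R - eps <=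
    (\int[leb2]_q (- \1_D q * w1 (Phi (U q, q)) + b q * w2 (Phi (U q, q))))%R].
Proof.
move=> oO OV cK KO SO eps0.
have oD := fol_domain_open fol; have mD := open_measurable_R2 oD.
have b0_ge0 := B0.
(* Off [C] the density loses at most [2 * (1 + b0)], so this part costs at most [eps / 2]. *)
pose eta := eps / (4 * (1 + b0)).
have eta0 : 0 < eta by rewrite divr_gt0// mulr_gt0//; lra.
have [C [cC CD Ceta]] := compact_exhaustion oD DA eta0.
pose KC := K `|` [set Phi (U q, q) | q in C].
have cKC : compact KC by apply: compactU => //; exact: graph_trace_compact.
have KCO : KC `<=` O.
  move=> p [/KO//|[q /CD Dq <-]]; apply: SO; apply/SgraphE.
  by rewrite projl_Phi (fol_ext fol).
have [chi [[chi1 chiO] chi01 chiK]] := cutoff cKC oO KCO.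
pose S := closure [set p | chi p != 0].
have [cS SO'] := chiO; rewrite -/S in cS SO'.
have [psi hpsi] := uniform_potential.
have cKr : compact (@projr R @` S).
  by apply: continuous_compact => //; apply: continuous_subspaceT; exact: continuous_projr.
have KrD : @projr R @` S `<=` Dr by move=> _ [p /SO'/OV/VDE Dp <-].
have [r [r0 hr]] := hpsi _ cKr KrD.
pose m := fine (leb2 D).
have m0 : 0 <= m by rewrite fine_ge0.
have A0 : 0 <= `|A| by [].
(* Shifts by [e] stay within the radius [r]; the divergence bound [8 * |A| * r^-1 ^+ 2 * e] is at
   most [eps]; the loss [2 * (r^-1 * e)] on [D], of measure [m], costs at most [eps / 2]. *)
pose e := Num.min (r / 2) (Num.min (eps / (8 * `|A| * r^-1 ^+ 2 + 1)) (eps * r / (4 * (m + 1)))).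
have ri0 : 0 < r^-1 by rewrite invr_gt0.
have p1 : 0 <= 8 * `|A| * r^-1 ^+ 2 by rewrite !mulr_ge0// ltW.
have e0 : 0 < e.
  rewrite !lt_min; apply/and3P; split; first by rewrite divr_gt0.
    by rewrite divr_gt0//; lra.
  by rewrite divr_gt0 ?mulr_gt0//; lra.
have er : e < r by apply: (@le_lt_trans _ _ (r / 2)); [rewrite ge_min lexx|lra].
have e1 : 8 * `|A| * r^-1 ^+ 2 * e <= eps.
  have : e <= eps / (8 * `|A| * r^-1 ^+ 2 + 1) by rewrite !ge_min lexx !orbT.
  by rewrite ler_pdivlMr; [lra|lra].
have e2 : 2 * (r^-1 * e) * m <= eps / 2.
  have : e <= eps * r / (4 * (m + 1)) by rewrite !ge_min lexx !orbT.
  rewrite ler_pdivlMr; last by lra.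
  rewrite -ler_pdivrMr// => h.
  have -> : r^-1 * e = e / r by rewrite mulrC.
  have er0 : 0 <= e / r by rewrite divr_ge0// ltW.
  by move: h; rewrite mulrAC; move: (e / r) er0 => z z0 h; lra.
have est p : S p -> forall q1 q2, dist2 (projr p) q1 < r -> dist2 (projr p) q2 < r ->
  `|s q1 - s q2| <= r^-1 * dist2 q1 q2 /\
  `|psi q2 - psi q1 - s q1 * (q2.2 - q1.2) + 2 * q1.1 * s q1 ^+ 2 * (q2.1 - q1.1)|
    <= r^-1 * dist2 q1 q2 ^+ 2.
  by move=> Sp q1 q2 d1 d2; have [_ ? ?] := hr _ (ex_intro2 _ _ p Sp erefl) _ _ d1 d2.
pose B := centered_quotient psi e.
have C1B p : S p -> C1at B p.
  by move=> Sp; exact: (centered_quotient_C1at e0 er (ltW ri0) (est _ Sp)).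
pose w1 p := chi p * nu1 (B p); pose w2 p := chi p * nu2 (B p).
have C1w (nu : R -> R) : (forall p, C1at B p -> C1at (fun p => nu (B p)) p) ->
    C1c O (fun p => chi p * nu (B p)).
  move=> hnu; split; last first.
    apply: cpt_in_subset chiO => p /=; apply: contraNneq => ->; by rewrite mul0r.
  apply: C1at_C1 => p; have [Sp|nS] := pselect (S p).
    by apply: C1atM; [exact: C1_C1at|exact/hnu/C1B].
  apply: (C1at_near_eq _ (C1at_cst 0 p)).
  by apply: filterS (notin_support_near nS) => p' ->; rewrite mul0r.
have w1O : C1c O w1 by apply: C1w => p; exact: C1at_nu1.
have w2O : C1c O w2 by apply: C1w => p; exact: C1at_nu2.
have S_of p : chi p != 0 -> S p by move=> cp; exact: (@subset_closure _ [set p | chi p != 0]).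
have KS p : KC p -> S p.
  by move=> /chiK/nbhs_singleton c1; apply: S_of; rewrite c1 oner_neq0.
have w_le p : Num.sqrt (w1 p ^+ 2 + w2 p ^+ 2) <= 1.
  have -> : w1 p ^+ 2 + w2 p ^+ 2 = chi p ^+ 2 * (nu1 (B p) ^+ 2 + nu2 (B p) ^+ 2).
    by rewrite /w1 /w2; ring.
  rewrite nu_unit mulr1 sqrtr_sqr.
  by have /andP[c0 c1] := chi01 p; rewrite ger0_norm.
exists w1, w2; split => //.
  move=> p Kp; have KCp : KC p by left.
  have Sp := KS _ KCp; have chi1p := chiK _ KCp.
  have n1 : \forall p' \near p, w1 p' = nu1 (B p') by apply: filterS chi1p => p' c1; rewrite /w1 c1 mul1r.
  have n2 : \forall p' \near p, w2 p' = nu2 (B p') by apply: filterS chi1p => p' c1; rewrite /w2 c1 mul1r.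
  have germ (v w : H -> R) : C1at w p -> (\forall p' \near p, v p' = w p') ->
      Xf v p = Xf w p /\ Yf v p = Yf w p.
    move=> [gx [gy [gt [G _ _ _]]]] vw; have {}G := nbhs_singleton G.
    have [a1 a2 a3] := has_grad_dE G.
    have vw' : \forall p' \near p, w p' = v p' by apply: filterS vw.
    have [c1 c2 c3] := has_grad_dE (has_grad_near_eq vw' G).
    by rewrite /Xf /Yf a1 a2 a3 c1 c2 c3.
  have [-> _] := germ _ _ (C1at_nu1 (C1B _ Sp)) n1.
  have [_ ->] := germ _ _ (C1at_nu2 (C1B _ Sp)) n2.
  apply: le_trans e1.
  apply: (normal_divergence e0 er (ltW ri0) (est _ Sp)).
  have /VDE Dp := OV _ (SO' _ Sp).
  exact: le_trans (Dr_y DA SS Dp) (ler_norm A).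
have cw1 : continuous w1 by apply: C1_continuous; case: w1O.
have cw2 : continuous w2 by apply: C1_continuous; case: w2O.
pose f q := \1_D q * hypot (b q).
pose g q := - \1_D q * w1 (Phi (U q, q)) + b q * w2 (Phi (U q, q)).
have mb := fol_slope_measurable fol.
have mI : measurable_fun setT (\1_D : R * R -> R) by exact: measurable_indic.
have mf : measurable_fun setT f.
  apply: (measurable_funM mI); apply: measurableT_comp => //.
  exact: (continuous_measurable_fun (@continuous_hypot R)).
have mg : measurable_fun setT g.
  apply: measurable_funD.
    by apply: (measurable_funM _ (graph_trace_measurable fol cw1)); exact: measurable_funN.
  exact: (measurable_funM mb (graph_trace_measurable fol cw2)).
have gE q : D q -> g q = - w1 (Phi (U q, q)) + b q * w2 (Phi (U q, q)).
  by move=> Dq; rewrite /g indicE mem_set// mulN1r.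
have g0 q : ~ D q -> g q = 0.
  by move=> nD; rewrite /g indicE memNset// oppr0 mul0r add0r (fol_out fol)// mul0r.
have f0 q : ~ D q -> f q = 0 by move=> nD; rewrite /f indicE memNset// mul0r.
have fE q : D q -> f q = hypot (b q) by move=> Dq; rewrite /f indicE mem_set// mul1r.
have hb q : hypot (b q) <= 1 + b0.
  by apply: (le_trans (hypot_le _)); rewrite lerD2l; exact: (fol_b fol).
have gb q : D q -> `|g q| <= hypot (b q) by move=> /gE ->; apply: cauchy_schwarz_hypot.
have Dfin := fol_domain_lty.
have If : leb2.-integrable setT (EFin \o f).
  apply: (@fs_integrable _ _ _ leb2 f D (1 + b0) mf mD Dfin _ f0) => q.
  have [Dq|nD] := pselect (D q); last by rewrite f0// normr0; lra.
  by rewrite fE// ger0_norm// (le_trans ler01 (hypot_ge1 _)).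
have Ig : leb2.-integrable setT (EFin \o g).
  apply: (@fs_integrable _ _ _ leb2 g D (1 + b0) mg mD Dfin _ g0) => q.
  have [Dq|nD] := pselect (D q); last by rewrite g0// normr0; lra.
  exact: le_trans (gb _ Dq) (hb _).
have mC : measurable C.
  rewrite -[C]setCK; apply: measurableC; apply: open_measurable_R2; rewrite openC.
  by apply: compact_closed => //; exact: norm_hausdorff.
have mDC : measurable (D `\` C) by exact: measurableD.
have DCfin : (leb2 (D `\` C) < +oo)%E by apply: le_lt_trans Ceta (ltry _).
have I1 := @fs_cst_integrable _ _ _ leb2 D (2 * (r^-1 * e)) mD Dfin.
have I2 := @fs_cst_integrable _ _ _ leb2 (D `\` C) (2 * (1 + b0)) mDC DCfin.
have Ifg : leb2.-integrable setT (EFin \o (fun q => f q - g q)) by exact: (integrableB measurableT If Ig).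
have I12 : leb2.-integrable setT (EFin \o (fun q => 2 * (r^-1 * e) * \1_D q + 2 * (1 + b0) * \1_(D `\` C) q)).
  exact: (integrableD measurableT I1 I2).
have ptw q : `|f q - g q| <= 2 * (r^-1 * e) * \1_D q + 2 * (1 + b0) * \1_(D `\` C) q.
  have [Dq|nD] := pselect (D q); last first.
    by rewrite f0// g0// subrr normr0 !indicE !memNset ?mulr0 ?addr0// => -[].
  have gq := gb _ Dq; have fg : 0 <= f q - g q.
    by rewrite fE// subr_ge0 (le_trans (ler_norm _)).
  rewrite (ger0_norm fg) [\1_D q]indicE mem_set// mulr1.
  have [Cq|nC] := pselect (C q).
    rewrite indicE memNset ?mulr0 ?addr0; last by move=> [].
    have KCq : KC (Phi (U q, q)) by right; exists q.
    have Sq := KS _ KCq; have c1 := nbhs_singleton (chiK _ KCq).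
    rewrite fE// gE// /w1 /w2 c1 !mul1r (fol_ext fol Dq).
    have close := centered_quotient_close e0 er (est _ Sq).
    rewrite /s (fol_ext fol Dq) projr_Phi (slope_r_toright b SS Dq) distrC -/(B _) in close.
    have := nu_dot_ge (b q) (B (Phi (u q, q))); lra.
  rewrite indicE mem_set// mulr1.
  have ri1 : 0 <= 2 * (r^-1 * e) by rewrite !mulr_ge0// ltW.
  move: gq; rewrite ler_norml => /andP[gq _]; have := hb q.
  rewrite fE// => hq; lra.
have := fs_Rintegral_le Ifg I12 ptw.
rewrite (@RintegralB _ _ _ leb2 setT f g measurableT If Ig).
rewrite (@RintegralD _ _ _ leb2 setT _ _ measurableT I1 I2).
have Id := @fs_indic_integrable _ _ _ leb2 D mD Dfin.
have Id2 := @fs_indic_integrable _ _ _ leb2 (D `\` C) mDC DCfin.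
rewrite (@RintegralZl _ _ _ leb2 setT \1_D _ measurableT Id).
rewrite (@RintegralZl _ _ _ leb2 setT \1_(D `\` C) _ measurableT Id2).
rewrite (fs_indic_Rintegral leb2 mD) (fs_indic_Rintegral leb2 mDC) -/m.
have mDCe : fine (leb2 (D `\` C)) <= eta.
  by rewrite -lee_fin fineK// ge0_fin_numE.
have eta2 : 2 * (1 + b0) * fine (leb2 (D `\` C)) <= eps / 2.
  have -> : eps / 2 = 2 * (1 + b0) * eta by rewrite /eta; field; lra.
  by rewrite ler_wpM2l//; lra.
move=> /(le_trans (ler_norm _)); rewrite lerBlDr => /le_trans h.
rewrite lerBlDr; apply: h; rewrite addrC lerD2l.
by rewrite [eps in _ <= eps]splitr; exact: lerD.
Qed.

End test_field.

(** * Perimeters *)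

Section perimeters.
Variable R : realType.
Local Notation H := (R * R * R)%type.
Local Notation leb2 := (@leb2 R).
Local Notation leb3 := (@leb3 R).
Variables (D : set (R * R)) (u U b : R * R -> R) (k Mu b0 A : R).
Hypothesis fol : foliation D u U b k Mu b0.
Hypothesis DA : forall q, D q -> `|q.1| <= A /\ `|q.2| <= A.
Hypothesis Dscale : forall q (a : R), D q -> 0 <= a <= 1 -> D (a * q.1, q.2).
Variables (Dr : set (R * R)) (ur : R * R -> R).
Hypotheses (oDr : open Dr) (urL : loclip2_on Dr ur).
Hypothesis SS : Sgraph D u = Sgraph_r Dr ur.
Implicit Types (p : H) (q : R * R) (v w : H -> R).

Let mD : measurable D. Proof. exact: open_measurable_R2 (fol_domain_open fol). Qed.
Let Dfin := fol_domain_lty fol DA.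
Let mI : measurable_fun setT (\1_D : R * R -> R). Proof. exact: measurable_indic. Qed.
Let mb := fol_slope_measurable fol.
Let B0 : 0 <= b0. Proof. exact: le_trans (normr_ge0 _) (fol_b fol (0, 0)). Qed.

Definition slope_area : R := (\int[leb2]_q (\1_D q * hypot (b q)))%R.

Let mhyp : measurable_fun setT (fun q => hypot (b q)).
Proof. by apply: measurableT_comp mb; exact: (continuous_measurable_fun (@continuous_hypot R)). Qed.

Let hypot_b q : hypot (b q) <= 1 + b0.
Proof. by apply: (le_trans (hypot_le _)); rewrite lerD2l; exact: (fol_b fol). Qed.

Let Iarea : leb2.-integrable setT (EFin \o (fun q => \1_D q * hypot (b q))).
Proof.
have mf : measurable_fun setT (fun q => \1_D q * hypot (b q)) by exact: (measurable_funM mI mhyp).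
apply: (@fs_integrable _ _ _ leb2 _ D (1 + b0) mf mD Dfin) => q.
  rewrite indicE; case: (_ \in _); rewrite ?mul1r ?mul0r ?normr0 ?addr_ge0//.
  by rewrite ger0_norm// (le_trans ler01 (hypot_ge1 _)).
by move=> nD; rewrite indicE memNset// mul0r.
Qed.

(** [Bop u] is the slope wherever [U] is derivable in [t], that is, off a null set. The comparison
    is made with the measurable [hypot (b q)], so that no measurability of [Bop u] has to be
    established. *)
Lemma AreaH_slope : AreaH D u = slope_area%:E.
Proof.
have [N [mN N0 hN]] := ae_derivable_slices (fol_lip fol).
have mg : measurable_fun setT (fun q => (hypot (b q))%:E) by apply/measurable_EFinP.
have -> : AreaH D u = (\int[leb2]_(q in D) (hypot (b q))%:E)%E.
  apply: (@integral_eq_off_null _ _ _ leb2 D D N _ _ mN N0 mD mg) => q nN; first by [].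
  by move=> Dq; rewrite (Bop_slope fol Dq (hN _ nN)).
rewrite integral_mkcond /slope_area /Rintegral fineK; last exact: (@integrable_fin_num _ _ _ leb2 setT measurableT _ Iarea).
apply: eq_integral => q _; rewrite patchE indicE.
by case: ifPn => qD; rewrite ?mul1r ?mul0r.
Qed.

Let flux v1 v2 q := - \1_D q * v1 (Phi (U q, q)) + b q * v2 (Phi (U q, q)).

Let mtrace v : continuous v -> measurable_fun setT (fun q => v (Phi (U q, q))).
Proof. exact: (graph_trace_measurable fol). Qed.

Let Itrace (a : R * R -> R) v (M M' : R) : measurable_fun setT a -> continuous v ->
  (forall q, `|a q| <= M) -> (forall p, `|v p| <= M') -> (forall q, ~ D q -> a q = 0) ->
  leb2.-integrable setT (EFin \o (fun q => a q * v (Phi (U q, q)))).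
Proof.
move=> ma cv aM vM a0.
have mf : measurable_fun setT (fun q => a q * v (Phi (U q, q))) by exact: (measurable_funM ma (mtrace cv)).
apply: (@fs_integrable _ _ _ leb2 _ D (M * M') mf mD Dfin) => q.
  by rewrite normrM ler_pM.
by move=> /a0 ->; rewrite mul0r.
Qed.

Let Itraces O v1 v2 : C1c O v1 -> C1c O v2 ->
  leb2.-integrable setT (EFin \o (fun q => - \1_D q * v1 (Phi (U q, q)))) /\
  leb2.-integrable setT (EFin \o (fun q => b q * v2 (Phi (U q, q)))).
Proof.
move=> h1 h2; have [M1 [_ [_ _ hM1 _]]] := C1c_bounds h1; have [M2 [_ [_ _ hM2 _]]] := C1c_bounds h2.
split.
- apply: (@Itrace _ _ 1 M1); [exact: measurable_funN| | | |].
  + by apply: C1_continuous; case: h1.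
  + by move=> q; rewrite normrN indicE; case: (_ \in _); rewrite ?normr1 ?normr0.
  + by move=> p; have [] := hM1 p.
  + by move=> q nD; rewrite indicE memNset// oppr0.
- apply: (@Itrace _ _ b0 M2) => //.
  + by apply: C1_continuous; case: h2.
  + exact: (fol_b fol).
  + by move=> p; have [] := hM2 p.
  + exact: (fol_out fol).
Qed.

(** The form common to both divergence formulas. The flux is written in left coordinates in either
    case, so both perimeters are compared with the same area. *)
Let divergence_on (E O : set H) := measurable E /\ forall v, C1c O v ->
  (\int[leb3]_(p in E) (Xf v p)%:E)%E = (\int[leb2]_q (- \1_D q * v (Phi (U q, q))))%R%:E /\
  (\int[leb3]_(p in E) (Yf v p)%:E)%E = (\int[leb2]_q (b q * v (Phi (U q, q))))%R%:E.

Let left_div : divergence_on (Egraph D u) (DV D).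
Proof.
split; first exact: open_measurable_R3 (Egraph_open fol).
by move=> v vD; rewrite (left_divergence_X fol vD) (left_divergence_Y fol vD).
Qed.

Let right_div : divergence_on (Egraph_r Dr ur) (VD Dr).
Proof.
split; first exact: open_measurable_R3 (Egraph_r_open oDr urL).
move=> v vD; rewrite (right_divergence_X fol Dscale oDr urL SS vD).
by rewrite (right_divergence_Y fol Dscale oDr urL SS vD).
Qed.

Let flux_formula E O v1 v2 : divergence_on E O -> C1c O v1 -> C1c O v2 ->
  (\int[leb3]_(p in E) (Xf v1 p + Yf v2 p)%:E)%E = (\int[leb2]_q flux v1 v2 q)%R%:E.
Proof.
move=> [mE hE] h1 h2.
have [IX _] := C1c_XYf_integrable h1; have [_ IY] := C1c_XYf_integrable h2.
have IXE : leb3.-integrable E (EFin \o Xf v1).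
  exact: (@integrableS _ _ _ leb3 setT _ _ measurableT mE (@subsetT _ _) IX).
have IYE : leb3.-integrable E (EFin \o Yf v2).
  exact: (@integrableS _ _ _ leb3 setT _ _ measurableT mE (@subsetT _ _) IY).
transitivity (\int[leb3]_(p in E) ((Xf v1 p)%:E + (Yf v2 p)%:E))%E; first by [].
rewrite (@integralD _ _ _ leb3 E mE (fun p => (Xf v1 p)%:E) (fun p => (Yf v2 p)%:E) IXE IYE).
have [-> _] := hE _ h1; have [_ ->] := hE _ h2.
have [I1 I2] := Itraces h1 h2.
by rewrite -EFinD -(@RintegralD _ _ _ leb2 setT _ _ measurableT I1 I2).
Qed.

Lemma HPer_le_area E O : divergence_on E O -> (HPer E O <= slope_area%:E)%E.
Proof.
move=> dE; apply: ge_ereal_sup => _ [v1 [v2 [h1 [h2 [h3 ->]]]]].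
rewrite (flux_formula dE h1 h2) lee_fin.
have [I1 I2] := Itraces h1 h2.
have If : leb2.-integrable setT (EFin \o flux v1 v2) by exact: (integrableD measurableT I1 I2).
apply: (le_trans (ler_norm _)); apply: (fs_Rintegral_le If Iarea) => q.
rewrite /flux indicE; have [Dq|nD] := pselect (D q).
  by rewrite mem_set// mulN1r mul1r; exact: cauchy_schwarz_hypot.
by rewrite memNset// oppr0 (fol_out fol)// !mul0r addr0 normr0.
Qed.

Let compact_leb3_lty (K : set H) : compact K -> measurable K /\ (leb3 K < +oo)%E.
Proof.
move=> cK; have clK := compact_closed (@R3_hausdorff R) cK.
have mK : measurable K by rewrite -[K]setCK; apply: measurableC; apply: open_measurable_R3; rewrite openC.
split => //.
have [Nx [_ hx]] := continuous_compact_norm_bound cK (@continuous_x3 R).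
have [Ny [_ hy]] := continuous_compact_norm_bound cK (@continuous_y3 R).
have [Nt [_ ht]] := continuous_compact_norm_bound cK (@continuous_t3 R).
pose N := Num.max Nx (Num.max Ny Nt).
apply: le_lt_trans (leb3_box_lty ((0, 0), 0) N); apply: le_measure; rewrite ?inE//.
  exact: measurable_box.
by move=> p Kp; rewrite /box/= !subr0 !le_max; rewrite (hx _ Kp) (hy _ Kp) (ht _ Kp) !orbT.
Qed.

(** Calibration: tested with the nearly optimal field, [E] gives the area up to a small error.
    Passing from [E] to [F] changes the integral only on [K], where the divergence is as small as
    desired. The set [O] is left free, so that the left graph can be tested in the overlap of the
    cylinders. *)
Lemma area_le_HPer E F O : divergence_on E O -> open O -> O `<=` VD Dr -> Sgraph D u `<=` O ->
  leb3_measurable F -> cpt_in ((E `\` F) `|` (F `\` E)) O ->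
  (slope_area%:E <= HPer F O)%E.
Proof.
move=> dE oO OV SO [B [N [mB [mN [N0 FBN]]]]] [cK KO]; have [mE _] := dE.
set K := closure _ in cK KO; have [mK Kfin] := compact_leb3_lty cK.
apply/lee_addgt0Pr => eps eps0.
pose m := fine (leb3 K); have m0 : 0 <= m by rewrite fine_ge0.
(* The flux error [eps / (m + 1)] and the divergence error [m] times as large add up to [eps]. *)
have e0 : 0 < eps / (m + 1) by rewrite divr_gt0//; lra.
have [w1 [w2 [h1 h2 h3 hK hL]]] := test_field fol DA oDr urL SS oO OV cK KO SO e0.
apply: (@le_trans _ _ ((\int[leb3]_(p in F) (Xf w1 p + Yf w2 p)%:E) + eps%:E)%E); last first.
  by apply: leeD => //; apply: ereal_sup_ubound; exists w1, w2.
have flE := flux_formula dE h1 h2.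
have [IX _] := C1c_XYf_integrable h1; have [_ IY] := C1c_XYf_integrable h2.
pose g p := Xf w1 p + Yf w2 p.
have Ig : leb3.-integrable setT (EFin \o g) by exact: (integrableD measurableT IX IY).
have mg : measurable_fun setT g by have /integrableP[/measurable_EFinP] := Ig.
(* A Borel representative of [F]. On the null set [N] it follows [E], so that it differs from [E]
   only at points of [K]. *)
pose B' := (B `\` N) `|` (E `&` N).
have mB' : measurable B' by apply: measurableU; [exact: measurableD|exact: measurableI].
have BF p : ~ N p -> (F p <-> B' p).
  move=> nN; split=> [Fp|[[Bp _]|[_ //]]].
    by left; split => //; apply: contrapT => nB; apply: nN; apply: FBN; left.
  by apply: contrapT => nF; apply: nN; apply: FBN; right.
have -> : (\int[leb3]_(p in F) (Xf w1 p + Yf w2 p)%:E)%E = (\int[leb3]_(p in B') (g p)%:E)%E.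
  have mgE : measurable_fun setT (fun p => (g p)%:E) by apply/measurable_EFinP.
  exact: (@integral_eq_off_null _ _ _ leb3 F B' N _ _ mN N0 mB' mgE).
have IgA (S : set H) : measurable S -> leb3.-integrable setT (EFin \o (fun p => \1_S p * g p)) /\
    (\int[leb3]_(p in S) (g p)%:E)%E = (\int[leb3]_p (\1_S p * g p))%R%:E.
  move=> mS; have IgS : leb3.-integrable setT (EFin \o (fun p => \1_S p * g p)).
    have mIS : measurable_fun setT (\1_S : H -> R) by exact: measurable_indic.
    have mf : measurable_fun setT (EFin \o (fun p => \1_S p * g p)).
      by apply/measurable_EFinP; exact: (measurable_funM mIS mg).
    apply: (@le_integrable _ _ _ leb3 setT measurableT _ (EFin \o g) mf _ Ig) => p _.
    by rewrite /= lee_fin normrM ler_piMl// indicE; case: (_ \in _); rewrite ?normr1 ?normr0.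
  split => //; rewrite integral_mkcond /Rintegral fineK; last exact: (@integrable_fin_num _ _ _ leb3 setT measurableT _ IgS).
  apply: eq_integral => p _; rewrite patchE indicE.
  by case: ifPn => _; rewrite ?mul1r ?mul0r.
have [IB EB] := IgA _ mB'; have [IE EE] := IgA _ mE.
rewrite EB -EFinD lee_fin.
have {flE} flE : (\int[leb3]_p (\1_E p * g p))%R = (\int[leb2]_q flux w1 w2 q)%R.
  by apply: EFin_inj; rewrite -EE -flE.
have close : `|(\int[leb3]_p (\1_B' p * g p))%R - (\int[leb3]_p (\1_E p * g p))%R| <= eps / (m + 1) * m.
  rewrite -(@RintegralB _ _ _ leb3 setT _ _ measurableT IB IE).
  have Id := @fs_indic_integrable _ _ _ leb3 K mK Kfin.
  have mEq : m = (\int[leb3]_p \1_K p)%R by rewrite (fs_indic_Rintegral leb3 mK).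
  rewrite [X in _ <= _ * X]mEq -(@RintegralZl _ _ _ leb3 setT \1_K _ measurableT Id).
  apply: fs_Rintegral_le; first exact: (integrableB measurableT IB IE).
    exact: (@fs_cst_integrable _ _ _ leb3 K (eps / (m + 1)) mK Kfin).
  move=> p; have eK : 0 <= eps / (m + 1) * \1_K p by rewrite mulr_ge0 ?(ltW e0).
  rewrite -mulrBl !indicE.
  have [EB'|nEB] := pselect (E p <-> B' p).
    rewrite (_ : (p \in B') = (p \in E)) ?subrr ?mul0r ?normr0//.
    by apply/idP/idP => /set_mem ?; apply/mem_set; apply/EB'.
  have Kp : K p.
    apply: (@subset_closure _ ((E `\` F) `|` (F `\` E))).
    have nN : ~ N p by move=> Np; apply: nEB; split => [Ep|[[]//|[]//]]; right.
    have hF := BF _ nN.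
    have [Ep|nE] := pselect (E p); [left|right]; split => //.
      by move=> Fp; apply: nEB; split => // _; exact/hF.
    by apply: contrapT => nF; apply: nEB; split => // /hF.
  rewrite (mem_set Kp) mulr1; apply: le_trans (hK _ Kp).
  by rewrite normrM; case: (_ \in _); case: (_ \in _);
    rewrite ?subrr ?subr0 ?sub0r ?normrN ?normr0 ?normr1 ?mul1r ?mul0r.
have m1 : m + 1 != 0 by rewrite gt_eqF// ltr_wpDl.
have em : eps / (m + 1) * m + eps / (m + 1) = eps.
  by rewrite -[X in _ + X]mulr1 -mulrDr divfK.
have key (a l x y : R) : a - y <= l -> `|x - l| <= y * m -> y * m + y = eps -> a <= x + eps.
  by rewrite ler_norml => al /andP[xl _] <-; lra.
by rewrite flE in close; exact: (key _ _ _ _ hL close em).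
Qed.

Lemma foliated_graph_minimality :
  [/\ AreaH D u = HPer (Egraph D u) (DV D),
    HPer (Egraph D u) (DV D) = HPer (Egraph_r Dr ur) (VD Dr) &
    forall F, leb3_measurable F ->
      cpt_in ((Egraph_r Dr ur `\` F) `|` (F `\` Egraph_r Dr ur)) (VD Dr) ->
      (HPer (Egraph_r Dr ur) (VD Dr) <= HPer F (VD Dr))%E].
Proof.
have cpt0 (E O : set H) : cpt_in ((E `\` E) `|` (E `\` E)) O.
  rewrite setUid setDv; split; rewrite closure0; first exact: compact0.
  exact: sub0set.
have bor (E : set H) : measurable E -> leb3_measurable E.
  move=> mE; exists E, set0; split => //; split; first exact: measurable0.
  by split; [rewrite /leb3 measure0|rewrite setDv setU0].
have [mEu dEu] := left_div; have [mEr dEr] := right_div.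
have SO := Sgraph_sub SS.
have lowR F : leb3_measurable F -> cpt_in ((Egraph_r Dr ur `\` F) `|` (F `\` Egraph_r Dr ur)) (VD Dr) ->
    (slope_area%:E <= HPer F (VD Dr))%E.
  apply: area_le_HPer right_div (open_VD oDr) (@subset_refl _ _) _.
  by move=> p /SO[].
have HR : HPer (Egraph_r Dr ur) (VD Dr) = slope_area%:E.
  apply/eqP; rewrite eq_le (HPer_le_area right_div) lowR//; exact: bor.
have HL : HPer (Egraph D u) (DV D) = slope_area%:E.
  apply/eqP; rewrite eq_le (HPer_le_area left_div)/=.
  (* The test field lives in the right cylinder, so the lower bound is obtained on the overlap of
     the cylinders, which contains the graph; the perimeter only grows with the open set. *)
  have dO : divergence_on (Egraph D u) (DV D `&` VD Dr).
    split => // v [v1 [v2 v3]]; apply: dEu; split => //; split => //.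
    by apply: subset_trans v3 _ => p [].
  have oO := open_common fol oDr.
  apply: (@le_trans _ _ (HPer (Egraph D u) (DV D `&` VD Dr))).
    by apply: (area_le_HPer dO oO (@subIsetr _ _ _) SO) => //; exact: bor.
  apply: le_ereal_sup => _ [v1 [v2 [[h1 [h1' h1'']] [[h2 [h2' h2'']] [h3 ->]]]]].
  exists v1, v2; split; first by split => //; split => // p /h1''[].
  by split; first by split => //; split => // p /h2''[].
by split; [rewrite AreaH_slope HL|rewrite HL HR|move=> F mF cF; rewrite HR; exact: lowR].
Qed.

End perimeters.

(** * Reduction of the theorem to the foliated graph *)

Unset Implicit Arguments.
Set Strict Implicit.

Theorem theorem1p3 (R : realType) (tbar : R) (g1 g2 : R -> R)
    (phi : R * R -> R) (u : R * R -> R) (Dr : set (R * R)) (ur : R * R -> R) :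
  let I := [set s : R | 0 < s < tbar] in
  let Ic := [set s : R | 0 <= s <= tbar] in
  let D := [set q : R * R | 0 < q.2 < tbar /\ g1 q.2 < q.1 < g2 q.2] in
  let bD := closure D `\` interior D in
  let f1 := fun s => phi (g1 s, s) in
  let f2 := fun s => phi (g2 s, s) in
  let zeta := 4 * (Num.max (supnorm I g1) (supnorm I g2)
                    + Num.max (lipconst I g1) (lipconst I g2))
                * (Num.max (supnorm I f1) (supnorm I f2)
                    + Num.max (lipconst I f1) (lipconst I f2)) in
  0 < tbar ->
  lip1_on I g1 -> lip1_on I g2 ->
  {within Ic, continuous g1} -> {within Ic, continuous g2} ->
  (forall s, I s -> g1 s < 0 < g2 s) ->
  g1 0 = 0 -> g1 tbar = 0 -> g2 0 = 0 -> g2 tbar = 0 ->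
  convex2 D ->
  {within bD, continuous phi} ->
  lip1_on I f1 -> lip1_on I f2 ->
  zeta < (Num.sqrt 721 - 25) / 48 ->
  (* u in Lip(D) (extended to the closure), u = phi on bD, S_u = R_phi *)
  lip2_on (closure D) u ->
  (forall q, bD q -> u q = phi q) ->
  Sgraph D u = Rphi tbar g1 g2 f1 f2 ->
  (* D^r open, u^r locally Lipschitz on D^r, S_u = S^r_{u^r} *)
  open Dr ->
  loclip2_on Dr ur ->
  Sgraph D u = Sgraph_r Dr ur ->
  AreaH D u = HPer (Egraph D u) (DV D) /\
  HPer (Egraph D u) (DV D) = HPer (Egraph_r Dr ur) (VD Dr) /\
  (forall F : set (R * R * R), leb3_measurable F ->
     cpt_in ((Egraph_r Dr ur `\` F) `|` (F `\` Egraph_r Dr ur)) (VD Dr) ->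
     (HPer (Egraph_r Dr ur) (VD Dr) <= HPer F (VD Dr))%E).
Proof.
move=> I Ic D bD f1 f2 zeta tbar0 g1L g2L g1c _ g12 g10 g1t g20 g2t _ _ f1L f2L zs uL uphi SR oDr urL SS.
have IE s : I s <-> 0 < s < tbar by [].
have DE q : D q <-> I q.2 /\ g1 q.2 < q.1 < g2 q.2 by [].
have IcE : Ic = `[0, tbar]%classic by apply/seteqP; split => x; rewrite /= in_itv.
rewrite IcE in g1c.
(* [u] is Lipschitz up to the closure of [D], so the extension carries the boundary values [phi]. *)
have [k [U [k0 UL UE]]] := lip2_mcshane uL.
have Uphi q : (closure D `\` interior D) q -> U q = phi q.
  by move=> bq; rewrite -uphi//; apply: UE; case: bq.
have UD q : D q -> U q = u q by move=> Dq; apply: UE; exact: subset_closure.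
have small : 4 * lipconst I g1 * supnorm I f1 < 1.
  have L1 := lipconst_ge0 IE tbar0 g1L; have S1 := supnorm_ge0 IE tbar0 g1L.
  have L2 := lipconst_ge0 IE tbar0 f1L; have S2 := supnorm_ge0 IE tbar0 f1L.
  (* As [27 ^+ 2 = 729], [zeta] is below [2 / 48]; its two factors dominate [lipconst I g1] and
     [supnorm I f1]. *)
  have s721 : Num.sqrt 721 <= 27 :> R.
    rewrite (_ : 27 = Num.sqrt (27 ^+ 2) :> R); last by rewrite sqrtr_sqr ger0_norm.
    by rewrite ler_sqrt; lra.
  apply: (@le_lt_trans _ _ zeta); last by apply: lt_trans zs _; lra.
  rewrite /zeta -mulrA -[leRHS]mulrA ler_wpM2l// ler_pM//.
    by rewrite -[leLHS]add0r lerD// le_max ?S1 ?lexx.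
  by rewrite -[leLHS]addr0 lerD// le_max ?lexx ?L2.
have lf q : D q -> exists b y1 y2, leaf D u q b y1 y2.
  exact: (lens_leaf IE tbar0 g1L g1c g12 g10 g1t DE g20 g2t f1L k0 UL Uphi small SR).
have [A DA] := lens_bounded IE tbar0 g1L g2L DE.
have uM q : D q -> `|u q| <= `|U (0, 0)| + k * A.
  move=> Dq; rewrite -UD//; have := UL q (0, 0); have := lerB_dist (U q) (U (0, 0)).
  have : k * dist2 q (0, 0) <= k * A.
    by rewrite ler_wpM2l ?(ltW k0)// /dist2/= !subr0 ge_max; apply/andP; exact: DA.
  by move=> ? ? ?; lra.
have [b [b0 fol]] := foliation_exists k0 UL UD (lens_open IE g1L g2L DE) uM lf.
have [h1 h2 h3] := foliated_graph_minimality fol DA (lens_scale g12 DE) oDr urL SS.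
by split; [|split].
Qed.
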